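(* Let $\overline{\mathbf P_{\mathrm{DIST}}}$ be the closure of $\mathbf P_{\mathrm{DIST}}$ in $\mathbb R^{\mathbb N}$ under pointwise convergence, and $\overline{\mathbf M_{\mathrm{DIST}}}$ the closure of $\mathbf M_{\mathrm{DIST}}$ in the L\'evy metric. Then $\overline{\mathbf M_{\mathrm{DIST}}}=\mathbf M_{\mathrm{DIST}}\sqcup\{\mathcal N(0,1)\}$, and the map $\Phi_{\mathrm{DIST}}:\overline{\mathbf P_{\mathrm{DIST}}}\to\overline{\mathbf M_{\mathrm{DIST}}}$ given by $\mathbf d\mapsto\mathcal S_{\mathbf d}$ for $\mathbf d\neq\mathbf 0$ and $\mathbf 0\mapsto\mathcal N(0,1)$ is a homeomorphism between (sequentially) compact spaces.
   Context: Finite multisets of nonnegative reals are identified with weakly decreasing sequences padded with zeros in $\mathbb R^{\mathbb N}$; $\mathbf 0$ is the all-zero sequence. For $\mathbf t=(t_1\ge t_2\ge\dots\ge0)$ with $|\mathbf t|_2=(\sum t_k^2)^{1/2}<\infty$, $\mathcal S_{\mathbf t}=\sum_k\mathcal U[-t_k/2,t_k/2]$ with independent summands, and for $\mathbf t\ne\mathbf0$, $\widehat{\mathbf t}=\sqrt{12}\,\mathbf t/|\mathbf t|_2$. The distance multiset of $\mathbf t=\{t_1\ge\cdots\ge t_m\}$ is $\Delta\mathbf t=\{t_i-t_j:1\le i<j\le m\}$. $\mathbf P_{\mathrm{DIST}}=\{\widehat{\Delta\mathbf t}:\mathbf t=\{1=t_1\ge\cdots\ge t_m=0\},m\ge2\}$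 and $\mathbf M_{\mathrm{DIST}}=\{\mathcal S_{\widehat{\Delta\mathbf t}}:\mathbf t=\{1=t_1\ge\cdots\ge t_m=0\},m\ge2\}$, the latter viewed as a set of distributions. The L\'evy metric metrizes convergence in distribution. *)

(* Defs.v *)
From HB Require Import structures.
From mathcomp Require Import all_boot all_order all_algebra finmap.
From mathcomp Require Import all_classical all_reals all_analysis.
From mathcomp Require Import lra.

Set Implicit Arguments.
Unset Strict Implicit.
Unset Printing Implicit Defensive.

Import Order.TTheory GRing.Theory Num.Theory.
Import numFieldNormedType.Exports.

Local Open Scope classical_set_scope.
Local Open Scope ring_scope.

(* The library's measures are total on [set R -> \bar R], with arbitrary values
   on non-Borel sets. A distribution is a Borel probability measure; fixing the
   value 0 off the Borel sets makes Leibniz equality of distributions agree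
   with equality on Borel sets (lemma [law_eqP]). *)
Record law (R : realType) := Law {
  law_prob :> probability (measurableTypeR R) R ;
  law_nmeas : forall A : set (measurableTypeR R), ~ measurable A ->
    law_prob A = 0%E }.

HB.instance Definition _ (R : realType) := gen_eqMixin (law R).
HB.instance Definition _ (R : realType) := gen_choiceMixin (law R).

Section law_of.
Context (R : realType) (P : probability (measurableTypeR R) R).
Local Open Scope ereal_scope.

Definition borel_restr (A : set (measurableTypeR R)) : \bar R :=
  if `[< measurable A >] then P A else 0.

Lemma borel_restrE A : measurable A -> borel_restr A = P A.
Proof. by rewrite /borel_restr => /asboolT ->. Qed.

Let borel_restr0 : borel_restr set0 = 0.
Proof. by rewrite borel_restrE. Qed.

Let borel_restr_ge0 A : 0 <= borel_restr A.
Proof. by rewrite /borel_restr; case: ifP. Qed.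

Let borel_restr_sigma_additive : semi_sigma_additive borel_restr.
Proof.
move=> F mF tF mUF; rewrite borel_restrE//.
under eq_fun do under eq_bigr do rewrite borel_restrE//.
exact: measure_semi_sigma_additive.
Qed.

HB.instance Definition _ := isMeasure.Build _ _ _ borel_restr
  borel_restr0 borel_restr_ge0 borel_restr_sigma_additive.

Let borel_restr_setT : borel_restr setT = 1.
Proof. by rewrite borel_restrE// probability_setT. Qed.

HB.instance Definition _ :=
  Measure_isProbability.Build _ _ R borel_restr borel_restr_setT.

Let borel_restr_nmeas (A : set (measurableTypeR R)) :
  ~ measurable A -> borel_restr A = 0.
Proof. by rewrite /borel_restr => /asboolF ->. Qed.

Definition law_of : law R := Law borel_restr_nmeas.

Lemma law_ofE A : measurable A -> law_of A = P A.
Proof. exact: borel_restrE. Qed.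

End law_of.

Section law_theory.
Context (R : realType).
Implicit Types (mu nu : law R) (x : R).

Lemma eq_probability_fun d (T : measurableType d) (P Q : probability T R) :
  P = Q :> (set T -> \bar R) -> P = Q.
Proof.
case: P Q => [P [[p1 q1] [p2] [p3] [p4] [p5] [p6] [p7]]].
move=> [Q [[p1' q1'] [p2'] [p3'] [p4'] [p5'] [p6'] [p7']]] /= PQ; subst Q.
rewrite (Prop_irrelevance p1' p1) (Prop_irrelevance q1' q1).
rewrite (Prop_irrelevance p2' p2) (Prop_irrelevance p3' p3).
rewrite (Prop_irrelevance p4' p4) (Prop_irrelevance p5' p5).
by rewrite (Prop_irrelevance p6' p6) (Prop_irrelevance p7' p7).
Qed.

Lemma law_eqP mu nu :
  mu = nu <-> forall A : set (measurableTypeR R), measurable A -> mu A = nu A.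
Proof.
split=> [->//|]; case: mu nu => [P P0] [Q Q0] /= PQ.
have {}PQ : P = Q.
  apply: eq_probability_fun; apply/funext => A.
  by have [/PQ//|nA] := pselect (measurable A); rewrite P0 ?Q0.
by subst Q; congr Law; exact: Prop_irrelevance.
Qed.

Definition law_cdf mu x : R := fine (mu `]-oo, x]%classic).

Lemma law_cdf_ge0 mu x : 0 <= law_cdf mu x.
Proof. by rewrite fine_ge0. Qed.

Lemma law_cdf_le1 mu x : law_cdf mu x <= 1.
Proof.
by rewrite -lee_fin fineK ?fin_num_measure//; exact: probability_le1.
Qed.

Lemma law_cdf_homo mu : {homo law_cdf mu : x y / x <= y}.
Proof.
move=> x y xy; rewrite fine_le ?fin_num_measure//.
by rewrite le_measure ?inE//; exact: subitvPr.
Qed.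

Lemma law_cdf_rcont mu : right_continuous (law_cdf mu).
Proof.
move=> x; apply: fine_cvg; rewrite fineK ?fin_num_measure//.
pose idR : measurableTypeR R -> R := idfun.
have midR : measurable_fun setT idR by exact: measurable_id.
pose X : {RV (mu : probability _ R) >-> R} :=
  HB.pack idR (isMeasurableFun.Build _ _ _ _ idR midR).
exact: (@cdf_right_continuous _ _ _ _ X x).
Qed.

Lemma law_cdf_inj mu nu : law_cdf mu = law_cdf nu -> mu = nu.
Proof.
move=> mn; apply/law_eqP => A mA.
have E x : mu `]-oo, x]%classic = nu `]-oo, x]%classic.
  by rewrite -[LHS]fineK ?fin_num_measure// -[RHS]fineK ?fin_num_measure//
    -/(law_cdf mu x) mn.
apply: (@measure_unique _ R (measurableTypeR R)
  [set A | exists x : R, A = `]x, +oo[%classic]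
  (fun n => `](- n%:R : R), +oo[%classic)) => //.
- exact: measurable_realfun.RGenOInfty.measurableE.
- move=> _ _ [x ->] [y ->]; exists (Num.max x y); apply/seteqP; split => z /=;
    rewrite !in_itv/= !andbT gt_max; first by case=> -> ->.
  by move=> /andP[].
- by move=> n; exists (- n%:R).
- apply/seteqP; split => // x _; exists (Num.bound `|x|) => //=.
  by rewrite in_itv/= andbT ltrNl (le_lt_trans (ler_norm _))// normrN archi_boundP.
- move=> _ [x ->]; have -> : `]x, +oo[%classic = ~` `]-oo, x]%classic.
    by rewrite setCitvl.
  have mC (m : law R) : m (~` `]-oo, x]%classic) = (1 - m `]-oo, x]%classic)%E.
    exact: probability_setC.
  by apply: (etrans (mC mu)); rewrite E; exact/esym/mC.
- by move=> n; rewrite (le_lt_trans (probability_le1 mu _))// ltry.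
Qed.

Definition levy_set mu nu : set R :=
  [set e | 0 < e /\ forall x, law_cdf mu (x - e) - e <= law_cdf nu x
                              <= law_cdf mu (x + e) + e].

Definition levy_dist mu nu : R := inf (levy_set mu nu).

Lemma levy_set_has_inf mu nu : has_inf (levy_set mu nu).
Proof.
split; last by exists 0 => e [/ltW].
exists 1; split => // x; apply/andP; split.
  by rewrite (@le_trans _ _ 0) ?law_cdf_ge0// subr_le0 law_cdf_le1.
by rewrite (@le_trans _ _ 1) ?law_cdf_le1// lerDr law_cdf_ge0.
Qed.

Lemma levy_dist_ge0 mu nu : 0 <= levy_dist mu nu.
Proof.
by apply: lb_le_inf; [case: (levy_set_has_inf mu nu)|move=> e [/ltW]].
Qed.

Lemma levy_distP mu nu e : levy_dist mu nu < e ->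
  exists2 e', levy_set mu nu e' & e' < e.
Proof. by move=> /inf_lt -/(_ (levy_set_has_inf mu nu).1)[e' ? ?]; exists e'. Qed.

Lemma levy_dist_le mu nu e : levy_set mu nu e -> levy_dist mu nu <= e.
Proof. by apply: ge_inf; case: (levy_set_has_inf mu nu). Qed.

Lemma levy_distxx mu : levy_dist mu mu = 0.
Proof.
apply/eqP; rewrite eq_le levy_dist_ge0 andbT.
apply/ler_addgt0Pl => e e0; rewrite addr0; apply: levy_dist_le; split=> // x.
apply/andP; split.
  by rewrite lerBlDr; apply: ler_wpDr; [exact: ltW|
    apply: law_cdf_homo; rewrite gerBl ltW].
by apply: ler_wpDr; [exact: ltW|apply: law_cdf_homo; rewrite lerDl ltW].
Qed.

Lemma levy_set_sym mu nu e : levy_set mu nu e -> levy_set nu mu e.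
Proof.
move=> [e0 H]; split => // x; apply/andP; split.
  by have /andP[_] := H (x - e); rewrite subrK lerBlDr.
by have /andP[+ _] := H (x + e); rewrite addrK lerBlDr.
Qed.

Lemma levy_dist_sym mu nu : levy_dist mu nu = levy_dist nu mu.
Proof. by congr inf; apply/seteqP; split => e; exact: levy_set_sym. Qed.

Lemma levy_dist_triangle nu mu xi :
  levy_dist mu xi <= levy_dist mu nu + levy_dist nu xi.
Proof.
apply/ler_addgt0Pl => e e0.
have [a [a0 Ha] ae] : exists2 a, levy_set mu nu a & a < levy_dist mu nu + e / 2.
  by apply: levy_distP; rewrite ltrDl divr_gt0.
have [b [b0 Hb] be] : exists2 b, levy_set nu xi b & b < levy_dist nu xi + e / 2.
  by apply: levy_distP; rewrite ltrDl divr_gt0.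
apply: (@le_trans _ _ (a + b)); last first.
  by rewrite (le_trans (lerD (ltW ae) (ltW be)))// addrACA -splitr addrC.
apply: levy_dist_le; split; first exact: addr_gt0.
move=> x; have /andP[b1 b2] := Hb x.
have /andP[a1 _] := Ha (x - b); have /andP[_ a2] := Ha (x + b).
rewrite (_ : x - (a + b) = x - b - a); last by rewrite opprD addrA addrAC.
rewrite (_ : x + (a + b) = x + b + a); last by rewrite addrA addrAC.
by apply/andP; split; lra.
Qed.

Lemma levy_dist_positivity mu nu : levy_dist mu nu = 0 -> mu = nu.
Proof.
suff le m n x : levy_dist m n = 0 -> law_cdf n x <= law_cdf m x.
  move=> d0; apply: law_cdf_inj; apply/funext => x; apply/eqP.
  by rewrite eq_le !le// levy_dist_sym.
move=> levy0; apply/ler_addgt0Pl => e e0.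
have e20 : 0 < e / 2 by rewrite divr_gt0.
have /cvgrPdist_lt/(_ _ e20)[d /= d0 Hd] := @law_cdf_rcont m x.
have [a [a0 Ha]] : exists2 a, levy_set m n a & a < Num.min d (e / 2).
  by apply: levy_distP; rewrite levy0 lt_min d0.
rewrite lt_min => /andP[ad ae].
have /andP[_ /le_trans] := Ha x; apply.
have := Hd (x + a); rewrite /ball_/= opprD addNKr normrN gtr0_norm//.
rewrite ltrDl => /(_ ad a0); rewrite distrC => /(le_lt_trans (ler_norm _)).
rewrite ltrBlDr => /ltW H.
by rewrite (le_trans (lerD H (ltW ae)))// addrAC -splitr.
Qed.

HB.instance Definition _ := isMetric.Build R (law R)
  levy_distxx levy_dist_positivity levy_dist_sym levy_dist_triangle.

End law_theory.

Definition mutually_independent d (T : measurableType d) (R : realType)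
    (P : probability T R) (X : nat -> {RV P >-> R}) :=
  forall (J : {fset nat}) (A : nat -> set R), (forall k, measurable (A k)) ->
    P (\bigcap_(k in [set` J]) X k @^-1` A k) =
    (\prod_(k <- J) P (X k @^-1` A k))%E.

(* U[-t/2, t/2], for t >= 0; it is the Dirac mass at 0 when t = 0. *)
Definition centered_uniform (R : realType) (t : R) :
    probability (measurableTypeR R) R :=
  match pselect (- (t / 2) < t / 2) with
  | left ab => uniform_prob ab
  | right _ => @dirac _ (measurableTypeR R) 0 R
  end.

Section uniform_sums.
Context (R : realType).
Implicit Types (t : nat -> R) (mu : law R).

(* For a square-summable t, independent X k ~ U[-t_k/2, t_k/2] have an almost
   surely convergent sum. *)
Definition is_uniform_sum_law t mu :=
  exists (d : measure_display) (T : measurableType d) (P : probability T R)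
    (X : nat -> {RV P >-> R}) (S : {RV P >-> R}),
  [/\ mutually_independent X,
      forall k (A : set R), measurable A ->
        distribution P (X k) A = centered_uniform (t k) A,
      {ae P, forall w, \sum_(0 <= k < n) X k w @[n --> \oo] --> S w} &
      forall A : set R, measurable A -> distribution P S A = mu A].

(* The distribution of S_t; the default value \d_0 is only there to make it a
   total function. *)
Definition uniform_sum_law t : law R :=
  xget (law_of (@dirac _ (measurableTypeR R) 0 R)) [set mu | is_uniform_sum_law t mu].

Definition std_normal : law R := law_of (normal_prob 0 1).

End uniform_sums.

Section distance_multisets.
Context (R : realType).
Implicit Types (s t : seq R) (u : nat -> R).

(* A finite multiset of nonnegative reals, listed in any order, as a weakly
   decreasing sequence padded with zeros. *)
Definition multiset_seq s : nat -> R := nth 0 (sort >=%R s).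

Definition l2norm u : R := Num.sqrt (limn (series (fun k => u k ^+ 2))).

Definition hat u : nat -> R := fun k => Num.sqrt 12 * u k / l2norm u.

Definition distance_multiset t : nat -> R :=
  multiset_seq [seq t`_i - t`_j | j <- iota 0 (size t), i <- iota 0 j].

Definition unit_span_multiset t :=
  [/\ (2 <= size t)%N, sorted >=%R t, t`_0 = 1 & t`_(size t).-1 = 0].

Definition P_DIST : set {ptws nat -> R} :=
  [set hat (distance_multiset t) | t in unit_span_multiset].

Definition M_DIST : set (law R) :=
  [set uniform_sum_law (hat (distance_multiset t)) | t in unit_span_multiset].

Definition Phi_DIST (u : {ptws nat -> R}) : law R :=
  if `[< u = (fun=> 0) >] then std_normal R else uniform_sum_law u.

End distance_multisets.
Arguments P_DIST R : clear implicits.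
Arguments M_DIST R : clear implicits.

Definition homeomorphism_on (X Y : topologicalType) (A : set X) (B : set Y)
    (f : X -> Y) :=
  [/\ set_bij A B f,
      {within A, continuous f} &
      exists2 g : Y -> X,
        (forall x, A x -> g (f x) = x) & {within B, continuous g}].

Definition seq_compact (X : topologicalType) (A : set X) :=
  forall u : nat -> X, (forall n, A (u n)) ->
  exists2 phi : nat -> nat, {homo phi : m n / (m < n)%N} &
  exists2 l, A l & u \o phi @ \oo --> l.

(* Main.v *)
Require Import Defs.
From HB Require Import structures.
From mathcomp Require Import all_boot all_order all_algebra finmap.
From mathcomp Require Import all_classical all_reals all_analysis.
From mathcomp Require Import measurable_realfun ring lra.

Set Implicit Arguments.
Unset Strict Implicit.
Unset Printing Implicit Defensive.

Import Order.TTheory GRing.Theory Num.Theory.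
Import numFieldNormedType.Exports.

Local Open Scope classical_set_scope.
Local Open Scope ring_scope.

(** Every normalised distance multiset has [|d|_2^2 = 12], and the span [1]
    together with [m] points forces the unnormalised sum of squares to be at
    least of order [m]: hence [d_1] bounded away from [0] bounds [m], and the
    pointwise closure of the normalised multisets only adds [0] and is compact.

    The map to laws is continuous at nonzero points because only finitely many
    coordinates matter there, and at [0] by the Lindeberg replacement argument:
    averaging operators [f |-> E f(x + X)] commute with each other and are
    contractions, so the uniform summands can be exchanged one at a time for
    normal ones of the same variance, at a cost controlled by [d_1] when the
    test function is a smooth (logistic) step; such steps control the Levy
    distance.

    It is injective because the Laplace transform of [S_d] is the product of
    the [sinh(l d_k / 2) / (l d_k / 2)], whose growth as [l] tends to infinity
    determines the [d_k] one by one, while the normal law has unbounded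
    support. A continuous injection from a compact space to a metric space is
    a homeomorphism onto its (closed) image. *)

(** Three choices shape the development. All integrands are nonnegative and extended-real valued, so
    that Tonelli's theorem and additivity need no integrability; a signed Taylor coefficient is
    split into its two parts, each placed on the side of the inequality where it is nonnegative. The
    logistic function is chosen as smooth step because its derivatives are polynomials in itself:
    the third derivative is bounded by inspection, and the tails are exponential. Infinite sums of
    random variables never need to be constructed: a nonzero point of the closure is again a
    normalised distance multiset, hence finitely supported. The quantitative source is
    [u k ^+ 2 <= 48 / m] for [m] points: distances are at most 1, their squares sum to at least
    [m / 4], and normalisation multiplies squares by 12 over that sum. Near a nonzero point only
    finitely many [m] can occur, and each contributes a compact set. For injectivity, positive
    arguments of the Laplace transform suffice, so no inversion theorem is needed. *)

Section smoothing.
Context (R : realType).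
Local Notation mR := (measurableTypeR R).
Local Open Scope ereal_scope.
Implicit Types (mu nu : probability mR R) (f g : R -> \bar R).

Definition smooth mu f (x : R) : \bar R := \int[mu]_y f (x + y)%R.

Definition smooths (ms : seq (probability mR R)) f : R -> \bar R :=
  foldr smooth f ms.

Lemma measurable_shift f x :
  measurable_fun setT f -> measurable_fun setT (fun y : R => f (x + y)%R).
Proof. by move=> mf; apply: measurableT_comp => //; exact: measurable_funD. Qed.

Let measurable_add2 f :
  measurable_fun setT f ->
  measurable_fun setT (fun z : R * R => f (z.1 + z.2)%R).
Proof. by move=> mf; apply: measurableT_comp => //; exact: measurable_funD. Qed.

Lemma smooth_ge0 mu f : (forall x, 0 <= f x) -> forall x, 0 <= smooth mu f x.
Proof. by move=> f0 x; apply: integral_ge0. Qed.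

Lemma measurable_smooth mu f : measurable_fun setT f -> (forall x, 0 <= f x) ->
  measurable_fun setT (smooth mu f).
Proof.
move=> mf f0.
apply: (@measurable_fun_fubini_tonelli_F _ _ mR mR R mu
  (fun z : R * R => f (z.1 + z.2)%R)) => //.
exact: measurable_add2.
Qed.

(** Tonelli, and commutativity of the addition inside [f]. *)
Lemma smoothC mu nu f : measurable_fun setT f -> (forall x, 0 <= f x) ->
  smooth mu (smooth nu f) = smooth nu (smooth mu f).
Proof.
move=> mf f0; apply/funext => x; rewrite /smooth.
have mg : measurable_fun setT (fun z : R * R => f (x + z.1 + z.2)%R).
  apply: measurableT_comp => //; apply: measurable_funD => //.
  exact: measurable_funD.
rewrite (@fubini_tonelli _ _ _ _ _ mu nu _ mg)//.
apply: eq_integral => y _; apply: eq_integral => z _ /=.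
by rewrite addrAC.
Qed.

Lemma le_smooth mu f g : measurable_fun setT f -> (forall x, 0 <= f x) ->
  measurable_fun setT g -> (forall x, f x <= g x) ->
  forall x, smooth mu f x <= smooth mu g x.
Proof.
by move=> mf f0 mg fg x; apply: ge0_le_integral => //; exact: measurable_shift.
Qed.

Lemma smoothDr mu f (c : R) : measurable_fun setT f -> (forall x, 0 <= f x) ->
  (0 <= c)%R -> forall x, smooth mu (fun x => f x + c%:E) x = smooth mu f x + c%:E.
Proof.
move=> mf f0 c0 x; rewrite /smooth ge0_integralD//; last exact: measurable_shift.
by rewrite integral_cst//= probability_setT mule1.
Qed.

Lemma smooths_ge0 ms f : (forall x, 0 <= f x) -> forall x, 0 <= smooths ms f x.
Proof. by move=> f0; elim: ms => //= m ms IH; exact: smooth_ge0. Qed.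

Lemma measurable_smooths ms f : measurable_fun setT f -> (forall x, 0 <= f x) ->
  measurable_fun setT (smooths ms f).
Proof.
move=> mf f0; elim: ms => //= m ms IH.
by apply: measurable_smooth => //; exact: smooths_ge0.
Qed.

Lemma smooths_smoothC ms mu f : measurable_fun setT f -> (forall x, 0 <= f x) ->
  smooths ms (smooth mu f) = smooth mu (smooths ms f).
Proof.
move=> mf f0; elim: ms => //= m ms ->.
by rewrite smoothC//; [exact: measurable_smooths|exact: smooths_ge0].
Qed.

Lemma le_smooths ms f g : measurable_fun setT f -> (forall x, 0 <= f x) ->
  measurable_fun setT g -> (forall x, 0 <= g x) -> (forall x, f x <= g x) ->
  forall x, smooths ms f x <= smooths ms g x.
Proof.
move=> mf f0 mg g0 fg; elim: ms => //= m ms IH.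
by apply: le_smooth => //; try exact: measurable_smooths; exact: smooths_ge0.
Qed.

Lemma smoothsDr ms f (c : R) : measurable_fun setT f -> (forall x, 0 <= f x) ->
  (0 <= c)%R -> smooths ms (fun x => f x + c%:E) = (fun x => smooths ms f x + c%:E).
Proof.
move=> mf f0 c0; elim: ms => //= m ms ->; apply/funext => x.
by rewrite smoothDr//; [exact: measurable_smooths|exact: smooths_ge0].
Qed.

(* The smoothing operators commute and are contractions for the sup distance,
   so their products can be compared one factor at a time. *)
Lemma le_smooths_sum (I : eqType) (s : seq I) (M N : I -> probability mR R)
    (c : I -> R) f : measurable_fun setT f -> (forall x, 0 <= f x) ->
  (forall i, (0 <= c i)%R) ->
  (forall i x, i \in s -> smooth (M i) f x <= smooth (N i) f x + (c i)%:E) ->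
  forall x, smooths (map M s) f x <=
            smooths (map N s) f x + (\sum_(i <- s) c i)%:E.
Proof.
move=> mf f0 c0; elim: s => [|i s IH] H x /=; first by rewrite big_nil adde0.
have {}IH : forall x, smooths (map M s) f x <=
            smooths (map N s) f x + (\sum_(i <- s) c i)%:E.
  by apply: IH => j y js; apply: H; rewrite in_cons js orbT.
have C0 : (0 <= \sum_(i <- s) c i)%R by apply: sumr_ge0.
have mM L := measurable_smooths (map L s) mf f0.
have M0 L := smooths_ge0 (map L s) f0.
apply: (@le_trans _ _ (smooth (M i) (smooths (map N s) f) x +
    (\sum_(i <- s) c i)%:E)).
  rewrite -smoothDr//; apply: le_smooth => //.
  exact: emeasurable_funD.
rewrite big_cons EFinD addeA leeD2r//.
(* The hypothesis compares [M i] and [N i] on [f] itself only, so the factor of index [i] is moved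
   innermost, next to [f], before it is exchanged. *)
rewrite -!smooths_smoothC//.
have H' y : smooth (M i) f y <= smooth (N i) f y + (c i)%:E.
  by apply: H; rewrite mem_head.
have := @smoothsDr (map N s) (smooth (N i) f) (c i).
move=> /(_ (measurable_smooth _ mf f0) (smooth_ge0 _ f0) (c0 i)).
move=> /(congr1 (@^~ x)) <-.
apply: le_smooths => //.
- exact: measurable_smooth.
- exact: smooth_ge0.
- by apply: emeasurable_funD => //; exact: measurable_smooth.
- by move=> y; rewrite adde_ge0 ?lee_fin//; exact: smooth_ge0.
Qed.

End smoothing.

(** * Laws of partial sums of independent random variables *)

Section independent_sums.
Context (R : realType) d (T : measurableType d) (P : probability T R).
Local Notation mR := (measurableTypeR R).
Local Open Scope ereal_scope.

(* The measurable structures of [R] and [measurableTypeR R] have the same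
   measurable sets but different displays. *)
Definition to_RV (f : T -> R) (mf : measurable_fun setT f) : {RV P >-> mR} :=
  HB.pack (f : T -> mR)
    (isMeasurableFun.Build _ _ T mR (f : T -> mR)
      (mf : measurable_fun setT (f : T -> mR))).

Lemma measurable_preimage (f : T -> R) (A : set R) :
  measurable_fun setT f -> measurable A -> measurable (f @^-1` A).
Proof. by move=> mf mA; rewrite -[_ @^-1` _]setTI; exact: mf. Qed.

(** Conditioned on [E], the pair has a law that agrees with the product measure on rectangles, hence
    everywhere. The event [E] is carried along because the induction on partial sums must keep the
    later variables in play. *)
Lemma indep_pair_prob (Y Z : {RV P >-> mR}) (E : set T) : measurable E ->
  (forall A B : set mR, measurable A -> measurable B ->
     P (Y @^-1` A `&` (Z @^-1` B `&` E)) = P (Y @^-1` A) * P (Z @^-1` B) * P E) ->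
  forall D : set (mR * mR), measurable D ->
    P ((fun w => (Y w, Z w)) @^-1` D `&` E) =
    (distribution P Y \x distribution P Z) D * P E.
Proof.
move=> mE H D mD.
have mYZ : measurable_fun setT (fun w => (Y w, Z w)).
  exact: measurable_fun_pair.
have mYZD (D' : set (mR * mR)) : measurable D' ->
    measurable ((fun w => (Y w, Z w)) @^-1` D').
  by move=> mD'; rewrite -[_ @^-1` _]setTI; exact: mYZ.
(* Conditioning divides by [P E], so a null [E] is treated apart; both sides then vanish. *)
have [PE0|PE0] := eqVneq (P E) 0.
  rewrite PE0 mule0; apply/eqP; rewrite -measure_le0 -PE0.
  by apply: le_measure; rewrite ?inE//; apply: measurableI => //; exact: mYZD.
have PEfin : P E \is a fin_num by exact: fin_num_measure.
have c0 : (0 <= (fine (P E))^-1)%R by rewrite invr_ge0 fine_ge0.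
have PEV : ((fine (P E))^-1)%:E * P E = 1.
  by rewrite -{2}(fineK PEfin) -EFinM mulVf// fine_eq0.
pose phi : {mfun T >-> (mR * mR)%type} :=
  HB.pack (fun w => (Y w, Z w)) (isMeasurableFun.Build _ _ _ _ _ mYZ).
have [m mDE] : exists m : {measure set (mR * mR)%type -> \bar R},
    forall A, m A = ((fine (P E))^-1)%:E * P (phi @^-1` A `&` E).
  by unshelve eexists (mscale (NngNum c0) (pushforward (mrestr P mE) phi)).
have := @product_measure_unique _ _ mR mR R (distribution P Y)
  (distribution P Z) m _ D mD.
rewrite mDE => ->.
  by rewrite muleAC PEV mul1e.
move=> A B mA mB; rewrite mDE.
rewrite (_ : phi @^-1` _ `&` E = Y @^-1` A `&` (Z @^-1` B `&` E)).
  by rewrite H// muleC -muleA [P E * _]muleC PEV mule1.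
by apply/seteqP; split => w /= => [[[]]|[? []]].
Qed.

Lemma indep_pair_integral (Y Z : {RV P >-> mR}) (f : R -> \bar R) :
  (forall A B : set mR, measurable A -> measurable B ->
     P (Y @^-1` A `&` Z @^-1` B) = P (Y @^-1` A) * P (Z @^-1` B)) ->
  measurable_fun setT f -> (forall x, 0 <= f x) ->
  \int[P]_w f (Y w + Z w)%R =
  \int[distribution P Y]_y smooth (distribution P Z) f y.
Proof.
move=> H mf f0.
have mYZ : measurable_fun setT (fun w => (Y w, Z w)).
  exact: measurable_fun_pair.
pose g (z : mR * mR) := f (z.1 + z.2)%R.
have mg : measurable_fun setT g.
  by apply: measurableT_comp => //; exact: measurable_funD.
transitivity (\int[distribution P Y \x distribution P Z]_z g z).
  pose phi : {RV P >-> (mR * mR)%type} :=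
    HB.pack (fun w => (Y w, Z w)) (isMeasurableFun.Build _ _ _ _ _ mYZ).
  transitivity (\int[distribution P phi]_z g z).
    by rewrite ge0_integral_distribution// => z; exact: f0.
  apply: eq_measure_integral => D mD _.
  have := @indep_pair_prob Y Z setT measurableT _ D mD.
  rewrite setIT probability_setT mule1; apply => A B mA mB.
  by rewrite setIT mule1 H.
by rewrite fubini_tonelli1// => z; exact: f0.
Qed.

Context (X : nat -> {RV P >-> R}).

Definition partial_sum n w : R := (\sum_(0 <= k < n) X k w)%R.

Lemma measurable_partial_sum n : measurable_fun setT (partial_sum n).
Proof. by apply: measurable_sum => k. Qed.

Hypothesis indepX : mutually_independent X.

Let event (J : {fset nat}) (A : nat -> set R) : set T :=
  \bigcap_(k in [set` J]) X k @^-1` A k.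

Let mevent J A : (forall k, measurable (A k)) -> measurable (event J A).
Proof.
move=> mA; apply: fin_bigcap_measurable => [|k _]; first exact: finite_fset.
exact: measurable_preimage.
Qed.

Let eventU J A n B : n \notin J ->
  event (n |` J)%fset (fun k => if k == n then B else A k) =
  X n @^-1` B `&` event J A.
Proof.
move=> nJ; apply/seteqP; split => w.
  move=> H; split.
    by have := H n; rewrite /= !inE eqxx/=; exact.
  move=> k /= kJ; have := H k; rewrite /= !inE kJ orbT => /(_ isT).
  by case: eqP => // kn; move: nJ; rewrite -kn kJ.
move=> [Hn HJ] k /=; rewrite !inE => /predU1P[->|kJ]; first by rewrite eqxx.
have := HJ k kJ.
by case: eqP => // kn; move: nJ; rewrite -kn kJ.
Qed.

Let prob_event J A n B : n \notin J -> measurable B ->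
    (forall k, measurable (A k)) ->
  P (X n @^-1` B `&` event J A) = P (X n @^-1` B) * P (event J A).
Proof.
move=> nJ mB mA; rewrite -eventU// indepX; last by move=> k; case: ifP.
rewrite big_fsetU1//= eqxx; congr (_ * _); rewrite indepX//.
apply: eq_big_seq => k kJ; case: eqP => // kn.
by move: nJ; rewrite -kn kJ.
Qed.

(** Induction on [n] for all [J] at once: the summand [X n] is first absorbed into the event, where
    the induction hypothesis applies to the shorter sum, and the pair (shorter sum, [X n]) is then
    independent of the remaining event. *)
Lemma partial_sum_indep n (J : {fset nat}) (A : nat -> set R) (B : set R) :
  (forall k, k \in J -> (n <= k)%N) -> (forall k, measurable (A k)) ->
  measurable B ->
  P (partial_sum n @^-1` B `&` event J A) =
  P (partial_sum n @^-1` B) * P (event J A).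
Proof.
elim: n J A B => [|n IH] J A B nJ mA mB.
  have -> : partial_sum 0 = cst 0%R by apply/funext => w; rewrite /partial_sum big_nil.
  rewrite preimage_cst; case: ifPn => _.
    by rewrite setTI probability_setT mul1e.
  by rewrite set0I measure0 mul0e.
have nnJ : n \notin J by apply/negP => /nJ; rewrite ltnn.
have mS := measurable_partial_sum n.
have mX : measurable_fun setT (X n) by [].
pose D : set (mR * mR) := [set z | B (z.1 + z.2)%R].
have mD : measurable D.
  rewrite -[D]setTI; apply: (_ : measurable_fun setT (fun z : mR * mR => z.1 + z.2 : mR)%R) => //.
  exact: measurable_funD.
have SE : partial_sum n.+1 @^-1` B = (fun w => (to_RV mS w, to_RV mX w)) @^-1` D.
  apply/seteqP; split => w /=; by rewrite /D /partial_sum/= big_nat_recr.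
have HH K C A' B' : (forall k, k \in K -> (n < k)%N) -> (forall k, measurable (C k)) ->
    measurable A' -> measurable B' ->
    P (partial_sum n @^-1` A' `&` (X n @^-1` B' `&` event K C)) =
    P (partial_sum n @^-1` A') * P (X n @^-1` B') * P (event K C).
  move=> nK mC mA' mB'.
  have nnK : n \notin K by apply/negP => /nK; rewrite ltnn.
  rewrite -eventU// IH//; last by move=> k; case: ifP.
    by rewrite eventU// prob_event// muleA.
  by move=> k; rewrite !inE => /predU1P[->//|/nK/ltnW].
rewrite SE (indep_pair_prob (mevent _ mA)) => //; last first.
  by move=> A' B' mA' mB'; exact: HH.
congr (_ * _).
(* The same factorisation with the trivial event identifies the product measure of [D] with the
   probability that the longer sum lies in [B]. *)
have := @indep_pair_prob (to_RV mS) (to_RV mX) setT measurableT _ D mD.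
rewrite setIT probability_setT mule1 => -> // A' B' mA' mB'.
rewrite setIT mule1.
have := HH fset0 (fun=> setT) A' B'.
have -> : event fset0 (fun=> setT) = setT.
  by rewrite /event; apply/seteqP; split => // w _ k /=; rewrite inE.
by rewrite setIT probability_setT mule1; apply.
Qed.

(** The last summand is integrated out first, which replaces [f] by its smoothing; hence the
    induction is for all [f]. *)
Lemma integral_partial_sum (m : nat -> probability mR R) n (f : R -> \bar R) :
  (forall k (A : set R), measurable A -> distribution P (X k) A = m k A) ->
  measurable_fun setT f -> (forall x, 0 <= f x) ->
  \int[P]_w f (partial_sum n w) = smooths [seq m k | k <- iota 0 n] f 0%R.
Proof.
move=> Xm; elim: n f => [|n IH] f mf f0.
  under eq_integral do rewrite /partial_sum big_nil.
  by rewrite integral_cst//= probability_setT mule1.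
have mS := measurable_partial_sum n.
have mX : measurable_fun setT (X n) by [].
have mm : smooth (distribution P (to_RV mX)) f = smooth (m n) f.
  by apply/funext => x; apply: eq_measure_integral => A mA _; exact: Xm.
transitivity (\int[P]_w f (to_RV mS w + to_RV mX w)%R).
  by apply: eq_integral => w _; rewrite /= {1}/partial_sum big_nat_recr.
rewrite indep_pair_integral//; last first.
  move=> A B mA mB.
  have := @partial_sum_indep n [fset n]%fset (fun=> B) A.
  rewrite /event set_fset1 bigcap_set1; apply => // k.
  by rewrite inE => /eqP ->.
rewrite mm ge0_integral_distribution; last 2 first.
  exact: measurable_smooth.
  exact: smooth_ge0.
rewrite IH; last 2 first.
  exact: measurable_smooth.
  exact: smooth_ge0.
rewrite -addn1 iotaD map_cat/= add0n /smooths foldr_cat/=.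
by [].
Qed.

End independent_sums.

(** * Existence and uniqueness of the law of a finite uniform sum *)

Section uniform_sum_laws.
Context (R : realType).
Local Notation mR := (measurableTypeR R).
Local Open Scope ereal_scope.

Lemma centered_uniform0 : centered_uniform (0 : R) = @dirac _ mR 0%R R.
Proof.
rewrite /centered_uniform; case: pselect => // h; exfalso; move: h.
by rewrite mul0r oppr0 ltxx.
Qed.

(** From index [n] on the summands have law Dirac at 0, so outside countably many null sets they
    vanish and the limit of the series is the [n]-th partial sum. *)
Lemma integral_uniform_sum_law (u : nat -> R) n (mu : law R) (f : R -> \bar R) :
  (forall k, (n <= k)%N -> u k = 0%R) -> is_uniform_sum_law u mu ->
  measurable_fun setT f -> (forall x, 0 <= f x) ->
  \int[mu]_x f x = smooths [seq centered_uniform (u k) | k <- iota 0 n] f 0%R.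
Proof.
move=> u0 [d [T [P [X [S [indX distX aeS distS]]]]]] mf f0.
have mS : measurable_fun setT S by [].
transitivity (\int[distribution P (to_RV P mS)]_x f x).
  by apply: eq_measure_integral => A mA _; exact/esym/distS.
rewrite ge0_integral_distribution//.
rewrite -(integral_partial_sum indX)//.
have mpS := measurable_partial_sum X n.
apply: ge0_ae_eq_integral => //; try exact: measurableT_comp.
  by move=> w _; exact: f0.
have aeX : {ae P, forall w k, (n <= k)%N -> X k w = 0%R}.
  apply/ae_foralln => k.
  have [nk|nk] := leqP n k; last exact/aeW.
  have mD : measurable (X k @^-1` (~` [set 0%R])).
    by apply: measurable_preimage => //; apply: measurableC.
  exists (X k @^-1` (~` [set 0%R])); split => //.
    apply: (etrans (distX k (~` [set 0%R]) _)); first exact: measurableC.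
    by rewrite u0// centered_uniform0/= diracE memNset//= => /(_ erefl).
  by move=> w /= H Xkw; apply: H => _; exact: Xkw.
apply: filterS2 aeX aeS => w Xw Sw _ /=; congr f.
suff : (\sum_(0 <= k < m) X k w)%R @[m --> \oo] --> partial_sum X n w.
  by move=> /(cvg_unique _ Sw); apply.
apply: cvg_near_cst; exists n => // m /= nm; rewrite /partial_sum.
rewrite (big_cat_nat (n := n))//= [X in (_ + X)%R]big_nat_cond.
by rewrite [X in (_ + X)%R]big1 ?addr0// => k /andP[/andP[/Xw]].
Qed.

Lemma uniform_sum_law_uniq (u : nat -> R) n (mu nu : law R) :
  (forall k, (n <= k)%N -> u k = 0%R) -> is_uniform_sum_law u mu ->
  is_uniform_sum_law u nu -> mu = nu.
Proof.
move=> u0 Hmu Hnu; apply/law_eqP => A mA.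
have H xi : is_uniform_sum_law u xi -> xi A =
    smooths [seq centered_uniform (u k) | k <- iota 0 n] (EFin \o \1_A) 0%R.
  move=> Hxi; rewrite -(integral_uniform_sum_law u0 Hxi).
  - by rewrite integral_indic// setIT.
  - by apply/measurable_EFinP; exact: measurable_indic.
  - by move=> x; rewrite /= lee_fin.
by rewrite (H mu)// (H nu).
Qed.

(** Each induction step adjoins one factor to the probability space by a product measure. The
    definition of the law asks for an infinite family; the variables past [n] are constantly 0,
    which keeps them independent of everything and gives them the uniform law of width 0. *)
Lemma independent_family_exists n (m : nat -> probability mR R) :
  exists (d : measure_display) (T : measurableType d) (P : probability T R)
    (X : nat -> {RV P >-> R}),
  [/\ mutually_independent X,
      forall k (A : set R), (k < n)%N -> measurable A ->
        distribution P (X k) A = m k A &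
      forall k w, (n <= k)%N -> X k w = 0%R].
Proof.
elim: n => [|n [d [T [P [X [indX distX X0]]]]]].
  pose P : probability mR R := @dirac _ mR 0%R R.
  have mX : measurable_fun setT (cst 0%R : mR -> R) by [].
  pose X (k : nat) : {RV P >-> R} :=
    HB.pack (cst 0%R : mR -> R) (isMeasurableFun.Build _ _ _ _ _ mX).
  exists _, mR, P, X; split => // J A mA.
  (* All variables are the constant 0, so every event is full or empty. *)
  have [H|/existsNP[k /not_implyP[kJ nA]]] :=
      pselect (forall k, k \in J -> A k 0%R).
    have XA k : k \in J -> X k @^-1` A k = setT.
      by move=> /H Ak; apply/seteqP; split.
    rewrite (_ : \bigcap_(k in _) _ = setT).
      rewrite probability_setT big_seq big1// => k /XA ->.
      exact: probability_setT.
    by apply/seteqP; split => // w _ k kJ; rewrite XA.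
  have XA : X k @^-1` A k = set0 by apply/seteqP; split.
  rewrite (_ : \bigcap_(k in _) _ = set0).
    by rewrite measure0 (big_fsetD1 k)//= XA measure0 mul0e.
  by apply/seteqP; split => // w /(_ k kJ); rewrite XA.
pose P' : probability (T * mR)%type R := (P \x m n)%E.
pose Y k (z : T * mR) : R := if k == n then z.2 else X k z.1.
have mY k : measurable_fun setT (Y k).
  rewrite /Y; case: eqP => _; last exact: measurableT_comp.
  exact: measurable_snd.
pose X' k : {RV P' >-> R} :=
  HB.pack (Y k) (isMeasurableFun.Build _ _ _ _ _ (mY k)).
have X'n (A : set R) : X' n @^-1` A = setT `*` A.
  by apply/seteqP; split => z /=; rewrite /Y eqxx => // -[].
have X'k k (A : set R) : k != n -> X' k @^-1` A = (X k @^-1` A) `*` setT.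
  by move=> /negPf kn; apply/seteqP; split => z /=; rewrite /Y kn => // -[].
have P'n (A : set R) : measurable A -> P' (X' n @^-1` A) = m n A.
  move=> mA; rewrite X'n /P'/= product_measure1E//.
  by rewrite -[RHS]mul1e; congr (_ * _); exact: probability_setT.
have P'k k (A : set R) : k != n -> measurable A ->
    P' (X' k @^-1` A) = P (X k @^-1` A).
  move=> kn mA; rewrite X'k// /P'/= product_measure1E//.
    by rewrite -[RHS]mule1; congr (_ * _); exact: probability_setT.
  exact: measurable_preimage.
exists _, (T * mR)%type, P', X'; split.
- move=> J A mA.
  have mI : measurable (\bigcap_(k in [set` (J `\ n)%fset]) X k @^-1` A k).
    apply: fin_bigcap_measurable => [|k _]; first exact: finite_fset.
    exact: measurable_preimage.
  (* The new coordinate is constrained only if [n] belongs to [J]; the event is then a rectangle. *)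
  pose B := if n \in J then A n else setT.
  have mB : measurable (B : set mR) by rewrite /B; case: ifP => // _; exact: mA.
  rewrite (_ : \bigcap_(k in _) _ =
      (\bigcap_(k in [set` (J `\ n)%fset]) X k @^-1` A k) `*` B); last first.
    apply/seteqP; split => z.
      move=> H; split.
        move=> k /=; rewrite !inE => /andP[kn kJ].
        by have := H k kJ; rewrite X'k// => -[].
      rewrite /B; case: ifPn => // nJ.
      by have := H n nJ; rewrite X'n => -[].
    move=> [H1 H2] k /= kJ; rewrite /Y; case: eqP => [kn|/eqP kn].
      by move: H2; rewrite /B; rewrite -kn kJ.
    by apply: H1; rewrite /= !inE kn.
  have -> : P' ((\bigcap_(k in [set` (J `\ n)%fset]) X k @^-1` A k) `*` B) =
      (\prod_(k <- (J `\ n)%fset) P (X k @^-1` A k)) * m n B.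
    by rewrite /P'/= product_measure1E//; congr (_ * _); exact: indX.
  have E : \prod_(k <- (J `\ n)%fset) P (X k @^-1` A k) =
           \prod_(k <- (J `\ n)%fset) P' (X' k @^-1` A k).
    by apply: eq_big_seq => k; rewrite !inE => /andP[kn _]; rewrite P'k.
  rewrite E /B; case: ifPn => nJ.
    by rewrite [RHS](big_fsetD1 n)//= P'n// muleC.
  rewrite (_ : (J `\ n)%fset = J).
    by rewrite -[RHS]mule1; congr (_ * _); exact: probability_setT.
  apply/fsetP => k; rewrite !inE; case: eqP => // ->.
  by rewrite (negPf nJ).
- move=> k A; rewrite ltnS leq_eqVlt => /predU1P[->|kn] mA; first exact: P'n.
  rewrite -distX//; apply: P'k => //.
  by rewrite lt_eqF.
- move=> k w nk; rewrite /= /Y gtn_eqF// X0//.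
  exact: ltnW.
Qed.

Lemma uniform_sum_law_exists (u : nat -> R) n :
  (forall k, (n <= k)%N -> u k = 0%R) -> exists mu, is_uniform_sum_law u mu.
Proof.
move=> u0.
have [d [T [P [X [indX distX X0]]]]] :=
  independent_family_exists n (fun k => centered_uniform (u k)).
have mS := measurable_partial_sum X n.
exists (law_of (distribution P (to_RV P mS))).
pose S : {RV P >-> R} :=
  HB.pack (partial_sum X n) (isMeasurableFun.Build _ _ _ _ _ mS).
exists d, T, P, X, S; split => //.
- move=> k A mA; have [nk|kn] := leqP n k; last exact: distX.
  rewrite u0// centered_uniform0/= diracE /distribution /pushforward.
  rewrite (_ : X k @^-1` A = [set w | A 0%R]); last first.
    by apply/seteqP; split => w /=; rewrite X0.
  have [A0|A0] := pselect (A 0%R).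
    rewrite mem_set// (_ : [set _ | _] = setT) ?probability_setT//.
    by apply/seteqP; split.
  rewrite memNset// (_ : [set _ | _] = set0) ?measure0//.
  by apply/seteqP; split.
- apply/aeW => w; apply: cvg_near_cst; exists n => // m /= nm.
  rewrite /partial_sum.
  rewrite (big_cat_nat (n := n))//= [X in (_ + X)%R]big_nat_cond.
  by rewrite [X in (_ + X)%R]big1 ?addr0// => k /andP[/andP[nk _] _]; exact: X0.
- by move=> A mA; rewrite law_ofE.
Qed.

Lemma uniform_sum_lawP (u : nat -> R) n :
  (forall k, (n <= k)%N -> u k = 0%R) ->
  is_uniform_sum_law u (uniform_sum_law u).
Proof.
move=> u0; have [mu Hmu] := uniform_sum_law_exists u0.
by rewrite /uniform_sum_law; case: xgetP => [nu -> //|/(_ mu)].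
Qed.

End uniform_sum_laws.

(** * The logistic step and its Taylor expansion *)

Section logistic.
Context (R : realType).
Implicit Types (x y a h : R).

(** The decreasing sigmoid, a smooth substitute for the indicator of the negative half-line. *)
Definition logistic x : R := (1 + expR x)^-1.

Lemma logistic_gt0 x : 0 < logistic x.
Proof. by rewrite invr_gt0 addr_gt0// expR_gt0. Qed.

Lemma logistic_lt1 x : logistic x < 1.
Proof. by rewrite invf_lt1 ?ltrDl ?expR_gt0// addr_gt0// expR_gt0. Qed.

Lemma logisticN x : logistic (- x) = 1 - logistic x.
Proof.
rewrite /logistic expRN; have := expR_gt0 x => x0.
by field; rewrite !gt_eqF// addr_gt0.
Qed.

Lemma logistic_le x : logistic x <= expR (- x).
Proof.
by rewrite expRN /logistic lef_pV2 ?posrE ?expR_gt0 ?addr_gt0 ?expR_gt0// lerDr.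
Qed.

Lemma is_derive_logistic x :
  is_derive x 1 logistic (logistic x ^+ 2 - logistic x).
Proof.
have e0 := expR_gt0 x.
have H : is_derive x 1 (fun y => (1 + expR y)^-1) (- (1 + expR x) ^- 2 *: (0 + expR x)).
  apply: is_deriveV; first by rewrite gt_eqF// addr_gt0.
apply: is_derive_eq.
rewrite /GRing.scale/= /logistic; field.
by rewrite gt_eqF// addr_gt0.
Qed.

Lemma continuous_logistic : continuous logistic.
Proof.
move=> x; apply: differentiable_continuous; apply/derivable1_diffP.
by have [] := is_derive_logistic x.
Qed.

End logistic.

Section taylor.
Context (R : realType).
Implicit Types (g : R -> R) (x y K : R).

Lemma ge0_of_derive (phi dphi : R -> R) :
  (forall y, is_derive y 1 phi (dphi y)) -> phi 0 = 0 ->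
  (forall y, 0 <= y -> 0 <= dphi y) -> forall y, 0 <= y -> 0 <= phi y.
Proof.
move=> H phi0 dphi0 y; rewrite le_eqVlt => /predU1P[<-|y0]; first by rewrite phi0.
have [|c] := @MVT R phi dphi 0 y y0 (fun x _ => H x).
  apply: continuous_subspaceT => x; apply: differentiable_continuous.
  by apply/derivable1_diffP; have [] := H x.
rewrite in_itv/= phi0 !subr0 => /andP[c0 _] ->.
by rewrite mulr_ge0 ?dphi0 ?ltW.
Qed.

Let is_derive_shift g g' x : (forall z : R, is_derive z 1 g (g' z)) ->
  forall y, is_derive y 1 (fun y => g (x + y)) (g' (x + y)).
Proof.
move=> H y.
have Hx : is_derive y 1 (fun y : R => x + y) (0 + 1) by exact: is_deriveD.
by have := is_derive1_comp (H (x + y)) Hx; rewrite add0r mulr1.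
Qed.

(** The upper bound on [g3] is integrated three times from 0: each remainder has the previous one as
    derivative and vanishes at 0. Being one-sided, the statement can be reused for [- g] and for the
    reflected function. *)
Lemma taylor2_le (g g1 g2 g3 : R -> R) K :
  (forall z : R, is_derive z 1 g (g1 z)) -> (forall z : R, is_derive z 1 g1 (g2 z)) ->
  (forall z : R, is_derive z 1 g2 (g3 z)) -> (forall z, g3 z <= K) ->
  forall x y, 0 <= y ->
  g (x + y) <= g x + g1 x * y + g2 x * (y ^+ 2 / 2) + K * (y ^+ 3 / 6).
Proof.
move=> H H1 H2 gK x y y0.
have S2 : forall y, 0 <= y -> 0 <= K * y - (g2 (x + y) - g2 x).
  apply: (@ge0_of_derive _ (fun y => K - g3 (x + y))).
  - move=> z; have Hz := is_derive_shift x H2 z.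
    by apply: is_derive_eq; rewrite /GRing.scale/=; ring.
  - by rewrite addr0; ring.
  - by move=> z _; rewrite subr_ge0.
have S1 : forall y, 0 <= y -> 0 <= K * (y ^+ 2 / 2) - (g1 (x + y) - g1 x - g2 x * y).
  apply: (@ge0_of_derive _ (fun y => K * y - (g2 (x + y) - g2 x))) => //.
  - move=> z; have Hz := is_derive_shift x H1 z.
    by apply: is_derive_eq; rewrite /GRing.scale/= /GRing.scale/=; field.
  - by rewrite addr0; ring.
have S0 : forall y, 0 <= y -> 0 <= K * (y ^+ 3 / 6) - (g (x + y) - g x - g1 x * y - g2 x * (y ^+ 2 / 2)).
  apply: (@ge0_of_derive _ (fun y => K * (y ^+ 2 / 2) - (g1 (x + y) - g1 x - g2 x * y))) => //.
  - move=> z; have Hz := is_derive_shift x H z.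
    by apply: is_derive_eq; rewrite /GRing.scale/= /GRing.scale/=; field.
  - by rewrite addr0; ring.
by have := S0 y y0; lra.
Qed.

(** Four uses of the one-sided bound: for [g] and [- g] when [y] is nonnegative, and for their
    reflections [g (- z)] and [- g (- z)] when [y] is negative. *)
Lemma taylor2 (g g1 g2 g3 : R -> R) K :
  (forall z : R, is_derive z 1 g (g1 z)) -> (forall z : R, is_derive z 1 g1 (g2 z)) ->
  (forall z : R, is_derive z 1 g2 (g3 z)) -> (forall z, `|g3 z| <= K) ->
  forall x y,
  `|g (x + y) - (g x + g1 x * y + g2 x * (y ^+ 2 / 2))| <= K * (`|y| ^+ 3 / 6).
Proof.
move=> H H1 H2 gK.
have D (f f' : R -> R) : (forall z : R, is_derive z 1 f (f' z)) ->
    forall z : R, is_derive z 1 (\- f) (- f' z).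
  by move=> Hf z; exact: is_deriveN.
have P : forall x y, 0 <= y ->
   `|g (x + y) - (g x + g1 x * y + g2 x * (y ^+ 2 / 2))| <= K * (y ^+ 3 / 6).
  move=> x y y0; rewrite ler_norml; apply/andP; split; last first.
    have := taylor2_le H H1 H2 (fun z => le_trans (ler_norm _) (gK z)) x y0.
    lra.
  have gKN z : - g3 z <= K by rewrite (le_trans (ler_norm _))// normrN.
  have := taylor2_le (D _ _ H) (D _ _ H1) (D _ _ H2) gKN x y0.
  rewrite /=; lra.
have O (f f' : R -> R) : (forall z : R, is_derive z 1 f (f' z)) ->
    forall z : R, is_derive z 1 (fun z => f (- z)) (- f' (- z)).
  move=> Hf z; have Hx : is_derive z 1 (fun y : R => - y) (- 1) by exact: is_deriveN.
  by have := is_derive1_comp (Hf (- z)) Hx; rewrite mulrN1.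
have O' (f f' : R -> R) : (forall z : R, is_derive z 1 f (f' z)) ->
    forall z : R, is_derive z 1 (fun z => - f (- z)) (f' (- z)).
  by move=> Hf z; rewrite -[X in is_derive _ _ _ X]opprK; apply: D; exact: O.
move=> x y; have [y0|y0] := leP 0 y; first by rewrite (ger0_norm y0) P.
have gN z : - g3 (- z) <= K by rewrite (le_trans (ler_norm _))// normrN.
have gN' z : - - g3 (- z) <= K by rewrite opprK (le_trans (ler_norm _)).
have y0' : 0 <= - y by rewrite oppr_ge0 ltW.
rewrite (ltr0_norm y0) ler_norml; apply/andP; split.
  have := taylor2_le (D _ _ (O _ _ H)) (D _ _ (O' _ _ H1)) (D _ _ (O _ _ H2)) gN' (- x) y0'.
  by rewrite /= !opprD !opprK; lra.
have := taylor2_le (O _ _ H) (O' _ _ H1) (O _ _ H2) gN (- x) y0'.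
by rewrite /= !opprD !opprK; lra.
Qed.

Lemma logistic_taylor : exists s1 s2 : R -> R, forall x y,
  `|logistic (x + y) - (logistic x + s1 x * y + s2 x * (y ^+ 2 / 2))|
    <= `|y| ^+ 3.
Proof.
pose s1 x : R := logistic x ^+ 2 - logistic x.
pose s2 x : R := (logistic x *+ 2 - 1) * s1 x.
pose s3 x : R := (logistic x ^+ 2 *+ 6 - logistic x *+ 6 + 1) * s1 x.
exists s1, s2 => x y.
have D0 (z : R) : is_derive z 1 (@logistic R) (s1 z) by exact: is_derive_logistic.
have D1 (z : R) : is_derive z 1 s1 (s2 z).
  have := D0 z => H; rewrite /s1; apply: is_derive_eq.
  by rewrite /GRing.scale/= /s2 /s1; ring.
have D2 (z : R) : is_derive z 1 s2 (s3 z).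
  have := D0 z => H; have := D1 z => H1; rewrite /s2; apply: is_derive_eq.
  by rewrite /GRing.scale/= /s3 /s2 /s1; ring.
(* With [p] in []0, 1[], both [p ^+ 2 - p] and [6 p ^+ 2 - 6 p + 1] are at most 1 in absolute
   value. *)
have B3 z : `|s3 z| <= 1.
  have p0 := logistic_gt0 z; have p1 := logistic_lt1 z.
  rewrite /s3 /s1; set p := logistic z in p0 p1 *.
  rewrite normrM -[leRHS]mulr1 ler_pM// ler_norml; apply/andP; split; nra.
apply: (le_trans (taylor2 D0 D1 D2 B3 x y)).
by rewrite mul1r ler_piMr ?exprn_ge0// invf_le1 ?ler1n// ltr0n.
Qed.

End taylor.

(** * Logistic steps control the Levy distance *)

Section levy_logistic.
Context (R : realType).
Implicit Types (mu nu : law R) (x a h : R).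

Definition step a h x : R := logistic ((x - a) / h).

Lemma step_ge0 a h x : 0 <= step a h x.
Proof. exact/ltW/logistic_gt0. Qed.

Lemma continuous_step a h : continuous (step a h).
Proof.
move=> x; apply: (@continuous_comp _ _ _ (fun x => (x - a) / h)).
  by apply: cvgM; [apply: cvgB; [exact: cvg_id|exact: cvg_cst]|exact: cvg_cst].
exact: continuous_logistic.
Qed.

Lemma measurable_step a h : measurable_fun setT (step a h).
Proof. by apply: continuous_measurable_fun; exact: continuous_step. Qed.

(** The step centred at [a + y] is within [q] of 1 up to [a] and below [q] beyond [a + 2 * y]. It
    therefore separates the two indicators, at a cost of [q] on either side. *)
Lemma le_cdf_step mu nu (h y d : R) : 0 < h -> 0 < y -> 0 <= d ->
  (forall a, \int[mu]_x (step a h x)%:E <= \int[nu]_x (step a h x)%:E + d%:E)%E ->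
  forall a, law_cdf mu a <= law_cdf nu (a + 2 * y) + (2 * expR (- (y / h)) + d).
Proof.
move=> h0 y0 d0 H a; set q := expR (- (y / h)).
have q0 : 0 <= q by exact: expR_ge0.
have mstep a' : measurable_fun setT (EFin \o step a' h).
  by apply/measurable_EFinP; exact: measurable_step.
have mind (b : R) : measurable_fun setT (EFin \o (\1_(`]-oo, b]%classic : set R) : R -> R)).
  by apply/measurable_EFinP; exact: measurable_indic.
have L : (mu `]-oo, a]%classic <= \int[mu]_x (step (a + y) h x)%:E + q%:E)%E.
  have -> : mu `]-oo, a]%classic = (\int[mu]_x (\1_(`]-oo, a]%classic : set R) x)%:E)%E.
    by rewrite integral_indic// setIT.
  have -> : (\int[mu]_x (step (a + y) h x)%:E + q%:E =
      \int[mu]_x ((step (a + y) h x)%:E + q%:E))%E.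
    rewrite ge0_integralD//=.
    - by rewrite integral_cst//= probability_setT mule1.
    - by move=> x _; rewrite lee_fin step_ge0.
    - exact: mstep.
  apply: ge0_le_integral => //.
  - exact: mind.
  - by apply: emeasurable_funD => //; exact: mstep.
  move=> x _; rewrite -EFinD lee_fin indicE.
  case: (boolP (x \in _)) => [|_]; last by rewrite addr_ge0// step_ge0.
  rewrite inE/= in_itv/= => xa; rewrite /step -lerBlDl -logisticN.
  apply: (le_trans (logistic_le _)); rewrite opprK ler_expR -mulNr.
  by rewrite ler_pM2r ?invr_gt0//; lra.
have U : (\int[nu]_x (step (a + y) h x)%:E <= nu `]-oo, (a + 2 * y)%R]%classic + q%:E)%E.
  have -> : nu `]-oo, (a + 2 * y)%R]%classic =
      (\int[nu]_x (\1_(`]-oo, (a + 2 * y)%R]%classic : set R) x)%:E)%E.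
    by rewrite integral_indic// setIT.
  have -> : (\int[nu]_x (\1_(`]-oo, (a + 2 * y)%R]%classic : set R) x)%:E + q%:E =
      \int[nu]_x ((\1_(`]-oo, (a + 2 * y)%R]%classic : set R) x)%:E + q%:E))%E.
    rewrite ge0_integralD//=.
    - by rewrite integral_cst//= probability_setT mule1.
    - exact: mind.
  apply: ge0_le_integral => //.
  - by move=> x _; rewrite lee_fin step_ge0.
  - exact: mstep.
  - by apply: emeasurable_funD => //; exact: mind.
  move=> x _; rewrite -EFinD lee_fin indicE.
  case: (boolP (x \in _)) => [_|].
    by rewrite ler_wpDr//; exact/ltW/logistic_lt1.
  rewrite notin_setE/= in_itv/= => /negP; rewrite -ltNge => xa; rewrite add0r.
  apply: (le_trans (logistic_le _)); rewrite ler_expR lerN2.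
  by rewrite ler_pM2r ?invr_gt0//; lra.
rewrite -lee_fin EFinD /law_cdf !fineK ?fin_num_measure//.
apply: (le_trans L); apply: (le_trans (leeD2r _ (H _))).
rewrite -addeA; apply: (le_trans (leeD2r _ U)).
by rewrite -addeA leeD2l// -!EFinD lee_fin; lra.
Qed.

Lemma levy_dist_step (e : R) : 0 < e -> exists h d : R, [/\ 0 < h, 0 < d &
  forall mu nu,
  (forall a, \int[mu]_x (step a h x)%:E <= \int[nu]_x (step a h x)%:E + d%:E)%E ->
  (forall a, \int[nu]_x (step a h x)%:E <= \int[mu]_x (step a h x)%:E + d%:E)%E ->
  levy_dist mu nu < e].
Proof.
(* Taking also [y = e / 4], one has [y / h = 8 / e], and [expR (- (8 / e)) <= e / 8]. The vertical
   error is then [2 * (e / 8) + e / 4 = e / 2], and the shift [2 * y] is [e / 2] as well. *)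
move=> e0; exists (e ^+ 2 / 32), (e / 4).
have h0 : 0 < e ^+ 2 / 32 by rewrite divr_gt0 ?exprn_gt0.
have y0 : 0 < e / 4 by rewrite divr_gt0.
split => // mu nu H1 H2.
have q : expR (- ((e / 4) / (e ^+ 2 / 32))) <= e / 8.
  have -> : (e / 4) / (e ^+ 2 / 32) = 8 / e by field; rewrite gt_eqF.
  rewrite expRN invf_ple ?posrE ?expR_gt0 ?divr_gt0// invf_div.
  by rewrite (le_trans _ (expR_ge1Dx _))// lerDr.
have L (m n : law R) : (forall a, \int[m]_x (step a (e ^+ 2 / 32) x)%:E <=
      \int[n]_x (step a (e ^+ 2 / 32) x)%:E + (e / 4)%:E)%E ->
    forall a, law_cdf m a <= law_cdf n (a + e / 2) + e / 2.
  move=> H a; have := le_cdf_step h0 y0 (ltW y0) H a.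
  rewrite (_ : 2 * (e / 4) = e / 2); last by field.
  by move=> /le_trans; apply; rewrite lerD2l; lra.
apply: (@le_lt_trans _ _ (e / 2)); last by rewrite ltr_pdivrMr// ltr_pMr// ltr1n.
apply: levy_dist_le; split; first by rewrite divr_gt0.
move=> x; apply/andP; split; last exact: L.
by rewrite lerBlDr; have := L _ _ H1 (x - e / 2); rewrite subrK.
Qed.

End levy_logistic.

(** * Integration against a density *)

Section densities.
Context (R : realType).
Local Notation mR := (measurableTypeR R).
Local Notation leb := (@lebesgue_measure R).
Local Open Scope ereal_scope.

Section integral_density.
Variables (mu : {measure set mR -> \bar R}) (p : R -> R).
Hypotheses (mp : measurable_fun setT p) (p0 : forall x, (0 <= p x)%R).
Hypothesis mup : forall A : set mR, measurable A -> mu A = \int[leb]_(x in A) (p x)%:E.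
Import HBNNSimple.

Let mpE : measurable_fun setT (EFin \o p). Proof. exact/measurable_EFinP. Qed.

Let integral_density_indic (A : set mR) : measurable A ->
  \int[mu]_x (\1_A x)%:E = \int[leb]_x ((\1_A x)%:E * (p x)%:E).
Proof.
move=> mA; rewrite integral_indic// setIT mup// integral_mkcond.
apply: eq_integral => x _; rewrite patchE indicE.
by case: ifP => _; rewrite ?mul1e ?mul0e.
Qed.

Let integral_density_nnsfun (f : {nnsfun mR >-> R}) :
  \int[mu]_x (f x)%:E = \int[leb]_x ((f x)%:E * (p x)%:E).
Proof.
have mI r : measurable_fun setT (fun x => (\1_(f @^-1` [set r]) x)%:E * (p x)%:E).
  apply: emeasurable_funM => //.
  by apply/measurable_EFinP; exact: measurable_indic.
under [LHS]eq_integral do rewrite fimfunE -fsumEFin//.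
rewrite [LHS]ge0_integral_fsum//; last 2 first.
  - by move=> r; exact/measurable_EFinP/measurableT_comp.
  - by move=> n x _; rewrite EFinM nnfun_muleindic_ge0.
under [RHS]eq_integral.
  move=> x _; rewrite fimfunE -fsumEFin// muleC ge0_mule_fsumr; last first.
    by move=> r; rewrite EFinM nnfun_muleindic_ge0.
  over.
rewrite [RHS]ge0_integral_fsum//; last 2 first.
  - move=> r; apply: emeasurable_funM => //.
    exact/measurable_EFinP/measurableT_comp.
  - move=> n x _; apply: mule_ge0; first by rewrite lee_fin.
    by rewrite EFinM nnfun_muleindic_ge0.
apply: eq_fsbigr => r; rewrite inE => -[x _ <-{r}].
under eq_integral do rewrite EFinM.
rewrite ge0_integralZl//; last 2 first.
  - by apply/measurable_EFinP; exact: measurable_indic.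
  - by rewrite lee_fin.
rewrite integral_density_indic// -ge0_integralZl ?lee_fin//; last first.
  by move=> y _; rewrite mule_ge0 ?lee_fin.
by apply: eq_integral => y _; rewrite [RHS]muleC EFinM -muleA.
Qed.

(** Indicators, then nonnegative simple functions, then monotone convergence. *)
Lemma integral_density (f : R -> \bar R) :
  measurable_fun setT f -> (forall x, 0 <= f x) ->
  \int[mu]_x f x = \int[leb]_x (f x * (p x)%:E).
Proof.
move=> mf f0; have mf' : measurable_fun [set: mR] f by exact: mf.
pose f_ := nnsfun_approx measurableT mf'.
have ff x : f x = limn (fun n => (f_ n x)%:E).
  by apply/esym/cvg_lim => //; exact: cvg_nnsfun_approx.
transitivity (limn (fun n => \int[mu]_x (f_ n x)%:E)).
  rewrite -monotone_convergence//=.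
  - by apply: eq_integral => x _.
  - by move=> n; exact/measurable_EFinP/measurable_funTS.
  - by move=> n ? _; rewrite lee_fin.
  - by move=> ? _ ? ? mn; rewrite lee_fin; exact/lefP/nd_nnsfun_approx.
transitivity (limn (fun n => \int[leb]_x ((f_ n x)%:E * (p x)%:E))).
  by apply: congr_lim; apply/funext => n; exact: integral_density_nnsfun.
rewrite -monotone_convergence//=.
- apply: eq_integral => x _; apply/cvg_lim => //.
  by apply: cvgeZr => //; exact: cvg_nnsfun_approx.
- move=> n; apply: emeasurable_funM => //.
  exact/measurable_EFinP/measurable_funTS.
- by move=> n x _; rewrite mule_ge0 ?lee_fin.
- move=> x _ m n mn; rewrite lee_wpmul2r ?lee_fin//.
  exact/lefP/nd_nnsfun_approx.
Qed.

End integral_density.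

Lemma integral_lebesgueN (f : R -> \bar R) : measurable_fun setT f ->
  (forall x, 0 <= f x) -> \int[leb]_x f (- x)%R = \int[leb]_x f x.
Proof.
move=> mf f0.
have mN : measurable_fun setT (-%R : mR -> mR) by [].
transitivity (\int[pushforward leb (-%R : mR -> mR)]_x f x).
  by rewrite ge0_integral_pushforward.
by apply: eq_measure_integral => A mA _; exact: lebesgue_measureN.
Qed.

(** The image of Lebesgue measure under a translation gives half-open intervals their length, which
    characterises Lebesgue measure. *)
Lemma integral_lebesgueD (f : R -> \bar R) (c : R) : measurable_fun setT f ->
  (forall x, 0 <= f x) -> \int[leb]_x f (x + c)%R = \int[leb]_x f x.
Proof.
move=> mf f0.
have mD : measurable_fun setT (fun x : mR => x + c : mR)%R by exact: measurable_funD.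
transitivity (\int[pushforward leb (fun x : mR => x + c : mR)%R]_x f x).
  by rewrite ge0_integral_pushforward.
apply: eq_measure_integral => A mA _; apply/esym/lebesgue_measure_unique => //.
move=> _ [[a b]] _ <-; rewrite /= /pushforward.
rewrite (_ : _ @^-1` _ = `](a - c)%R, (b - c)%R]%classic); last first.
  by apply/seteqP; split => x /=; rewrite !in_itv/= ltrBlDr lerBrDr.
rewrite !lebesgue_measure_itv/= !lte_fin ltrD2r; case: ifP => // _.
by rewrite -!EFinB; congr EFin; ring.
Qed.

Lemma integral_density_sym (mu : {measure set mR -> \bar R}) (p : R -> R)
    (f : R -> \bar R) :
  measurable_fun setT p -> (forall x, (0 <= p x)%R) -> (forall x, p (- x)%R = p x) ->
  (forall A : set mR, measurable A -> mu A = \int[leb]_(x in A) (p x)%:E) ->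
  measurable_fun setT f -> (forall x, 0 <= f x) ->
  \int[mu]_x f (- x)%R = \int[mu]_x f x.
Proof.
move=> mp p0 pN mup mf f0.
have mfN : measurable_fun setT (fun x : R => f (- x)%R) by exact: measurableT_comp.
rewrite !(integral_density mp p0 mup)//.
rewrite -[RHS]integral_lebesgueN//.
- by apply: eq_integral => x _; rewrite pN.
- by apply: emeasurable_funM => //; exact/measurable_EFinP.
- by move=> x; rewrite mule_ge0 ?lee_fin.
Qed.

End densities.

(** * Cost of exchanging one summand *)

Section lindeberg_step.
Context (R : realType).
Local Notation mR := (measurableTypeR R).

(** The derivative [p ^+ 2 - p] is negative and greater than -1, so adding the identity makes the
    function nondecreasing. *)
Lemma logistic_lipschitz (x y : R) : logistic x <= logistic y + `|y - x|.
Proof.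
have [yx|xy] := leP y x.
  rewrite ler_wpDr// /logistic lef_pV2 ?posrE ?addr_gt0 ?expR_gt0//.
  by rewrite lerD2l ler_expR.
rewrite gtr0_norm ?subr_gt0//.
have := @ge0_of_derive R (fun z => z + (logistic (x + z) - logistic x))
  (fun z => 1 + (logistic (x + z) ^+ 2 - logistic (x + z))) _ _ _ (y - x).
rewrite subrKC subr_ge0 (ltW xy) => H.
have {}H : 0 <= y - x + (logistic y - logistic x).
  apply: H => //.
  - move=> z.
    have Hz : is_derive z 1 (fun z : R => x + z) (0 + 1) by exact: is_deriveD.
    have := is_derive1_comp (is_derive_logistic (x + z)) Hz.
    rewrite add0r mulr1 => Hl.
    by apply: is_derive_eq; rewrite subr0.
  - by rewrite addr0 subrr addr0.
  - move=> z _; have := logistic_gt0 (x + z); have := logistic_lt1 (x + z).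
    by set p := logistic _ => p1 p0; nra.
lra.
Qed.

Lemma step_lipschitz (a h x y : R) : 0 < h -> step a h x <= step a h y + `|y - x| / h.
Proof.
move=> h0; apply: (le_trans (logistic_lipschitz _ ((y - a) / h))).
rewrite /step lerD2l -mulrBl normrM (@gtr0_norm _ h^-1) ?invr_gt0//.
by rewrite (_ : y - a - (x - a) = y - x)//; ring.
Qed.

(** Adding the expansions at [y] and [- y] cancels the linear term, so that no integral of an odd
    function is needed later. The constant [C] is half the second derivative of the step at [x], and
    does not depend on [y]. *)
Lemma step_taylor (a h x : R) : 0 < h -> exists C : R, forall y,
  `|step a h (x + y) + step a h (x - y) - (2 * step a h x + 2 * C * y ^+ 2)|
    <= 2 / h ^+ 3 * `|y| ^+ 3.
Proof.
move=> h0; have [s1 [s2 H]] := logistic_taylor R.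
exists (s2 ((x - a) / h) / (2 * h ^+ 2)) => y.
have h3 : `|y / h| ^+ 3 = `|y| ^+ 3 / h ^+ 3.
  by rewrite normrM (@gtr0_norm _ h^-1) ?invr_gt0// exprMn exprVn.
have := H ((x - a) / h) (y / h); have := H ((x - a) / h) (- (y / h)).
rewrite normrN h3.
rewrite (_ : (x - a) / h + y / h = (x + y - a) / h); last by field; rewrite gt_eqF.
rewrite (_ : (x - a) / h - y / h = (x - y - a) / h); last by field; rewrite gt_eqF.
rewrite -!/(step _ _ _).
rewrite (_ : 2 * (s2 ((x - a) / h) / (2 * h ^+ 2)) * y ^+ 2 =
   2 * (s2 ((x - a) / h) * ((y / h) ^+ 2 / 2))); last by field; rewrite gt_eqF.
rewrite (_ : (- (y / h)) ^+ 2 = (y / h) ^+ 2) ?sqrrN//.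
rewrite (_ : 2 / h ^+ 3 * `|y| ^+ 3 = 2 * (`|y| ^+ 3 / h ^+ 3)); last by ring.
set q := `|y| ^+ 3 / h ^+ 3; set b := s2 _ * _; set c := s1 _.
rewrite !ler_norml mulrN => /andP[? ?] /andP[? ?]; apply/andP; split; lra.
Qed.

Local Open Scope ereal_scope.

Lemma measurable_norm_cube :
  measurable_fun setT (fun x : R => (`|x| ^+ 3)%:E).
Proof.
apply/measurable_EFinP; apply: measurable_funX.
exact: normr_measurable.
Qed.

Definition symmetric_prob (mu : probability mR R) :=
  forall f : R -> \bar R, measurable_fun setT f -> (forall x, 0 <= f x) ->
    \int[mu]_x f (- x)%R = \int[mu]_x f x.

Let ge0_integral_poly (mu : probability mR R) (v r A B C : R) :
  \int[mu]_x (x ^+ 2)%:E = v%:E -> \int[mu]_x (`|x| ^+ 3)%:E = r%:E ->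
  (0 <= A)%R -> (0 <= B)%R -> (0 <= C)%R ->
  \int[mu]_x (A + B * x ^+ 2 + C * `|x| ^+ 3)%:E = (A + B * v + C * r)%:E.
Proof.
move=> Hv Hr A0 B0 C0.
have m2 : measurable_fun [set: mR] (fun x : mR => (x ^+ 2)%:E).
  exact/measurable_EFinP/measurable_funX.
have m3 : measurable_fun [set: mR] (fun x : mR => (`|x| ^+ 3)%:E).
  exact: measurable_norm_cube.
have mB : measurable_fun [set: mR] (fun x : mR => B%:E * (x ^+ 2)%:E).
  exact: measurable_funeM.
have mC : measurable_fun [set: mR] (fun x : mR => C%:E * (`|x| ^+ 3)%:E).
  exact: measurable_funeM.
under eq_integral do rewrite 2!EFinD (EFinM B) (EFinM C).
rewrite ge0_integralD//; last 3 first.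
- by move=> x _; rewrite -EFinM -EFinD lee_fin addr_ge0// mulr_ge0// sqr_ge0.
- exact: emeasurable_funD.
- by move=> x _; rewrite -EFinM lee_fin mulr_ge0// exprn_ge0.
rewrite ge0_integralD//; last first.
  by move=> x _; rewrite -EFinM lee_fin mulr_ge0// sqr_ge0.
rewrite ge0_integralZl// ?lee_fin//; last by move=> x _; rewrite lee_fin sqr_ge0.
rewrite ge0_integralZl// ?lee_fin//.
by rewrite Hv Hr integral_cst//= probability_setT mule1 2!EFinD !EFinM.
Qed.

(** The order of the quantifiers matters: [C] is chosen before [mu], so two symmetric laws of equal
    variance share the main term and differ only by the third-moment errors. Symmetry makes the
    integral of the symmetrised step twice that of the step. *)
Lemma smooth_step_taylor (a h x : R) : (0 < h)%R -> exists C : R,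
  forall (mu : probability mR R) (v r : R), symmetric_prob mu ->
    \int[mu]_x (x ^+ 2)%:E = v%:E -> \int[mu]_x (`|x| ^+ 3)%:E <= r%:E ->
  exists2 I : R, smooth mu (EFin \o step a h) x = I%:E &
    (`|I - (step a h x + C * v)| <= r / h ^+ 3)%R.
Proof.
move=> h0; have [C HC] := step_taylor a x h0.
exists C => mu v r smu Hv Hr.
have mst : measurable_fun setT (EFin \o step a h).
  by apply/measurable_EFinP; exact: measurable_step.
have mst1 : measurable_fun setT (fun y : R => (step a h (x + y))%:E).
  exact: (measurable_shift x mst).
have mst2 : measurable_fun setT (fun y : R => (step a h (x - y))%:E).
  by apply: (measurableT_comp mst); exact: measurable_funB.
pose I : \bar R := smooth mu (EFin \o step a h) x.
have I0 : 0 <= I by apply: smooth_ge0 => y; rewrite lee_fin step_ge0.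
have I1 : I <= 1.
  apply: (@le_trans _ _ (\int[mu]_y (cst 1 y))).
    apply: ge0_le_integral => //.
    - by move=> y _; rewrite /= lee_fin step_ge0.
    - by move=> y _; rewrite /= lee_fin; exact/ltW/logistic_lt1.
  by rewrite integral_cst//= probability_setT mule1.
have If : I \is a fin_num.
  by rewrite ge0_fin_numE// (le_lt_trans I1)// ltry.
have I2 : I = \int[mu]_y (step a h (x - y))%:E.
  rewrite /I /smooth -smu//; first by move=> y; rewrite lee_fin step_ge0.
(* The exact third moment, finite because it is at most [r]. *)
pose r' : R := fine (\int[mu]_x (`|x| ^+ 3)%:E).
have r'E : \int[mu]_x (`|x| ^+ 3)%:E = r'%:E.
  rewrite /r' fineK// ge0_fin_numE ?(le_lt_trans Hr) ?ltry//.
  by apply: integral_ge0 => y _; rewrite lee_fin exprn_ge0.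
have r'r : (r' <= r)%R by rewrite -lee_fin -r'E.
exists (fine I); first by rewrite fineK.
have v0 : (0 <= v)%R.
  by rewrite -lee_fin -Hv; apply: integral_ge0 => y _; rewrite lee_fin sqr_ge0.
pose S (y : R) : R := (step a h (x + y) + step a h (x - y))%R.
have S0 y : (0 <= S y)%R by rewrite addr_ge0// step_ge0.
have mS : measurable_fun setT (EFin \o S).
  by apply/measurable_EFinP; apply: measurable_funD; exact/measurable_EFinP.
have IS : \int[mu]_y (S y)%:E = (2 * fine I)%:E.
  under eq_integral do rewrite EFinD.
  rewrite ge0_integralD//; try by move=> y _; rewrite lee_fin step_ge0.
  rewrite -I2 -/(smooth mu (EFin \o step a h) x) -/I.
  by rewrite -(fineK If) -EFinD; congr EFin; rewrite /=; ring.
(* Positive and negative parts of [C]: the negative part is moved to the other side of each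
   inequality, so that all integrands stay nonnegative. *)
pose D1 : R := Num.max C 0%R; pose D2 : R := Num.max (- C)%R 0%R.
have D10 : (0 <= D1)%R by rewrite le_max lexx orbT.
have D20 : (0 <= D2)%R by rewrite le_max lexx orbT.
have CD : C = (D1 - D2)%R.
  by rewrite /D1 /D2; case: (leP C 0%R) => c; case: (leP (- C)%R 0%R) => c'; lra.
have h3 : (0 <= 2 / h ^+ 3)%R by rewrite divr_ge0// exprn_ge0// ltW.
have st0 : (0 <= step a h x)%R by exact: step_ge0.
have st2 : (0 <= 2 * step a h x)%R by rewrite mulr_ge0.
have D12 : (0 <= 2 * D1)%R by rewrite mulr_ge0.
have D22 : (0 <= 2 * D2)%R by rewrite mulr_ge0.
have P1 := ge0_integral_poly Hv r'E st2 D12 h3.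
have P2 := ge0_integral_poly Hv r'E (lexx 0%R) D22 (lexx 0%R).
have P3 := ge0_integral_poly Hv r'E st2 D12 (lexx 0%R).
have P4 := ge0_integral_poly Hv r'E (lexx 0%R) D22 h3.
have mP (A B G : R) :
    measurable_fun setT (fun y : R => (A + B * y ^+ 2 + G * `|y| ^+ 3)%:E).
  apply/measurable_EFinP/measurable_funD.
    by apply: measurable_funD => //; apply: measurable_funM => //; exact: measurable_funX.
  by apply: measurable_funM => //; apply/measurable_EFinP; exact: measurable_norm_cube.
have PP (A B G y : R) : (0 <= A)%R -> (0 <= B)%R -> (0 <= G)%R ->
    0 <= (A + B * y ^+ 2 + G * `|y| ^+ 3)%:E.
  move=> A0 B0 G0; rewrite lee_fin; apply: addr_ge0; last first.
    by rewrite mulr_ge0// exprn_ge0.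
  by rewrite addr_ge0// mulr_ge0// sqr_ge0.
have U : \int[mu]_y ((S y)%:E + (0 + 2 * D2 * y ^+ 2 + 0 * `|y| ^+ 3)%:E) <=
    \int[mu]_y (2 * step a h x + 2 * D1 * y ^+ 2 + 2 / h ^+ 3 * `|y| ^+ 3)%:E.
  apply: ge0_le_integral => //.
  - by move=> y _; rewrite adde_ge0//; [rewrite lee_fin|rewrite PP].
  - by apply: emeasurable_funD => //; exact: mP.
  - exact: mP.
  move=> y _; rewrite -EFinD lee_fin.
  by move: (HC y); rewrite CD ler_norml /S => /andP[_]; clear; lra.
have L : \int[mu]_y (2 * step a h x + 2 * D1 * y ^+ 2 + 0 * `|y| ^+ 3)%:E <=
    \int[mu]_y ((S y)%:E + (0 + 2 * D2 * y ^+ 2 + 2 / h ^+ 3 * `|y| ^+ 3)%:E).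
  apply: ge0_le_integral => //.
  - by move=> y _; rewrite PP.
  - exact: mP.
  - by apply: emeasurable_funD => //; exact: mP.
  move=> y _; rewrite -EFinD lee_fin.
  by move: (HC y); rewrite CD ler_norml /S => /andP[+ _]; clear; lra.
move: U L; rewrite !ge0_integralD//;
  try (by move=> y _; rewrite PP); try exact: mP;
  try (by move=> y _; rewrite lee_fin).
rewrite IS P1 P2 P3 P4 -!EFinD !lee_fin => U L.
have hr : (r' / h ^+ 3 <= r / h ^+ 3)%R.
  by rewrite ler_pM2r// invr_gt0 exprn_gt0.
rewrite CD; move: U L hr; set w := (r' / h ^+ 3)%R.
rewrite (_ : 2 / h ^+ 3 * r' = 2 * w)%R; last by rewrite /w; ring.
by clear; move=> U L hr; rewrite ler_norml; apply/andP; split; lra.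
Qed.

Lemma smooth_step_compare (mu nu : probability mR R) (v r r' a h x : R) :
  (0 < h)%R -> symmetric_prob mu -> symmetric_prob nu ->
  \int[mu]_x (x ^+ 2)%:E = v%:E -> \int[nu]_x (x ^+ 2)%:E = v%:E ->
  \int[mu]_x (`|x| ^+ 3)%:E <= r%:E -> \int[nu]_x (`|x| ^+ 3)%:E <= r'%:E ->
  smooth mu (EFin \o step a h) x <=
  smooth nu (EFin \o step a h) x + ((r + r') / h ^+ 3)%:E.
Proof.
move=> h0 smu snu vmu vnu rmu rnu; have [C HC] := smooth_step_taylor a x h0.
have [I -> HI] := HC _ _ _ smu vmu rmu.
have [J -> HJ] := HC _ _ _ snu vnu rnu.
move: HI HJ; rewrite -EFinD lee_fin mulrDl !ler_norml => /andP[_ ?] /andP[? _].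
lra.
Qed.

End lindeberg_step.

(** * Centred uniform laws: moments and dependence on the width *)

Section centered_uniform.
Context (R : realType).
Local Notation mR := (measurableTypeR R).
Local Notation leb := (@lebesgue_measure R).
Local Open Scope ereal_scope.

Lemma centered_uniformE (t : R) : (0 < t)%R -> exists ab : (- (t / 2) < t / 2)%R,
  centered_uniform t = uniform_prob ab.
Proof.
move=> t0; rewrite /centered_uniform; case: pselect => [ab|]; first by exists ab.
by move=> /negP; rewrite -leNgt => h; exfalso; lra.
Qed.

Lemma integral_centered_uniform (t : R) (f : R -> \bar R) : (0 < t)%R ->
  measurable_fun setT f -> (forall x, 0 <= f x) ->
  \int[centered_uniform t]_x f x =
  (t^-1)%:E * \int[leb]_(x in `[(- (t / 2))%R, (t / 2)%R]) f x.
Proof.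
move=> t0 mf f0; have [ab ->] := centered_uniformE t0.
rewrite integral_uniform//; congr (_%:E * _).
by congr GRing.inv; field.
Qed.

Lemma centered_uniform_symmetric (t : R) : (0 < t)%R ->
  symmetric_prob (centered_uniform t).
Proof.
move=> t0 f mf f0; have [ab ->] := centered_uniformE t0.
apply: (@integral_density_sym _ _ (uniform_pdf (- (t / 2)) (t / 2))) => //.
- exact: measurable_uniform_pdf.
- by move=> x; exact: uniform_pdf_ge0.
- by move=> x; rewrite /uniform_pdf lerNl opprK lerNl andbC.
Qed.

Lemma centered_uniform_sqr (t : R) : (0 < t)%R ->
  \int[centered_uniform t]_x (x ^+ 2)%:E = (t ^+ 2 / 12)%:E.
Proof.
move=> t0; rewrite integral_centered_uniform//; last 2 first.
- exact/measurable_EFinP/measurable_funX.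
- by move=> x; rewrite lee_fin sqr_ge0.
have ab : (- (t / 2) < t / 2)%R by lra.
have D (x : R) : is_derive x 1%R (fun x : R => x ^+ 3 / 3)%R (x ^+ 2)%R.
  by apply: is_derive_eq; rewrite /GRing.scale/=; field.
have cF : continuous (fun x : R => x ^+ 3 / 3 : R)%R.
  by move=> x; apply: differentiable_continuous; apply/derivable1_diffP; have [] := D x.
rewrite (@continuous_FTC2 _ (fun x => x ^+ 2)%R (fun x => x ^+ 3 / 3)%R)//.
- rewrite -EFinB -EFinM; congr EFin; field; by rewrite gt_eqF.
- by apply: continuous_subspaceT => x; exact: exprn_continuous.
- split.
  + by move=> x _; have [] := D x.
  + by apply: cvg_at_right_filter; exact: cF.
  + by apply: cvg_at_left_filter; exact: cF.
- by move=> x _; rewrite derive1E; have [_ ->] := D x.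
Qed.

(** On the support [|x| <= t], so the cube is at most [t * x ^+ 2], and the variance gives
    [t ^+ 3 / 12]; the cruder bound is enough. *)
Lemma centered_uniform_cube (t : R) : (0 < t)%R ->
  \int[centered_uniform t]_x (`|x| ^+ 3)%:E <= (t ^+ 3)%:E.
Proof.
move=> t0.
have m3 : measurable_fun setT (fun x : R => (`|x| ^+ 3)%:E).
  exact: measurable_norm_cube.
have m2 : measurable_fun setT (fun x : R => (x ^+ 2)%:E).
  by apply/measurable_EFinP/measurable_funX.
rewrite integral_centered_uniform//.
apply: (@le_trans _ _ ((t^-1)%:E *
    \int[leb]_(x in `[(- (t / 2))%R, (t / 2)%R]) (t%:E * (x ^+ 2)%:E))).
  rewrite lee_pmul2l ?lte_fin ?invr_gt0//.
  apply: ge0_le_integral => //.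
  - exact: measurable_funTS.
  - by apply: measurable_funTS; exact: measurable_funeM.
  move=> x /=; rewrite in_itv/= => /andP[x1 x2]; rewrite lee_fin exprS.
  rewrite -normrX (@ger0_norm _ (x ^+ 2)%R) ?sqr_ge0// ler_wpM2r ?sqr_ge0//.
  by rewrite ler_norml; lra.
rewrite ge0_integralZl//; last 3 first.
- exact: measurable_funTS.
- by move=> x _; rewrite lee_fin sqr_ge0.
- by rewrite lee_fin ltW.
rewrite muleCA -integral_centered_uniform//; last by move=> x; rewrite lee_fin sqr_ge0.
rewrite centered_uniform_sqr// -EFinM lee_fin.
have : (0 <= t ^+ 3)%R by rewrite exprn_ge0// ltW.
by rewrite (_ : t * (t ^+ 2 / 12) = t ^+ 3 / 12)%R; [lra|ring].
Qed.

Let measurable_affine (x t : R) : measurable_fun setT (fun y : R => x + t * y)%R.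
Proof.
by apply: measurable_funD; [exact: measurable_cst|exact: mulrl_measurable].
Qed.

(** Substitution by [y |-> t * y]: every width is realised on the same interval, so the width
    appears in the integrand alone. The degenerate width 0 is included, since entries of a multiset
    may vanish in a limit. *)
Lemma smooth_uniformE (t x : R) (f : R -> R) : (0 <= t)%R -> continuous f ->
  (forall x, 0 <= f x)%R ->
  smooth (centered_uniform t) (EFin \o f) x =
  \int[leb]_(y in `[(- 2^-1)%R, 2^-1%R]) (f (x + t * y))%:E.
Proof.
move=> t0 cf f0; rewrite /smooth.
have mf : measurable_fun setT f by exact: continuous_measurable_fun.
move: t0; rewrite le_eqVlt => /predU1P[<-|t0].
  rewrite centered_uniform0 integral_dirac//; last first.
    apply: (@measurable_shift _ (EFin \o f)).
    exact/measurable_EFinP.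
  under eq_integral do rewrite mul0r addr0.
  rewrite integral_cst//= lebesgue_measure_itv/= lte_fin ifT; last by lra.
  by rewrite diracE in_setT mul1e addr0 -EFinB -EFinM; congr EFin; field.
rewrite integral_centered_uniform//; last 2 first.
- by apply: (@measurable_shift _ (EFin \o f)); exact/measurable_EFinP.
- by move=> y; rewrite lee_fin.
pose F (y : R) : R := (t * y)%R.
have F'E : F^`()%classic = cst t.
  apply/funext => y; rewrite derive1E; apply: derive_val.
  by apply: is_derive_eq; rewrite /GRing.scale/=; ring.
have cfx : continuous (fun y => f (x + y)%R).
  move=> y; apply: (@continuous_comp _ _ _ (fun y => x + y)%R f); last exact: cf.
  by apply: cvgD; [exact: cvg_cst|exact: cvg_id].
have := @integration_by_substitution_increasing R F (fun y => f (x + y)%R)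
  (- 2^-1)%R 2^-1%R.
rewrite (_ : F (- 2^-1) = - (t / 2))%R; last by rewrite /F; field.
rewrite (_ : F (2^-1) = t / 2)%R; last by rewrite /F; field.
move=> ->.
- rewrite F'E.
  have mft : measurable_fun setT (fun y : R => (f (x + t * y))%:E).
    by apply/measurable_EFinP; exact: (measurableT_comp mf (measurable_affine x t)).
  rewrite (eq_integral (fun y : mR => (f (x + t * y))%:E * t%:E)) => [|y _ //].
  rewrite ge0_integralZr//; try exact: measurable_funTS;
    try (by move=> y _; rewrite lee_fin); try by rewrite lee_fin ltW.
  by rewrite muleC -muleA -EFinM divff ?gt_eqF// mule1.
- lra.
- by move=> y z _ _ yz; rewrite /F ltr_pM2l.
- by rewrite F'E => y _; exact: cvg_cst.
- by rewrite F'E; exact: is_cvg_cst.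
- by rewrite F'E; exact: is_cvg_cst.
- have cF : continuous F.
    by move=> y; apply: cvgM; [exact: cvg_cst|exact: cvg_id].
  split.
  + by move=> y _; apply: derivableM.
  + by apply: cvg_at_right_filter; exact: cF.
  + by apply: cvg_at_left_filter; exact: cF.
- exact: continuous_subspaceT.
Qed.

(** A coupling: both uniforms are multiples [s * y] and [t * y] of one variable with [|y| <= 1 / 2],
    and the step is Lipschitz with constant [1 / h]. *)
Lemma smooth_uniform_lipschitz (s t a h x : R) : (0 <= s)%R -> (0 <= t)%R ->
  (0 < h)%R -> smooth (centered_uniform s) (EFin \o step a h) x <=
  smooth (centered_uniform t) (EFin \o step a h) x + (`|s - t| / h)%:E.
Proof.
move=> s0 t0 h0.
have cst_ := @continuous_step R a h.
have st0 := @step_ge0 R a h.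
rewrite !smooth_uniformE//.
have ms r : measurable_fun setT (fun y : R => (step a h (x + r * y))%:E).
  apply/measurable_EFinP.
  exact: (measurableT_comp (@measurable_step R a h) (measurable_affine x r)).
have msI r : measurable_fun (`[(- 2^-1)%R, 2^-1%R]%classic : set mR)
    (fun y : mR => (step a h (x + r * y))%:E).
  exact: (measurable_funTS (ms r)).
have L : leb `[(- 2^-1)%R, 2^-1%R]%classic = 1.
  by rewrite lebesgue_measure_itv/= lte_fin ifT; [rewrite -EFinB; congr EFin; field|lra].
have -> : (`|s - t| / h)%:E =
    \int[leb]_(y in `[(- 2^-1)%R, 2^-1%R]) (`|s - t| / h)%:E.
  by rewrite integral_cst//= [X in _ = _ * X]L mule1.
rewrite -ge0_integralD//; try exact: msI;
  try (by move=> y _; rewrite lee_fin);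
  try (by move=> y _; rewrite lee_fin divr_ge0// ltW).
apply: ge0_le_integral => //; try exact: msI;
  try (by move=> y _; rewrite lee_fin).
  by apply: emeasurable_funD => //; exact: msI.
move=> y /=; rewrite in_itv/= => /andP[y1 y2]; rewrite -EFinD lee_fin.
apply: (le_trans (step_lipschitz a _ (x + t * y) h0)).
rewrite lerD2l ler_pM2r ?invr_gt0//.
rewrite (_ : x + t * y - (x + s * y) = (t - s) * y)%R; last by ring.
rewrite normrM distrC -[leRHS]mulr1 ler_wpM2l// ler_norml; lra.
Qed.

End centered_uniform.

(** * Moments of the centred normal law *)

Section normal.
Context (R : realType).
Local Notation mR := (measurableTypeR R).
Local Notation leb := (@lebesgue_measure R).
Implicit Types s a b x y : R.

(** The primitive that stands for the integration by parts in the computation of the variance. *)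
Lemma normal_fun_derive s x : s != 0 ->
  is_derive x 1 (fun y => s ^+ 2 * (y * normal_fun 0 s y))
    ((s ^+ 2 - x ^+ 2) * normal_fun 0 s x).
Proof.
move=> s0.
have D1 : is_derive x 1 (fun y : R => - (y - 0) ^+ 2 / (s ^+ 2 *+ 2))
    (- x / s ^+ 2).
  apply: is_derive_eq; rewrite /GRing.scale/= subr0; field; exact: s0.
have D2 := @is_derive1_comp _ expR (fun y : R => - (y - 0) ^+ 2 / (s ^+ 2 *+ 2))
  x _ _ (is_derive_expR _) D1.
have D3 : is_derive x 1 (normal_fun 0 s)
    (expR (- (x - 0) ^+ 2 / (s ^+ 2 *+ 2)) * (- x / s ^+ 2)) by exact: D2.
apply: is_derive_eq; rewrite /GRing.scale/= -/(normal_fun 0 s x).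
by field.
Qed.

Lemma normal_fun_le s x : 0 < s -> 0 < x -> normal_fun 0 s x <= 2 * s ^+ 2 / x ^+ 2.
Proof.
move=> s0 x0; rewrite /normal_fun subr0 mulNr expRN.
have -> : 2 * s ^+ 2 / x ^+ 2 = (x ^+ 2 / (s ^+ 2 *+ 2))^-1.
  by field; rewrite !gt_eqF.
rewrite lef_pV2 ?posrE ?expR_gt0//; last first.
  by rewrite divr_gt0 ?exprn_gt0// pmulrn_lgt0// exprn_gt0.
by rewrite (le_trans _ (expR_ge1Dx _))// lerDr.
Qed.

Lemma normal_fun_cvg0 s : 0 < s ->
  - (s ^+ 2 * (x * normal_fun 0 s x)) @[x --> +oo] --> (0 : R).
Proof.
move=> s0; apply/cvgrPdist_le => e e0; near=> x.
have x0 : 0 < x by near: x; exact: nbhs_pinfty_gt.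
rewrite sub0r normrN normrN ger0_norm; last first.
  by rewrite mulr_ge0 ?sqr_ge0// mulr_ge0 ?normal_fun_ge0// ltW.
apply: (@le_trans _ _ (s ^+ 2 * (x * (2 * s ^+ 2 / x ^+ 2)))).
  by rewrite ler_wpM2l ?sqr_ge0// ler_wpM2l ?(ltW x0)// normal_fun_le.
have -> : s ^+ 2 * (x * (2 * s ^+ 2 / x ^+ 2)) = 2 * s ^+ 4 / x.
  by field; rewrite gt_eqF.
rewrite ler_pdivrMr// [leRHS]mulrC -ler_pdivrMr//.
Unshelve. all: by end_near. Qed.

Let continuous_normal_fun s : continuous (normal_fun 0 s).
Proof.
move=> x; apply: (@continuous_comp _ _ _ (fun x => - (x - 0) ^+ 2 / (s ^+ 2 *+ 2)) expR).
  apply: cvgM; last exact: cvg_cst.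
  apply: (@cvgN _ R^o); apply: (@continuous_comp _ _ _ (fun x => x - 0) (fun x => x ^+ 2)).
    by apply: (@cvgB _ R^o); [exact: cvg_id|exact: cvg_cst].
  exact: exprn_continuous.
exact: continuous_expR.
Qed.

Local Open Scope ereal_scope.

Lemma integral_normal s (f : R -> \bar R) : measurable_fun setT f ->
  (forall x, 0 <= f x) ->
  \int[normal_prob 0 s]_x f x = \int[leb]_x (f x * (normal_pdf 0 s x)%:E).
Proof.
move=> mf f0; apply: integral_density => //.
- exact: measurable_normal_pdf.
- by move=> x; exact: normal_pdf_ge0.
Qed.

Lemma normal_symmetric s : (0 < s)%R -> symmetric_prob (normal_prob 0 s).
Proof.
move=> s0 f mf f0; apply: (@integral_density_sym _ _ (normal_pdf 0 s)) => //.
- exact: measurable_normal_pdf.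
- by move=> x; exact: normal_pdf_ge0.
- by move=> x; rewrite !normal_pdfE ?gt_eqF// /normal_fun !subr0 sqrrN.
Qed.

(** The difference [(s ^+ 2 - x ^+ 2) * normal_fun 0 s x] has the primitive [G], which vanishes at 0
    and at infinity. It changes sign at [s], so the half-line is cut there: each piece contributes
    [G s] with a nonnegative integrand, and the contributions balance. *)
Let integral0y_normal_fun_sqr s : (0 < s)%R ->
  \int[leb]_(x in `[0%R, +oo[) (x ^+ 2 * normal_fun 0 s x)%:E =
  \int[leb]_(x in `[0%R, +oo[) (s ^+ 2 * normal_fun 0 s x)%:E.
Proof.
move=> s0; have s0' : s != 0%R by rewrite gt_eqF.
have D x := normal_fun_derive x s0'.
pose G (x : R) : R := (s ^+ 2 * (x * normal_fun 0 s x))%R.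
have cG : continuous G.
  by move=> x; apply: differentiable_continuous; apply/derivable1_diffP; have [] := D x.
have cx2 : continuous (fun x : R => x ^+ 2 * normal_fun 0 s x : R)%R.
  move=> x; apply: cvgM; [exact: exprn_continuous|exact: continuous_normal_fun].
have cs2 : continuous (fun x : R => s ^+ 2 * normal_fun 0 s x : R)%R.
  move=> x; apply: cvgM; [exact: cvg_cst|exact: continuous_normal_fun].
have c1 : continuous (fun x : R => (s ^+ 2 - x ^+ 2) * normal_fun 0 s x : R)%R.
  move=> x; apply: cvgM; last exact: continuous_normal_fun.
  by apply: cvgB; [exact: cvg_cst|exact: exprn_continuous].
have c2 : continuous (fun x : R => (x ^+ 2 - s ^+ 2) * normal_fun 0 s x : R)%R.
  move=> x; apply: cvgM; last exact: continuous_normal_fun.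
  by apply: cvgB; [exact: exprn_continuous|exact: cvg_cst].
have mc (A : set mR) (g : R -> R) : measurable A -> continuous g ->
    measurable_fun A (EFin \o g : mR -> \bar R).
  move=> mA cg; apply: measurable_funTS; apply/measurable_EFinP.
  exact: continuous_measurable_fun.
have E1 : \int[leb]_(x in `[0%R, s]) ((s ^+ 2 - x ^+ 2) * normal_fun 0 s x)%:E =
    (G s)%:E.
  rewrite (@continuous_FTC2 _ _ G)//.
  - by rewrite /G mul0r mulr0 sube0.
  - exact: continuous_subspaceT.
  - split.
    + by move=> x _; have [] := D x.
    + by apply: cvg_at_right_filter; exact: cG.
    + by apply: cvg_at_left_filter; exact: cG.
  - by move=> x _; rewrite derive1E; have [_ ->] := D x.
have E2 : \int[leb]_(x in `[s, +oo[) ((x ^+ 2 - s ^+ 2) * normal_fun 0 s x)%:E =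
    (G s)%:E.
  have DN (x : R) : is_derive x 1%R (fun x => - G x)%R
      (- ((s ^+ 2 - x ^+ 2) * normal_fun 0 s x))%R by exact: is_deriveN.
  rewrite (@ge0_continuous_FTC2y _ _ (fun x => - G x)%R _ 0%R).
  - by rewrite sub0e -EFinN opprK.
  - move=> x sx; rewrite mulr_ge0 ?normal_fun_ge0// subr_ge0.
    by rewrite ler_sqr// nnegrE ltW// (lt_le_trans s0).
  - exact: continuous_subspaceT.
  - exact: normal_fun_cvg0.
  - by move=> x _; have [] := DN x.
  - by apply: cvg_at_right_filter; apply: cvgN; exact: cG.
  - move=> x _; rewrite derive1E; have [_ ->] := DN x.
    by rewrite -mulNr opprB.
have U : `[0%R, +oo[%classic = `[0%R, s[%classic `|` `[s, +oo[%classic :> set mR.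
  apply/seteqP; split => x /=; rewrite !in_itv/= !andbT.
    by move=> x0; have [sx|xs] := leP s x; [right|left; rewrite x0].
  by case=> [/andP[]//|sx]; rewrite (le_trans (ltW s0)).
have dis : [disjoint `[0%R, s[%classic & `[s, +oo[%classic : set mR].
  apply/disj_setPLR => x /=; rewrite !in_itv/= !andbT => /andP[_ xs] /=.
  by apply/negP; rewrite -ltNge.
rewrite U !ge0_integral_setU//; last 4 first.
- by apply: mc => //; exact: measurableU.
- by move=> x _; rewrite lee_fin mulr_ge0 ?sqr_ge0// normal_fun_ge0.
- by apply: mc => //; exact: measurableU.
- by move=> x _; rewrite lee_fin mulr_ge0 ?sqr_ge0// normal_fun_ge0.
rewrite !integral_itv_bndo_bndc; try exact: mc.
have -> : \int[leb]_(x in `[0%R, s]) (s ^+ 2 * normal_fun 0 s x)%:E =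
    \int[leb]_(x in `[0%R, s]) (x ^+ 2 * normal_fun 0 s x)%:E + (G s)%:E.
  rewrite -E1 -ge0_integralD//.
  - by apply: eq_integral => x _; rewrite -EFinD; congr EFin; ring.
  - by move=> x _; rewrite lee_fin mulr_ge0 ?sqr_ge0// normal_fun_ge0.
  - exact: mc.
  - move=> x /=; rewrite in_itv/= => /andP[x0 xs]; rewrite lee_fin.
    by rewrite mulr_ge0 ?normal_fun_ge0// subr_ge0 ler_sqr// nnegrE ltW.
  - exact: mc.
have -> : \int[leb]_(x in `[s, +oo[) (x ^+ 2 * normal_fun 0 s x)%:E =
    (G s)%:E + \int[leb]_(x in `[s, +oo[) (s ^+ 2 * normal_fun 0 s x)%:E.
  rewrite -E2 -ge0_integralD//.
  - by apply: eq_integral => x _; rewrite -EFinD; congr EFin; ring.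
  - move=> x /=; rewrite in_itv/= andbT => sx; rewrite lee_fin.
    rewrite mulr_ge0 ?normal_fun_ge0// subr_ge0 ler_sqr// nnegrE ?ltW//.
    exact: lt_le_trans sx.
  - exact: mc.
  - by move=> x _; rewrite lee_fin mulr_ge0 ?sqr_ge0// normal_fun_ge0.
  - exact: mc.
by rewrite addeA.
Qed.

Lemma normal_sqr s : (0 < s)%R ->
  \int[normal_prob 0 s]_x (x ^+ 2)%:E = (s ^+ 2)%:E.
Proof.
move=> s0; have s0' : s != 0%R by rewrite gt_eqF.
have N0 : (normal_fun 0 s =1 normal_fun 0 s \o -%R)%R.
  by move=> x; rewrite /normal_fun/= !subr0 sqrrN.
rewrite integral_normal; last 2 first.
- exact/measurable_EFinP/measurable_funX.
- by move=> x; rewrite lee_fin sqr_ge0.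
have mN : measurable_fun setT (normal_fun 0 s) by exact: measurable_normal_fun.
have K0 := @normal_peak_ge0 R s.
have mx2 : measurable_fun [set: mR] (fun x : mR => (x ^+ 2 * normal_fun 0 s x)%:E).
  by apply/measurable_EFinP/measurable_funM => //; exact: measurable_funX.
have ms2 : measurable_fun [set: mR] (fun x : mR => (s ^+ 2 * normal_fun 0 s x)%:E).
  exact/measurable_EFinP/measurable_funM.
have x20 (x : R) : (0 <= x ^+ 2 * normal_fun 0 s x)%R.
  by rewrite mulr_ge0 ?sqr_ge0// normal_fun_ge0.
have s20 (x : R) : (0 <= s ^+ 2 * normal_fun 0 s x)%R.
  by rewrite mulr_ge0 ?sqr_ge0// normal_fun_ge0.
transitivity ((normal_peak s)%:E * \int[leb]_x (x ^+ 2 * normal_fun 0 s x)%:E).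
  rewrite -ge0_integralZl//; try (by move=> x _; rewrite lee_fin).
  by apply: eq_integral => x _; rewrite normal_pdfE// -!EFinM; congr EFin; ring.
have -> : \int[leb]_x (x ^+ 2 * normal_fun 0 s x)%:E =
    \int[leb]_x (s ^+ 2 * normal_fun 0 s x)%:E.
  rewrite !ge0_symfun_integralT//.
  - by rewrite -set_itvcy integral0y_normal_fun_sqr.
  - by move=> x; apply: cvgM; [exact: cvg_cst|exact: continuous_normal_fun].
  - by move=> x /=; rewrite {1}N0.
  - by move=> x; apply: cvgM; [exact: exprn_continuous|exact: continuous_normal_fun].
  - by move=> x /=; rewrite {1}N0 sqrrN.
rewrite -ge0_integralZl//; try (by move=> x _; rewrite lee_fin).
rewrite -[RHS]mule1 -(integral_normal_pdf 0 s) -ge0_integralZl//.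
- by apply: eq_integral => x _; rewrite normal_pdfE// -!EFinM; congr EFin; ring.
- by apply/measurable_EFinP; exact: measurable_normal_pdf.
- by move=> x _; rewrite lee_fin normal_pdf_ge0.
- by rewrite lee_fin sqr_ge0.
Qed.

(** The cube is absorbed by doubling the standard deviation, which bounds the third moment without
    computing it. With [w = |x| / s] the two Gaussians have ratio [expR (- (3 * w ^+ 2 / 8))]; the
    constant 64 is the bound 32 in [Q] times the ratio 2 of the peaks. *)
Lemma normal_pdf_cube s x : (0 < s)%R ->
  (`|x| ^+ 3 * normal_pdf 0 s x <= 64 * s ^+ 3 * normal_pdf 0 (2 * s) x)%R.
Proof.
move=> s0; have s0' : s != 0%R by rewrite gt_eqF.
rewrite !normal_pdfE ?mulf_neq0//.
have -> : normal_peak (2 * s) = (normal_peak s / 2)%R.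
  rewrite /normal_peak -invfM; congr GRing.inv.
  rewrite (_ : (2 * s) ^+ 2 * pi *+ 2 = 2 ^+ 2 * (s ^+ 2 * pi *+ 2))%R; last by ring.
  by rewrite sqrtrM ?sqr_ge0// sqrtr_sqr ger0_norm// mulrC.
pose w : R := (`|x| / s)%R.
have w0 : (0 <= w)%R by rewrite divr_ge0// ltW.
have xw : (x ^+ 2 = w ^+ 2 * s ^+ 2)%R.
  rewrite /w expr_div_n divfK ?expf_neq0//.
  by rewrite -normrX ger0_norm// sqr_ge0.
have x3 : (`|x| ^+ 3 = w ^+ 3 * s ^+ 3)%R.
  by rewrite /w expr_div_n divfK ?expf_neq0.
have E : (normal_fun 0 s x = normal_fun 0 (2 * s) x * expR (- (3 * w ^+ 2 / 8)))%R.
  rewrite /normal_fun subr0 -expRD; congr expR; rewrite xw; field; exact: s0'.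
have Q : (w ^+ 3 * expR (- (3 * w ^+ 2 / 8)) <= 32)%R.
  rewrite expRN ler_pdivrMr ?expR_gt0//.
  (* Squaring [1 + z <= expR z] produces a fourth power of [w], which dominates the cube. *)
  have e2 : (1 + 9 * w ^+ 4 / 256 <= expR (3 * w ^+ 2 / 8))%R.
    rewrite (_ : 3 * w ^+ 2 / 8 = 3 * w ^+ 2 / 16 + 3 * w ^+ 2 / 16)%R; last by field.
    rewrite expRD.
    have H := expR_ge1Dx (3 * w ^+ 2 / 16)%R.
    have w2 : (0 <= 3 * w ^+ 2 / 16)%R by rewrite divr_ge0// mulr_ge0// sqr_ge0.
    apply: (@le_trans _ _ ((1 + 3 * w ^+ 2 / 16) * (1 + 3 * w ^+ 2 / 16))%R).
      rewrite (_ : 9 * w ^+ 4 / 256 = (3 * w ^+ 2 / 16) * (3 * w ^+ 2 / 16))%R.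
        by move: w2; clear; set q := (_ / 16)%R; nra.
      by field.
    by apply: ler_pM => //; rewrite addr_ge0.
  apply: (@le_trans _ _ (32 * (1 + 9 * w ^+ 4 / 256))%R); last by rewrite ler_pM2l.
  have : (0 <= (w - w ^+ 2) ^+ 2)%R by exact: sqr_ge0.
  have : (0 <= (w ^+ 2 - 1) ^+ 2)%R by exact: sqr_ge0.
  have : (0 <= (w ^+ 2) ^+ 2)%R by exact: sqr_ge0.
  by clear; nra.
rewrite x3 E.
have K0 := @normal_peak_ge0 R s.
have N0 := @normal_fun_ge0 R 0 (2 * s) x.
rewrite (_ : w ^+ 3 * s ^+ 3 * (normal_peak s * (normal_fun 0 (2 * s) x *
    expR (- (3 * w ^+ 2 / 8)))) = (w ^+ 3 * expR (- (3 * w ^+ 2 / 8))) *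
    (s ^+ 3 * normal_peak s * normal_fun 0 (2 * s) x))%R; last by ring.
rewrite (_ : 64 * s ^+ 3 * (normal_peak s / 2 * normal_fun 0 (2 * s) x) =
   32 * (s ^+ 3 * normal_peak s * normal_fun 0 (2 * s) x))%R; last by field.
have s30 : (0 <= s ^+ 3)%R by rewrite exprn_ge0// ltW.
by apply: ler_wpM2r => //; apply: mulr_ge0 => //; exact: mulr_ge0.
Qed.

Lemma normal_cube s : (0 < s)%R ->
  \int[normal_prob 0 s]_x (`|x| ^+ 3)%:E <= (64 * s ^+ 3)%:E.
Proof.
move=> s0; rewrite integral_normal//; last exact: measurable_norm_cube.
rewrite -[leRHS]mule1 -(integral_normal_pdf 0 (2 * s)) -ge0_integralZl//; last 3 first.
- by apply/measurable_EFinP; exact: measurable_normal_pdf.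
- by move=> x _; rewrite lee_fin normal_pdf_ge0.
- by rewrite lee_fin mulr_ge0// exprn_ge0// ltW.
apply: ge0_le_integral => //.
- by move=> x _; rewrite mule_ge0// lee_fin normal_pdf_ge0.
- apply: emeasurable_funM; first exact: measurable_norm_cube.
  by apply/measurable_EFinP; exact: measurable_normal_pdf.
- by apply: measurable_funeM; apply/measurable_EFinP; exact: measurable_normal_pdf.
- by move=> x _; rewrite -!EFinM lee_fin normal_pdf_cube.
Qed.

End normal.

(** * Stability of normal laws and the full replacement *)

Section normal_convolution.
Context (R : realType).
Local Notation mR := (measurableTypeR R).
Local Notation leb := (@lebesgue_measure R).
Implicit Types a b x y : R.

Lemma normal_peakM (a b c d : R) : 0 < a -> 0 < b -> 0 < c -> 0 < d -> a * b = c * d ->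
  normal_peak a * normal_peak b = normal_peak c * normal_peak d :> R.
Proof.
move=> a0 b0 c0 d0 abcd; rewrite /normal_peak -!invfM; congr GRing.inv.
have P x : 0 < x -> Num.sqrt (x ^+ 2 * pi *+ 2) = x * Num.sqrt (pi *+ 2).
  move=> x0; rewrite -mulrnAr sqrtrM ?sqr_ge0// sqrtr_sqr ger0_norm// ltW//.
by rewrite !P// mulrACA abcd mulrACA.
Qed.

(** Completing the square in [y]. The second factor on the right is the conditional density of the
    first summand given that the sum is [x]. *)
Lemma normal_pdf_conv (a b c x y : R) : 0 < a -> 0 < b -> 0 < c ->
  c ^+ 2 = a ^+ 2 + b ^+ 2 ->
  normal_pdf 0 b (x - y) * normal_pdf 0 a y =
  normal_pdf 0 c x * normal_pdf (x * a ^+ 2 / c ^+ 2) (a * b / c) y.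
Proof.
move=> a0 b0 c0 cab; have d0 : 0 < a * b / c by rewrite divr_gt0// mulr_gt0.
have [an bn cn dn] : [/\ a != 0, b != 0, c != 0 & a * b / c != 0].
  by rewrite !gt_eqF.
rewrite !normal_pdfE// mulrACA [RHS]mulrACA; congr (_ * _).
  apply: normal_peakM => //; by rewrite mulrC mulrCA divff// mulr1.
rewrite /normal_fun -!expRD !subr0; congr expR.
have ab0 : a ^+ 2 + b ^+ 2 != 0 by rewrite -cab expf_neq0.
rewrite !exprMn exprVn cab; field.
by rewrite ab0 an bn.
Qed.

Local Open Scope ereal_scope.

Lemma smooth_normal_conv (a b c : R) (f : R -> \bar R) : (0 < a)%R -> (0 < b)%R ->
  (0 < c)%R -> (c ^+ 2 = a ^+ 2 + b ^+ 2)%R -> measurable_fun setT f ->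
  (forall x, 0 <= f x) ->
  smooth (normal_prob 0 a) (smooth (normal_prob 0 b) f) =
  smooth (normal_prob 0 c) f.
Proof.
move=> a0 b0 c0 cab mf f0; apply/funext => x.
have mfx z : measurable_fun setT (fun y : R => f (z + y)%R) by exact: measurable_shift.
have mp s : measurable_fun setT (fun y : R => (normal_pdf 0 s y)%:E).
  by apply/measurable_EFinP; exact: measurable_normal_pdf.
have p0 s (y : R) : 0 <= (normal_pdf 0 s y)%:E by rewrite lee_fin normal_pdf_ge0.
rewrite {1}/smooth integral_normal; last 2 first.
- exact: (measurable_shift x (measurable_smooth (normal_prob 0 b) mf f0)).
- by move=> y; exact: smooth_ge0.
pose k (z : mR * mR) : \bar R := f (x + z.2)%R *
  ((normal_pdf 0 b (z.2 - z.1))%:E * (normal_pdf 0 a z.1)%:E).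
have mk : measurable_fun setT k.
  apply: emeasurable_funM; first by apply: (measurableT_comp (mfx x)).
  apply: emeasurable_funM; last exact: (measurableT_comp (mp a)).
  apply: (measurableT_comp (mp b)); exact: measurable_funB.
have k0 z : 0 <= k z by rewrite /k !mule_ge0.
transitivity (\int[leb]_y \int[leb]_w k (y, w)).
  apply: eq_integral => y _; rewrite /smooth integral_normal//.
  pose g (w : R) := f (x + w)%R * (normal_pdf 0 b (w - y))%:E.
  have mg : measurable_fun setT g.
    apply: emeasurable_funM; first exact: mfx.
    by apply: (measurableT_comp (mp b)); exact: measurable_funB.
  have g0 w : 0 <= g w by rewrite /g mule_ge0.
  have -> : \int[leb]_z (f (x + y + z)%R * (normal_pdf 0 b z)%:E) = \int[leb]_w g w.
    rewrite -(integral_lebesgueD y mg g0); apply: eq_integral => z _.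
    by rewrite /g addrK [(z + y)%R]addrC addrA.
  rewrite -ge0_integralZr//.
  by apply: eq_integral => w _; rewrite /k/= muleA.
rewrite (@fubini_tonelli _ _ _ _ _ leb leb _ mk k0) {1}/smooth integral_normal//.
apply: eq_integral => w _; rewrite /k/=.
have mh : measurable_fun setT
    (fun y : R => (normal_pdf (w * a ^+ 2 / c ^+ 2) (a * b / c) y)%:E).
  by apply/measurable_EFinP; exact: measurable_normal_pdf.
(* With the value [w] of the sum fixed, only the conditional density depends on [y], and it
   integrates to 1. *)
transitivity (\int[leb]_y (f (x + w)%R * (normal_pdf 0 c w)%:E *
    (normal_pdf (w * a ^+ 2 / c ^+ 2) (a * b / c) y)%:E)).
  apply: eq_integral => y _; rewrite -muleA -!EFinM.
  by rewrite (normal_pdf_conv w y a0 b0 c0 cab).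
rewrite ge0_integralZl//; last 2 first.
- by move=> y _; rewrite lee_fin normal_pdf_ge0.
- by rewrite mule_ge0.
by rewrite integral_normal_pdf mule1.
Qed.

Definition centered_normal (s : R) : probability mR R := normal_prob 0 s.

Lemma smooths_normal (I : Type) (s : seq I) (sg : I -> R) (f : R -> \bar R) :
  measurable_fun setT f -> (forall x, 0 <= f x) -> (forall i, 0 < sg i)%R ->
  (0 < size s)%N ->
  smooths [seq centered_normal (sg i) | i <- s] f =
  smooth (centered_normal (Num.sqrt (\sum_(i <- s) sg i ^+ 2))) f.
Proof.
move=> mf f0 sg0; elim: s => [h|i s IH]; first by exfalso; rewrite ltnn in h.
case: s IH => [_ _|j s IH _].
  by rewrite big_seq1 sqrtr_sqr (gtr0_norm (sg0 i)).
have sq (l : seq I) k : (0 < \sum_(i <- k :: l) sg i ^+ 2)%R.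
  rewrite big_cons; apply: ltr_pwDl; first exact: exprn_gt0 (sg0 k).
  by apply: sumr_ge0 => l' _; exact: sqr_ge0.
rewrite (_ : smooths _ f = smooth (centered_normal (sg i))
    (smooths [seq centered_normal (sg i) | i <- j :: s] f)); last by [].
rewrite (IH isT); apply: smooth_normal_conv.
- exact: sg0.
- by rewrite sqrtr_gt0.
- by rewrite sqrtr_gt0.
- by rewrite (sqr_sqrtr (ltW (sq _ _))) (sqr_sqrtr (ltW (sq _ _))) big_cons.
- exact: mf.
- exact: f0.
Qed.

(* Lindeberg: replace the uniform summands by centered normal ones of the same
   variance; the error is of third order. *)
Lemma lindeberg (d : nat -> R) (n : nat) (a h : R) : (0 < h)%R -> (0 < n)%N ->
  (forall k, (k < n)%N -> (0 < d k)%R) ->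
  (forall k, (d k <= d 0%N)%R) ->
  (\sum_(0 <= k < n) d k ^+ 2 = 12)%R ->
  let I := smooths [seq centered_uniform (d k) | k <- iota 0 n] (EFin \o step a h) 0%R in
  let J := \int[std_normal R]_x (step a h x)%:E in
  let e := (780 * d 0%N / h ^+ 3)%:E in I <= J + e /\ J <= I + e.
Proof.
move=> h0 n0 d0 dmax d12 I J e.
(* The lemmas on normal laws ask for positivity at every index, so the values past [n] are replaced
   by 1; only indices below [n] enter the sums. *)
pose d' k : R := if (k < n)%N then d k else 1%R.
have d'0 k : (0 < d' k)%R by rewrite /d'; case: ifP => // /d0.
have sd k : k \in iota 0 n -> d k = d' k.
  by rewrite mem_iota /d' add0n => /andP[_ ->].
(* A uniform law of width [t] has variance [t ^+ 2 / 12]; hence the standard deviations [sg], whose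
   squares sum to 1. *)
have s12 : (0 < Num.sqrt 12 :> R)%R by rewrite sqrtr_gt0.
pose sg k : R := (d' k / Num.sqrt 12)%R.
have sg0 k : (0 < sg k)%R by rewrite divr_gt0.
have sg2 k : (sg k ^+ 2 = d' k ^+ 2 / 12)%R.
  by rewrite /sg expr_div_n sqr_sqrtr.
have sgd k : (sg k <= d' k)%R.
  rewrite /sg ler_pdivrMr// ler_peMr ?ltW//.
  by rewrite -{1}sqrtr1 ltr_sqrt// ltr1n.
have mst : measurable_fun setT (EFin \o step a h).
  by apply/measurable_EFinP; exact: measurable_step.
have st0 x : 0 <= (EFin \o step a h) x by rewrite lee_fin step_ge0.
have IE : I = smooths [seq centered_uniform (d' k) | k <- iota 0 n] (EFin \o step a h) 0%R.
  by rewrite /I; congr (smooths _ _ _); apply/eq_in_map => k /sd ->.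
have JE : J = smooths [seq centered_normal (sg k) | k <- iota 0 n] (EFin \o step a h) 0%R.
  rewrite smooths_normal ?size_iota//.
  have -> : (\sum_(i <- iota 0 n) sg i ^+ 2 = 1)%R.
    transitivity (\sum_(0 <= k < n) d k ^+ 2 / 12)%R.
      rewrite /index_iota subn0; apply: eq_big_seq => k /sd dk.
      by rewrite sg2 -dk.
    by rewrite -mulr_suml d12 divff.
  rewrite sqrtr1 /J /smooth /std_normal.
  transitivity (\int[normal_prob 0 1]_x (step a h x)%:E).
    by apply: eq_measure_integral => A mA _; rewrite /= borel_restrE.
  by apply: eq_integral => x _; rewrite /= add0r.
pose c k : R := ((d' k ^+ 3 + 64 * sg k ^+ 3) / h ^+ 3)%R.
have c0 k : (0 <= c k)%R.
  by rewrite divr_ge0// ?addr_ge0 ?mulr_ge0 ?exprn_ge0// ltW.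
(* Third moments are at most [d ^+ 3] for the uniform and [64 * sg ^+ 3] for the normal law, so at
   most [65 * d 0 * d k ^+ 2] in total for index [k]. The squares sum to 12, and [65 * 12 = 780]. *)
have cC : (\sum_(k <- iota 0 n) c k <= 780 * d 0%N / h ^+ 3)%R.
  rewrite /c -mulr_suml ler_pM2r ?invr_gt0 ?exprn_gt0//.
  apply: (@le_trans _ _ (\sum_(0 <= k < n) (65 * d 0%N) * d k ^+ 2)%R).
    rewrite /index_iota subn0 !big_seq; apply: ler_sum => k kn.
    have dk := sd _ kn; rewrite dk.
    have H1 : (sg k ^+ 3 <= d' k ^+ 3)%R.
      by apply: lerXn2r (sgd k); rewrite nnegrE; exact: ltW.
    have H2 : (d' k ^+ 3 <= d 0%N * d' k ^+ 2)%R.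
      by rewrite exprS ler_wpM2r ?sqr_ge0// -dk.
    by move: H1 H2; rewrite -mulrA; clear; lra.
  by rewrite -mulr_sumr d12; clear; lra.
have comp1 k x : k \in iota 0 n -> smooth (centered_uniform (d' k)) (EFin \o step a h) x <=
    smooth (centered_normal (sg k)) (EFin \o step a h) x + (c k)%:E.
  move=> _; apply: (smooth_step_compare (v := (d' k ^+ 2 / 12)%R)) => //.
  - exact: centered_uniform_symmetric.
  - exact: normal_symmetric.
  - exact: centered_uniform_sqr.
  - by rewrite -sg2; exact: normal_sqr.
  - exact: centered_uniform_cube.
  - exact: normal_cube.
have comp2 k x : k \in iota 0 n -> smooth (centered_normal (sg k)) (EFin \o step a h) x <=
    smooth (centered_uniform (d' k)) (EFin \o step a h) x + (c k)%:E.
  move=> _; rewrite /c [X in (X / _)%R]addrC.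
  apply: (smooth_step_compare (v := (d' k ^+ 2 / 12)%R)) => //.
  - exact: normal_symmetric.
  - exact: centered_uniform_symmetric.
  - by rewrite -sg2; exact: normal_sqr.
  - exact: centered_uniform_sqr.
  - exact: normal_cube.
  - exact: centered_uniform_cube.
rewrite IE JE; split.
  apply: (le_trans (le_smooths_sum mst st0 c0 comp1 _)).
  by rewrite leeD2l// lee_fin.
apply: (le_trans (le_smooths_sum mst st0 c0 comp2 _)).
by rewrite leeD2l// lee_fin.
Qed.

End normal_convolution.

(** * Stability of sorting *)

Section sorting.
Context (R : realType).
Implicit Types (s : seq R) (x e : R).

Lemma sorted_ge_nth s i j : sorted >=%R s -> (i <= j)%N -> (j < size s)%N ->
  nth 0 s j <= nth 0 s i.
Proof.
move=> ss ij js.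
have ge_trans : transitive (>=%R : rel R) by move=> y x z xy yz; exact: le_trans yz xy.
have is_ : (i < size s)%N by exact: leq_ltn_trans ij js.
have ge_refl : reflexive (>=%R : rel R) by move=> y; exact: lexx.
by apply: (sorted_leq_nth ge_trans ge_refl 0 ss) => //; rewrite inE.
Qed.

(** Turns an entry of the sorted list into a count, which ignores the order of [s]. *)
Lemma le_nth_sort s k x : (k < size s)%N ->
  (x <= nth 0 (sort >=%R s) k) = (k < count (fun y => (x <= y)%R) s)%N.
Proof.
move=> ks; set s' := sort _ _.
have ss : sorted >=%R s' by apply: sort_sorted => y z; exact: le_total.
have <- : count (fun y => (x <= y)%R) s' = count (fun y => (x <= y)%R) s.
  by apply/permP; rewrite perm_sort.
have ks' : (k < size s')%N by rewrite size_sort.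
have [xk|kx] := leP x (nth 0 s' k); apply/esym.
  rewrite -(cat_take_drop k.+1 s') count_cat.
  apply: leq_trans (leq_addr _ _).
  have -> : count (fun y => (x <= y)%R) (take k.+1 s') = k.+1 by
    rewrite -[RHS](size_takel ks'); apply/eqP; rewrite -all_count;
    apply/(all_nthP 0) => i; rewrite (size_takel ks') => ik;
    rewrite nth_take//; apply: (le_trans xk); exact: sorted_ge_nth.
  by [].
apply/negbTE; rewrite -leqNgt -(cat_take_drop k s') count_cat.
have -> : count (fun y => (x <= y)%R) (drop k s') = 0%N.
  apply/eqP; rewrite -leqn0 leqNgt -has_count; apply/(has_nthP 0) => -[i].
  rewrite size_drop nth_drop => iks; apply/negP; rewrite -ltNge.
  apply: le_lt_trans kx; apply: sorted_ge_nth => //; first exact: leq_addr.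
  by rewrite -ltn_subRL.
by rewrite addn0 (leq_trans (count_size _ _))// size_take; case: ltnP.
Qed.

Lemma sort_map_le (I : eqType) (l : seq I) (f g : I -> R) e k :
  (k < size l)%N -> (forall i, i \in l -> f i <= g i + e) ->
  nth 0 (sort >=%R (map f l)) k <= nth 0 (sort >=%R (map g l)) k + e.
Proof.
move=> kl fg; rewrite -lerBlDr le_nth_sort ?size_map// count_map.
set x := nth _ _ _.
have : (k < count (fun y => (x <= y)%R) (map f l))%N by rewrite -le_nth_sort ?size_map.
rewrite count_map => /leq_trans; apply.
rewrite (@eq_in_count _ _ (predI (preim f (fun y => (x <= y)%R)) (mem l))); last first.
  by move=> i il /=; rewrite il andbT.
apply: sub_count => i /= /andP[xi il].
by rewrite lerBlDr (le_trans xi)// fg.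
Qed.

End sorting.

(** * Norm and size bounds for distance multisets *)

Section distances.
Context (R : realType).
Implicit Types (t : seq R) (u : nat -> R).

Definition index_pairs m : seq (nat * nat) :=
  [seq (i, j) | j <- iota 0 m, i <- iota 0 j].

Lemma index_pairsP m p : p \in index_pairs m -> (p.1 < p.2)%N /\ (p.2 < m)%N.
Proof.
move=> /allpairsPdep[j [i [+ + ->]]] /=.
by rewrite !mem_iota !add0n.
Qed.

Lemma distance_multisetE t : distance_multiset t =
  multiset_seq [seq t`_p.1 - t`_p.2 | p <- index_pairs (size t)].
Proof. by rewrite /distance_multiset /index_pairs map_allpairs. Qed.

Lemma l2normE u n : (forall k, (n <= k)%N -> u k = 0) ->
  l2norm u = Num.sqrt (\sum_(0 <= k < n) u k ^+ 2).
Proof.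
move=> u0; rewrite /l2norm; congr Num.sqrt; apply/cvg_lim => //.
apply: cvg_near_cst; exists n => // m /= nm; rewrite /series/=.
rewrite (big_cat_nat (n := n))//= [X in _ + X]big_nat_cond.
by rewrite [X in _ + X]big1 ?addr0// => k /andP[/andP[/u0 ->]]; rewrite expr0n.
Qed.

Lemma multiset_seq_ge0 (s : seq R) k : {in s, forall x, 0 <= x} ->
  0 <= multiset_seq s k.
Proof.
move=> s0; rewrite /multiset_seq; have [ks|ks] := ltnP k (size (sort >=%R s)).
  by apply: s0; rewrite -(mem_sort >=%R) mem_nth.
by rewrite nth_default.
Qed.

Lemma multiset_seq_le1 (s : seq R) k : {in s, forall x, x <= 1} ->
  multiset_seq s k <= 1.
Proof.
move=> s1; rewrite /multiset_seq; have [ks|ks] := ltnP k (size (sort >=%R s)).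
  by apply: s1; rewrite -(mem_sort >=%R) mem_nth.
by rewrite nth_default.
Qed.

Lemma multiset_seq_out (s : seq R) k : (size s <= k)%N -> multiset_seq s k = 0.
Proof. by move=> sk; rewrite /multiset_seq nth_default// size_sort. Qed.

Lemma multiset_seq_homo (s : seq R) i j : {in s, forall x, 0 <= x} ->
  (i <= j)%N -> multiset_seq s j <= multiset_seq s i.
Proof.
move=> s0 ij; have [js|js] := ltnP j (size s); last first.
  by rewrite (multiset_seq_out js) multiset_seq_ge0.
apply: sorted_ge_nth => //; last by rewrite size_sort.
by apply: sort_sorted => y z; exact: le_total.
Qed.

Lemma multiset_seq_sumsq (s : seq R) :
  \sum_(0 <= k < size s) multiset_seq s k ^+ 2 = \sum_(x <- s) x ^+ 2.
Proof.
rewrite [RHS](perm_big (sort >=%R s)) /=; last by rewrite perm_sym perm_sort.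
by rewrite [RHS](big_nth 0) size_sort.
Qed.

Lemma unit_span_ge0 t k : unit_span_multiset t -> 0 <= t`_k <= 1.
Proof.
move=> [s2 ss t0 tl]; have [ks|ks] := ltnP k (size t); last first.
  by rewrite nth_default// lexx ler01.
have s0 : (0 < size t)%N by exact: ltn_trans s2.
apply/andP; split; last by rewrite -t0 sorted_ge_nth.
apply: (@le_trans _ _ t`_(size t).-1); first by rewrite tl.
by apply: sorted_ge_nth => //; rewrite ?prednK// -ltnS prednK.
Qed.

Definition distances t : seq R :=
  [seq t`_p.1 - t`_p.2 | p <- index_pairs (size t)].

Lemma distances01 t : unit_span_multiset t ->
  {in distances t, forall x, 0 <= x <= 1}.
Proof.
move=> ut _ /mapP[p /index_pairsP[p12 p2] ->].
have [s2 ss t0 tl] := ut.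
have := unit_span_ge0 p.1 ut; have := unit_span_ge0 p.2 ut.
have : t`_p.2 <= t`_p.1 by apply: sorted_ge_nth => //; exact: ltnW.
by move=> h /andP[? ?] /andP[? ?]; apply/andP; split; lra.
Qed.

Lemma sum_index_pairs m (F : nat * nat -> R) :
  \sum_(p <- index_pairs m) F p = \sum_(0 <= j < m) \sum_(0 <= i < j) F (i, j).
Proof.
rewrite big_allpairs_dep /index_iota subn0; apply: eq_bigr => j _.
by rewrite subn0.
Qed.

(* The pairs containing an end point 0 or 1 already contribute
   \sum_k (1 - t_k)^2 and \sum_k t_k^2. *)
Lemma distances_sumsq_ge t : unit_span_multiset t ->
  (size t)%:R / 4 <= \sum_(x <- distances t) x ^+ 2.
Proof.
move=> ut; have [s2 ss t0 tl] := ut.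
rewrite /distances big_map sum_index_pairs; set m := size t in s2 tl *.
pose a j := \sum_(0 <= i < j) (t`_i - t`_j) ^+ 2.
rewrite (_ : \sum_(0 <= j < m) _ = \sum_(0 <= j < m) a j)//.
have a0 j : 0 <= a j by apply: sumr_ge0 => i _; exact: sqr_ge0.
have m0 : (0 < m)%N by exact: ltn_trans s2.
have A1 : \sum_(0 <= j < m) (1 - t`_j) ^+ 2 <= \sum_(0 <= j < m) a j.
  apply: ler_sum => -[|j] _; first by rewrite t0 subrr expr0n a0.
  rewrite /a big_nat_recl// t0 lerDl.
  by apply: sumr_ge0 => i _; exact: sqr_ge0.
have A2 : \sum_(0 <= j < m) t`_j ^+ 2 <= \sum_(0 <= j < m) a j.
  rewrite -(prednK m0) big_nat_recr//= [leRHS]big_nat_recr//= tl expr0n addr0.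
  rewrite -[leLHS]add0r lerD//; first by apply: sumr_ge0.
  rewrite /a; apply: ler_sum => i _; by rewrite tl subr0.
(* Each term is at least [1 / 2]. As each of the two sums is bounded by the sum over pairs, twice
   the latter is at least [m / 2]. *)
have A3 : m%:R / 2 <= \sum_(0 <= j < m) ((1 - t`_j) ^+ 2 + t`_j ^+ 2).
  have -> : m%:R / 2 = \sum_(0 <= j < m) (2^-1 : R).
    by rewrite sumr_const_nat subn0 mulr_natl.
  apply: ler_sum => j _; have := sqr_ge0 (t`_j - 2^-1); nra.
rewrite big_split/= in A3; move: A1 A2 A3; lra.
Qed.

Lemma hat_distance t : unit_span_multiset t ->
  let u := hat (distance_multiset t) in
  [/\ forall k, 0 <= u k, forall i j, (i <= j)%N -> u j <= u i,
      forall k, (size (index_pairs (size t)) <= k)%N -> u k = 0,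
      \sum_(0 <= k < size (index_pairs (size t))) u k ^+ 2 = 12 &
      forall k, u k ^+ 2 <= 48 / (size t)%:R].
Proof.
move=> ut u; have d01 := distances01 ut.
have d0 : {in distances t, forall x, 0 <= x} by move=> x /d01/andP[].
have d1 : {in distances t, forall x, x <= 1} by move=> x /d01/andP[].
have N : size (distances t) = size (index_pairs (size t)) by rewrite size_map.
have T0 := distances_sumsq_ge ut; set T := \sum_(x <- _) _ in T0.
have m0 : 0 < (size t)%:R :> R.
  by rewrite ltr0n; have [s2 _ _ _] := ut; exact: ltn_trans s2.
have Tgt0 : 0 < T by apply: lt_le_trans T0; rewrite divr_gt0.
have nE : l2norm (distance_multiset t) = Num.sqrt T.
  rewrite (@l2normE _ (size (distances t))).
    by rewrite distance_multisetE multiset_seq_sumsq.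
  by move=> k; rewrite distance_multisetE; exact: multiset_seq_out.
have n0 : 0 < Num.sqrt T by rewrite sqrtr_gt0.
have uE k : u k = Num.sqrt 12 * multiset_seq (distances t) k / Num.sqrt T.
  by rewrite /u /hat nE distance_multisetE.
have s12 : 0 <= Num.sqrt 12 :> R by exact: sqrtr_ge0.
have u2 k : u k ^+ 2 = 12 / T * multiset_seq (distances t) k ^+ 2.
  rewrite uE expr_div_n exprMn !sqr_sqrtr ?(ltW Tgt0)// ?ler0n//.
  by rewrite mulrAC.
split.
- by move=> k; rewrite uE divr_ge0 ?(ltW n0)// mulr_ge0// multiset_seq_ge0.
- move=> i j ij; rewrite !uE ler_pM2r ?invr_gt0// ler_wpM2l//.
  exact: multiset_seq_homo.
- by move=> k Nk; rewrite uE multiset_seq_out ?N// mulr0 mul0r.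
- under eq_bigr do rewrite u2.
  by rewrite -mulr_sumr -N multiset_seq_sumsq -/T divfK// gt_eqF.
- move=> k; rewrite u2.
  have u01 : 0 <= multiset_seq (distances t) k <= 1.
    by rewrite multiset_seq_ge0//= multiset_seq_le1.
  apply: (@le_trans _ _ (12 / T)).
    rewrite ler_piMr ?divr_ge0 ?(ltW Tgt0) ?ler0n//.
    by move/andP: u01 => [? ?]; rewrite exprn_ile1.
  rewrite ler_pdivrMr// mulrAC ler_pdivlMr//.
  move: T0; clear -m0 Tgt0; lra.
Qed.

(** Coinciding points produce zero distances, so the number of positive entries may be smaller than
    the number of pairs; [n] is the first index at which the decreasing sequence vanishes. *)
Lemma P_DISTP (u : {ptws nat -> R}) : P_DIST R u -> exists n : nat,
  [/\ (0 < n)%N, forall k, (k < n)%N -> 0 < u k,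
     forall k, (n <= k)%N -> u k = 0, forall i j, (i <= j)%N -> u j <= u i &
     \sum_(0 <= k < n) u k ^+ 2 = 12].
Proof.
move=> [t ut <-]; have [] := hat_distance ut.
set v := hat _; set N := size _ => v0 vd vN v12 _.
have ex : exists k, v k == 0 by exists N; rewrite vN.
case: (ex_minnP ex) => n /eqP vn nmin.
have vn0 k : (n <= k)%N -> v k = 0.
  by move=> nk; apply/eqP; rewrite eq_le v0 -vn vd.
have nN : (n <= N)%N by apply: nmin; rewrite vN.
have S : \sum_(0 <= k < n) v k ^+ 2 = 12.
  rewrite -v12 [RHS](big_cat_nat (n := n))//= [X in _ + X]big_nat_cond.
  by rewrite [X in _ + X]big1 ?addr0// => k /andP[/andP[/vn0 ->]]; rewrite expr0n.
exists n; split => //.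
- by rewrite lt0n; apply/eqP => n0; move: S; rewrite n0 big_nil => /eqP; rewrite lt_eqF.
- move=> k kn; rewrite lt_neqAle v0 andbT eq_sym; apply/eqP => /eqP/nmin.
  by rewrite leqNgt kn.
Qed.

End distances.

(** * Continuity of the normalised distance multiset *)

Section hat_continuity.
Context (R : realType) (T : topologicalType) (c : nat -> T -> R).
Hypothesis cc : forall k, continuous (c k).
Implicit Types x y : T.

Let sq m x : seq R := mkseq (c^~ x) m.

Let distances_sq m x :
  distances (sq m x) = [seq c p.1 x - c p.2 x | p <- index_pairs m].
Proof.
rewrite /distances size_mkseq; apply/eq_in_map => p /index_pairsP[p12 p2].
by rewrite !nth_mkseq//; exact: ltn_trans p2.
Qed.

Let sumsq (l : seq (nat * nat)) x : R := \sum_(p <- l) (c p.1 x - c p.2 x) ^+ 2.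

Let l2norm_sq m x :
  l2norm (distance_multiset (sq m x)) = Num.sqrt (sumsq (index_pairs m) x).
Proof.
rewrite (@l2normE _ _ (size (distances (sq m x)))).
  by rewrite distance_multisetE multiset_seq_sumsq -/(distances _)
    distances_sq big_map.
by move=> k; rewrite distance_multisetE; exact: multiset_seq_out.
Qed.

Let sumsq_continuous l : continuous (sumsq l).
Proof.
move=> x; elim: l => [|p l IH].
  rewrite (_ : sumsq [::] = cst 0); first exact: cvg_cst.
  by apply/funext => y; rewrite /sumsq big_nil.
rewrite (_ : sumsq (p :: l) = (fun y => (c p.1 y - c p.2 y) ^+ 2 + sumsq l y)).
  apply: cvgD; last exact: IH.
  apply: (@continuous_comp _ _ _ (fun y => c p.1 y - c p.2 y) (fun z => z ^+ 2)).
    by apply: cvgB; exact: cc.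
  exact: exprn_continuous.
by apply/funext => y; rewrite /sumsq big_cons.
Qed.

Let multiset_continuous m k :
  continuous (fun y => distance_multiset (sq m y) k).
Proof.
move=> x.
rewrite (_ : (fun y => _) = (fun y =>
    multiset_seq [seq c p.1 y - c p.2 y | p <- index_pairs m] k)); last first.
  apply/funext => y.
  by rewrite distance_multisetE -/(distances _) distances_sq.
have [Nk|kN] := leqP (size (index_pairs m)) k.
  rewrite (_ : (fun y => _) = cst 0); first exact: cvg_cst.
  by apply/funext => y; rewrite multiset_seq_out ?size_map.
apply/cvgrPdist_le => e e0.
have e20 : 0 < e / 2 by rewrite divr_gt0.
have : \forall y \near x, forall i : 'I_m, `|c i x - c i y| <= e / 2.
  apply: filter_forall => i.
  by have /cvgrPdist_le := @cc i x; exact.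
apply: filterS => y H.
have Hp (i : nat) : (i < m)%N -> `|c i x - c i y| <= e / 2.
  by move=> im; exact: (H (Ordinal im)).
have D p : p \in index_pairs m ->
    c p.1 x - c p.2 x <= c p.1 y - c p.2 y + e /\ c p.1 y - c p.2 y <= c p.1 x - c p.2 x + e.
  move=> /index_pairsP[p12 p2].
  have := Hp _ p2; have := Hp _ (ltn_trans p12 p2).
  by rewrite !ler_norml => /andP[? ?] /andP[? ?]; split; lra.
have L := sort_map_le kN (fun p pi => (D p pi).1).
have U := sort_map_le kN (fun p pi => (D p pi).2).
rewrite ler_norml /multiset_seq; apply/andP; split; first by rewrite lerBrDr addrC lerBlDr.
by rewrite lerBlDr addrC.
Qed.

(** Only the division by the norm could break continuity; unit span at the single point [x] makes
    the norm nonzero there. The points [y] nearby need not have unit span, nor be sorted. *)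
Lemma hat_distance_continuous m k x : unit_span_multiset (mkseq (c^~ x) m) ->
  {for x, continuous (fun y => hat (distance_multiset (mkseq (c^~ y) m)) k)}.
Proof.
move=> ux; rewrite /hat.
apply: cvgM.
  by apply: cvgM; [exact: cvg_cst|exact: multiset_continuous].
have n0 : l2norm (distance_multiset (sq m x)) != 0.
  rewrite l2norm_sq gt_eqF// sqrtr_gt0.
  have := distances_sumsq_ge ux; rewrite distances_sq big_map.
  apply: lt_le_trans; rewrite divr_gt0// ltr0n.
  by have [s2 _ _ _] := ux; exact: ltn_trans s2.
apply: cvgV => //.
rewrite (_ : (fun y => _) = (fun y => Num.sqrt (sumsq (index_pairs m) y))).
  rewrite l2norm_sq.
  apply: (@continuous_comp _ _ _ (sumsq (index_pairs m)) Num.sqrt).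
    exact: sumsq_continuous.
  exact: sqrt_continuous.
by apply/funext => y; rewrite l2norm_sq.
Qed.

End hat_continuity.

Lemma continuous_diff (R : realType) (T : topologicalType) (f g : T -> R) :
  continuous f -> continuous g -> continuous (fun x => f x - g x).
Proof. by move=> cf cg x; apply: cvgB; [exact: cf|exact: cg]. Qed.

(** * The pointwise closure of the normalised distance multisets *)

Section closure_P_DIST.
Context (R : realType).
Local Notation S := {ptws nat -> R}.

Lemma ptws_coord_continuous (k : nat) : continuous (fun u : S => u k).
Proof. exact: (@proj_continuous nat (fun=> R) k). Qed.

Lemma ptws_hausdorff : hausdorff_space S.
Proof. by apply: hausdorff_product => k; exact: norm_hausdorff. Qed.

Lemma ptws_cvgP (F : set_system S) (u : S) : Filter F ->
  (forall k, g k @[g --> F] --> u k) -> F --> u.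
Proof. by move=> FF H; apply/(@pointwise_cvgP nat R F u FF). Qed.

Lemma ptws_continuous (T : topologicalType) (f : T -> S) (x : T) :
  (forall k, {for x, continuous (fun y => f y k)}) -> {for x, continuous f}.
Proof.
by move=> H; apply/(@pointwise_cvgP nat R (f @ x) (f x) _) => k; exact: (H k).
Qed.

Definition P_DIST_size m : set S :=
  [set hat (distance_multiset t) | t in
    [set t | unit_span_multiset t /\ size t = m]].

(** Multisets of size [m] are parametrised by whole sequences, of which only the first [m] terms
    count; Tychonoff's theorem then supplies the compact parameter space. *)
Let span_hat m (x : S) : S := hat (distance_multiset (mkseq x m)).

Let span_hat_continuous m (x : S) : unit_span_multiset (mkseq x m) ->
  {for x, continuous (span_hat m)}.
Proof.
move=> ux; exact: (@ptws_continuous S (span_hat m) x (fun k =>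
  @hat_distance_continuous R S (fun k u => u k) (@ptws_coord_continuous) m k x ux)).
Qed.

Let cube (a b : R) : set S := [set x | forall k, `[a, b]%classic (x k)].

Let cube_compact a b : compact (cube a b).
Proof.
apply: (@tychonoff nat (fun=> R) (fun=> `[a, b]%classic)) => k.
exact: segment_compact.
Qed.

Let closed_coord_eq k (a : R) : closed [set x : S | x k = a].
Proof.
have := @preimage_closed S R (fun x : S => x k) [set x | x = a].
by apply; [move=> x _; exact: ptws_coord_continuous|exact: closed_eq].
Qed.

Let coord k (x : S) : R := x k.

Let closed_coord_le i j : closed [set x | 0 <= coord i x - coord j x].
Proof.
have cB : continuous (fun x => coord i x - coord j x).
  exact: (@continuous_diff R S (coord i) (coord j) (@ptws_coord_continuous i)
    (@ptws_coord_continuous j)).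
have := @preimage_closed S R (fun x => coord i x - coord j x) [set x | 0 <= x].
by apply; [move=> x _; exact: cB|exact: closed_ge].
Qed.

Let span_compact m :
  compact (cube 0 1 `&` [set x | unit_span_multiset (mkseq x m)]).
Proof.
have [m2|m2] := ltnP m 2.
  rewrite (_ : _ `&` _ = set0); first exact: compact0.
  apply/seteqP; split => // x [_ []].
  by rewrite size_mkseq leqNgt m2.
have m0 : (0 < m)%N by exact: ltn_trans m2.
apply: (subclosed_compact _ (@cube_compact 0 1)) => //.
apply: closedI.
  by apply: compact_closed; [exact: ptws_hausdorff|exact: cube_compact].
rewrite (_ : mkset _ = [set x : S | x 0%N = 1] `&` ([set x | x m.-1 = 0] `&`
    \bigcap_(i in [set i | (i.+1 < m)%N]) [set x | 0 <= coord i x - coord i.+1 x])).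
  apply: closedI; first exact: closed_coord_eq.
  apply: closedI; first exact: closed_coord_eq.
  by apply: closed_bigI => i _; exact: closed_coord_le.
apply/seteqP; split => x /=.
  move=> [_ ss]; rewrite size_mkseq !nth_mkseq ?prednK// => x0 x1.
  split => //; split => // i /= im; rewrite subr_ge0 /coord.
  have := @sorted_ge_nth _ _ i i.+1 ss (leqnSn i).
  rewrite size_mkseq => /(_ im); rewrite !nth_mkseq//; exact: ltnW.
move=> [x0 [x1 H]]; split; rewrite ?size_mkseq ?nth_mkseq ?prednK//.
apply/(sortedP 0) => i; rewrite size_mkseq => im.
rewrite !nth_mkseq//; last exact: ltnW.
by have := H i im; rewrite /= subr_ge0 /coord.
Qed.

Lemma P_DIST_size_compact m : compact (P_DIST_size m).
Proof.
rewrite (_ : P_DIST_size m =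
    span_hat m @` (cube 0 1 `&` [set x | unit_span_multiset (mkseq x m)])).
  apply: continuous_compact; last exact: span_compact.
  apply: continuous_in_subspaceT => x; rewrite inE => -[_].
  exact: span_hat_continuous.
apply/seteqP; split => u.
  move=> [t [ut tm] <-].
  have tE : mkseq (nth 0 t) m = t by rewrite -tm mkseq_nth.
  exists (nth 0 t); last by rewrite /span_hat tE.
  split; last by rewrite /= tE.
  by move=> k /=; rewrite in_itv/=; exact: unit_span_ge0.
move=> [x [_ ux] <-]; exists (mkseq x m) => //; split => //.
by rewrite size_mkseq.
Qed.

Lemma P_DISTE : P_DIST R = \bigcup_m P_DIST_size m.
Proof.
apply/seteqP; split => u; first by move=> [t ut <-]; exists (size t) => //; exists t.
by move=> [m _ [t [ut _] <-]]; exists t.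
Qed.

(** An element [w] of [P_DIST] close to [v] satisfies [c < w k ^+ 2 <= 48 / m], so its size [m] is
    below [N]. Hence [v] is in the closure of finitely many compact sets [P_DIST_size m], whose
    union is closed already. *)
Lemma closure_P_DIST_bound (v : S) k (c : R) N : closure (P_DIST R) v -> 0 < c ->
  c < v k ^+ 2 -> 48 / c < N%:R -> exists2 m, (m < N)%N & P_DIST_size m v.
Proof.
move=> Pv c0 cv cN.
pose U : set S := \bigcup_(m in [set` iota 0 N]) P_DIST_size m.
have cl : closed U.
  rewrite /U bigcup_seq; apply: compact_closed; first exact: ptws_hausdorff.
  by apply: bigsetU_compact => m _; exact: P_DIST_size_compact.
suff : closure U v.
  rewrite -(closure_id _).1// => -[m /=].
  by rewrite mem_iota => /andP[_ mN] Pm; exists m.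
move=> B Bv.
have Cv : nbhs v [set w : S | c < w k ^+ 2].
  have cz : continuous (fun z : R => z ^+ 2) by exact: exprn_continuous.
  have H := @continuous_comp S R R (fun w => w k) (fun z => z ^+ 2) v
    (@ptws_coord_continuous k v) (cz (v k)).
  apply: (H [set z | c < z]); apply: open_nbhs_nbhs.
  by split; [exact: open_gt|exact: cv].
have [w [Pw [Bw /= cw]]] := Pv _ (filterI Bv Cv).
exists w; split => //; move: Pw; rewrite P_DISTE => -[m _ Pmw].
exists m => //=; rewrite mem_iota/= add0n.
have [t [ut tm] wE] := Pmw.
have [_ _ _ _ /(_ k)] := hat_distance ut; rewrite wE tm => wm.
rewrite -(ltr_nat R); apply: lt_trans cN.
have m0 : 0 < m%:R :> R.
  by rewrite ltr0n -tm; have [s2 _ _ _] := ut; exact: ltn_trans s2.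
rewrite ltr_pdivlMr// mulrC -ltr_pdivlMr//.
exact: lt_le_trans wm.
Qed.

Lemma closure_P_DIST (u : S) : closure (P_DIST R) u -> u = (fun=> 0) \/ P_DIST R u.
Proof.
move=> Pu; have [->|u0] := pselect (u = (fun=> 0)); [by left|right].
have [k uk] : exists k, u k != 0.
  apply: contrapT => /forallNP H; apply: u0; apply/funext => k.
  by apply/eqP; have /negP := H k; rewrite negbK.
have uk2 : 0 < u k ^+ 2 by rewrite lt_neqAle sqr_ge0 eq_sym expf_neq0.
have [|||m _] := @closure_P_DIST_bound u k (u k ^+ 2 / 2)
  (Num.bound (48 / (u k ^+ 2 / 2))) Pu.
- by rewrite divr_gt0.
- by rewrite ltr_pdivrMr// ltr_pMr// ltr1n.
- by apply: archi_boundP; rewrite divr_ge0// divr_ge0// ltW.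
by rewrite P_DISTE => Pm; exists m.
Qed.

(** The witnesses have one point at 1 and [m.+1] points at 0; any multisets of unit span with sizes
    tending to infinity would do, by the bound [48 / m] on the squares. *)
Lemma closure_P_DIST0 : closure (P_DIST R) (fun=> 0 : R).
Proof.
pose t m : seq R := 1 :: nseq m.+1 0.
have ut m : unit_span_multiset (t m).
  have sz : size (t m) = m.+2 := congr1 succn (size_nseq m.+1 0).
  split => //; rewrite ?sz//; last first.
    by rewrite -[LHS]/(nth 0 (nseq m.+1 0) m) nth_nseq if_same.
  by rewrite /= ler01/=; elim: m {sz} => //= m IH; rewrite lexx.
pose v m : S := hat (distance_multiset (t m)).
suff vk k : v m k @[m --> \oo] --> (0 : R).
  have cv := @ptws_cvgP (v @ \oo) (fun=> 0) _ vk.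
  move=> B /cv [m _ Bm]; exists (v m); split; last exact: (Bm m (leqnn m)).
  by exists (t m).
apply/cvgrPdist_le => e e0; near=> m; rewrite /v.
  rewrite sub0r normrN -(ler_pXn2r (n := 2))// ?nnegrE ?(ltW e0)//.
  rewrite -normrX ger0_norm ?sqr_ge0//.
  have [_ _ _ _ /(_ k) /le_trans] := hat_distance (ut m); apply.
  rewrite /= size_nseq ler_pdivrMr ?ltr0n// mulrC -ler_pdivrMr ?exprn_gt0//.
  apply: (@le_trans _ _ m%:R); last by rewrite ler_nat -addn2 leq_addr.
by near: m; exact: nbhs_infty_ger.
Unshelve. all: by end_near. Qed.

Lemma closure_P_DIST_compact : compact (closure (P_DIST R)).
Proof.
(* Squares of entries are at most 48, and [48 <= 7 ^+ 2]. *)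
apply: (subclosed_compact _ (@cube_compact (- 7) 7)).
  exact: closed_closure.
have /closure_id -> : closed (cube (- 7) 7).
  by apply: compact_closed; [exact: ptws_hausdorff|exact: cube_compact].
apply: closureS => _ [t ut <-] k /=; rewrite in_itv/= -ler_norml.
rewrite -(ler_pXn2r (n := 2))// ?nnegrE// -normrX ger0_norm ?sqr_ge0//.
have [_ _ _ _ /(_ k) /le_trans] := hat_distance ut; apply.
have [s2 _ _ _] := ut.
have m1 : 1 <= (size t)%:R :> R by rewrite ler1n; exact: ltn_trans s2.
rewrite ler_pdivrMr ?(lt_le_trans _ m1)//; lra.
Qed.

End closure_P_DIST.

(** * The Laplace transform determines the widths *)

Section mgf.
Context (R : realType).
Local Notation mR := (measurableTypeR R).
Implicit Types (a b s : seq R) (l x q K : R).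

(** This is [sinh (l x / 2) / (l x / 2)], the Laplace transform of the centred uniform law of width
    [x], written so that the growing exponential is separate from a factor tending to 1. *)
Definition sinhc l x : R := expR (l * x / 2) * (1 - expR (- (l * x))) / (l * x).

Lemma sinhc_gt0 l x : 0 < l -> 0 < x -> 0 < sinhc l x.
Proof.
move=> l0 x0; have lx : 0 < l * x by rewrite mulr_gt0.
rewrite divr_gt0// mulr_gt0 ?expR_gt0// subr_gt0 -expR0 ltr_expR; lra.
Qed.

(** What is left of the product of the [sinhc] once the exponential and the power of [l] are taken
    out. *)
Let Q s l : R := \prod_(x <- s) (1 - expR (- (l * x))).

Let posseq s := {in s, forall x, 0 < x}.

Let posseq_cons x s : posseq (x :: s) -> 0 < x /\ posseq s.
Proof.
move=> H; split; first by apply: H; rewrite mem_head.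
by move=> y ys; apply: H; rewrite in_cons ys orbT.
Qed.

Let factor_itv l x : 0 < l -> 0 < x -> 0 < 1 - expR (- (l * x)) < 1.
Proof.
move=> l0 x0; have lx : 0 < l * x by rewrite mulr_gt0.
by rewrite subr_gt0 -[X in _ < X]expR0 ltr_expR oppr_lt0 lx/= ltrBlDr ltrDl expR_gt0.
Qed.

Let Q_itv s l : 0 < l -> posseq s -> 0 < Q s l <= 1.
Proof.
move=> l0; rewrite /Q; elim: s => [_|x s IH /posseq_cons[x0 /IH/andP[s0 s1]]].
  by rewrite big_nil ltr01 lexx.
rewrite big_cons; have /andP[f0 /ltW f1] := factor_itv l0 x0.
by rewrite mulr_gt0//= mulr_ile1// ltW.
Qed.

Let Q_ge s l y : 0 < l -> posseq s -> {in s, forall x, y <= x} ->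
  1 - (size s)%:R * expR (- (l * y)) <= Q s l.
Proof.
move=> l0; rewrite /Q; elim: s => [_ _|x s IH /posseq_cons[x0 ps] ys].
  by rewrite big_nil mul0r subr0.
have yx : y <= x by apply: ys; rewrite mem_head.
have /IH : {in s, forall x, y <= x}.
  by move=> z zs; apply: ys; rewrite in_cons zs orbT.
move=> /(_ ps); rewrite -/(Q s l) => H.
have /andP[s0 s1] := Q_itv l0 ps.
have e1 : expR (- (l * x)) <= expR (- (l * y)) by rewrite ler_expR lerN2 ler_pM2l.
have e0 := expR_gt0 (- (l * x)).
rewrite big_cons -/(Q s l) /= -natr1; set E := expR (- (l * y)) in H e1 *.
set e := expR _ in e1 e0 *; set p := Q s l in s0 s1 H *.
move: H e1 e0 s0 s1; clear; set n := _%:R => H e1 e0 s0 s1.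
have : e * p <= e by rewrite ler_piMr// ltW.
rewrite mulrDl mul1r; lra.
Qed.

Lemma expR_mul_unbounded c K : 0 < c -> exists2 l, 0 < l & K < expR (l * c).
Proof.
move=> c0; exists ((`|K| + 1) / c); first by rewrite divr_gt0// ltr_wpDl.
rewrite divfK ?gt_eqF//; apply: lt_le_trans (expR_ge1Dx _).
have := ler_norm K; lra.
Qed.

(* Comparing the smallest elements: the product over a list is
   1 - m e^(- l x) (1 + o(1)) when its smallest element x has multiplicity m. *)
Let Q_inj_lt x s y t : posseq (x :: s) -> posseq (y :: t) ->
  {in y :: t, forall z, y <= z} -> x < y ->
  ~ (forall l, 0 < l -> Q (x :: s) l = Q (y :: t) l).
Proof.
move=> pxs pyt yz xy H.
have [x0 ps] := posseq_cons pxs.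
have c0 : 0 < y - x by rewrite subr_gt0.
(* For this [l] the single term [expR (- (l * x))] exceeds the sum of all the terms allowed on the
   other side, each at most [expR (- (l * y))]. *)
have [l l0 Hl] := expR_mul_unbounded (size (y :: t))%:R c0.
have := Q_ge l0 pyt yz; rewrite -H//; set n := (size _)%:R in Hl *.
rewrite /Q big_cons -/(Q s l).
have /andP[s0 s1] := Q_itv l0 ps; have /andP[f0 f1] := factor_itv l0 x0.
move=> h; have {}h : 1 - n * expR (- (l * y)) <= 1 - expR (- (l * x)).
  by apply: (le_trans h); rewrite ler_piMr// ltW.
have {}h : expR (- (l * x)) <= n * expR (- (l * y)) by lra.
move: Hl; apply/negP; rewrite -leNgt.
have -> : l * (y - x) = - (l * x) + l * y by ring.
rewrite expRD -(ler_pM2r (expR_gt0 (- (l * y)))) -mulrA -expRD subrr expR0 mulr1.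
exact: h.
Qed.

(** The smallest entries must agree; their common factor is positive and cancels, and the tails are
    compared in the same way. *)
Let Q_inj s t : sorted <=%R s -> sorted <=%R t -> posseq s -> posseq t ->
  (forall l, 0 < l -> Q s l = Q t l) -> s = t.
Proof.
have nilc x u : posseq (x :: u) -> ~ (forall l, 0 < l -> Q [::] l = Q (x :: u) l).
  move=> /posseq_cons[x0 pu] /(_ 1 ltr01); rewrite /Q big_nil big_cons -/(Q u 1).
  have /andP[u0 u1] := Q_itv ltr01 pu; have /andP[f0 f1] := factor_itv ltr01 x0.
  move=> h; have : (1 - expR (- (1 * x))) * Q u 1 < 1.
    by apply: le_lt_trans f1; rewrite ler_piMr// ltW.
  by rewrite -h ltxx.
have mins x u : sorted <=%R (x :: u) -> {in x :: u, forall z, x <= z}.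
  move=> /= su z; rewrite in_cons => /predU1P[->//|zu].
  by have /allP := order_path_min le_trans su; exact.
elim: s t => [|x s IH] [|y t] // ss st ps pt H.
- by have := nilc _ _ pt H.
- by exfalso; apply: (nilc _ _ ps) => l l0; rewrite -H.
have [xy|yx|xy] := ltgtP x y.
- by exfalso; exact: (Q_inj_lt ps pt (mins _ _ st) xy).
- by exfalso; apply: (Q_inj_lt pt ps (mins _ _ ss) yx) => l l0; rewrite H.
have [x0 ps'] := posseq_cons ps; have [y0 pt'] := posseq_cons pt.
congr (_ :: _) => //; apply: IH => //; try exact: path_sorted ss; try exact: path_sorted st.
move=> l l0; have := H l l0; rewrite /Q !big_cons -xy; apply: mulfI.
by have /andP[f0 _] := factor_itv l0 x0; rewrite gt_eqF.
Qed.

Let Q_cvg s : posseq s -> Q s l @[l --> +oo] --> (1 : R).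
Proof.
elim: s => [_|x s IH /posseq_cons[x0 /IH Hs]].
  rewrite (_ : (fun l => Q [::] l) = cst 1); first exact: cvg_cst.
  by apply/funext => l; rewrite /Q big_nil.
rewrite (_ : (fun l => Q (x :: s) l) =
    (fun l => (1 - expR (- (l * x))) * Q s l)); last first.
  by apply/funext => l; rewrite /Q big_cons.
rewrite -[X in _ --> X]mulr1; apply: cvgM; last exact: Hs.
rewrite -[X in _ --> X]subr0; apply: cvgB; first exact: cvg_cst.
apply: (cvg_comp (fun l => l * x) (fun l => expR (- l))); last exact: cvgr_expR.
by apply: gt0_cvgMly => //; exact: cvg_id.
Qed.

Let cvg_eq_pos (f g : R -> R) (c : R) : (forall l, 0 < l -> f l = g l) ->
  f l @[l --> +oo] --> c -> g l @[l --> +oo] --> c.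
Proof.
move=> fg; apply: cvg_trans; apply: near_eq_cvg; near=> l.
by rewrite fg//; near: l; exact: nbhs_pinfty_gt.
Unshelve. all: by end_near. Qed.

Let cvg_scale (f : R -> R) (c k : R) : 0 < k -> f l @[l --> +oo] --> c ->
  f (k * l) @[l --> +oo] --> c.
Proof.
move=> k0 fc; apply: (cvg_comp (fun l => k * l) f) fc.
by apply: gt0_cvgMry => //; exact: cvg_id.
Qed.

Let cst_lim (c d : R) : (fun _ : R => c) l @[l --> +oo] --> d -> c = d.
Proof.
have := @cvg_unique _ _ ((fun _ : R => c) @ +oo) _ c d (cvg_cst c).
by apply.
Qed.

(* A function K l^(n - m) e^(q l) tending to 1 is constant. *)
Let asymptotics_trivial (phi : R -> R) K q n m : 0 < K ->
  (forall l, 0 < l -> phi l = K * (l ^+ n / l ^+ m) * expR (q * l)) ->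
  phi l @[l --> +oo] --> (1 : R) -> forall l, 0 < l -> phi l = 1.
Proof.
move=> K0 H phi1.
have Kn : K != 0 by rewrite gt_eqF.
have q0 : q = 0.
  have E : expR (q * l) @[l --> +oo] --> (1 : R).
    (* In this ratio the constants and the powers of [l] cancel, as [l * (4 * l) = (2 * l) ^+ 2],
       whereas the exponents leave [q * (1 + 4 - 2 - 2) = q]. *)
    apply: (@cvg_eq_pos (fun l => phi l * phi (4 * l) / (phi (2 * l) * phi (2 * l)))).
      move=> l l0; rewrite !H ?mulr_gt0//.
      have ln : l != 0 by rewrite gt_eqF.
      have -> : expR (q * (4 * l)) = expR (q * l) ^+ 4.
        by rewrite -expRM_natl; congr expR; ring.
      have -> : expR (q * (2 * l)) = expR (q * l) ^+ 2.
        by rewrite -expRM_natl; congr expR; ring.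
      rewrite !exprMn (_ : 4 = 2 * 2 :> R); last by ring.
      rewrite !exprMn; field.
      by rewrite Kn (gt_eqF (expR_gt0 _)) !expf_neq0.
    rewrite -[X in _ --> X](_ : 1 * 1 / (1 * 1) = 1 :> R); last by rewrite !mulr1 divr1.
    have p2 := cvg_scale (ltr0n R 2 : 0 < 2) phi1.
    have p4 := cvg_scale (ltr0n R 4 : 0 < 4) phi1.
    apply: cvgM; first exact: cvgM.
    by apply: cvgV; [rewrite mulr1 oner_neq0|exact: cvgM].
  (* A shift of [l] by 1 preserves the limit but multiplies the function by [expR q], so
     [expR q = 1]. *)
  have E1 : expR (q * (l + 1)) @[l --> +oo] --> (1 : R).
    by apply: (cvg_comp (fun l => l + 1) (fun l => expR (q * l))) E; exact: cvg_addrr.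
  have E2 : expR (q * (l + 1)) @[l --> +oo] --> 1 * expR q.
    apply: (@cvg_eq_pos (fun l => expR (q * l) * expR q)).
      by move=> l _; rewrite -expRD mulrDr mulr1.
    by apply: cvgM => //; exact: cvg_cst.
  have h : 1 = expR q by rewrite -[RHS]mul1r; exact: (cvg_unique _ E1 E2).
  by apply: expR_inj; rewrite expR0.
have H' l : 0 < l -> phi l = K * (l ^+ n / l ^+ m).
  by move=> l0; rewrite H// q0 mul0r expR0 mulr1.
have nm : 2 ^+ n / 2 ^+ m = 1 :> R.
  (* Doubling [l] multiplies [phi] by the constant [2 ^+ n / 2 ^+ m]. *)
  apply: cst_lim; apply: (@cvg_eq_pos (fun l => phi (2 * l) / phi l)).
    move=> l l0; rewrite !H' ?mulr_gt0// !exprMn; field.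
    by rewrite Kn !expf_neq0// gt_eqF.
  rewrite -[X in _ --> X](_ : 1 / 1 = 1 :> R); last by rewrite divr1.
  apply: cvgM; first exact: cvg_scale.
  by apply: cvgV => //; rewrite oner_neq0.
have {}nm : n = m.
  have : (2 ^ n)%:R = (2 ^ m)%:R :> R.
    rewrite !natrX.
    have := congr1 (fun z => z * 2 ^+ m) nm.
    by rewrite /= mul1r divfK// expf_neq0// pnatr_eq0.
  by move=> /eqP; rewrite eqr_nat eqn_exp2l// => /eqP.
have H'' l : 0 < l -> phi l = K.
  by move=> l0; rewrite H'// nm divff ?mulr1// expf_neq0// gt_eqF.
have K1 : K = 1 by apply: cst_lim; exact: (cvg_eq_pos H'').
by move=> l l0; rewrite H''.
Qed.

(** Equality of the products says that [Q s l / Q t l] is a constant times a power of [l] times an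
    exponential. It also tends to 1, so it equals 1, and [Q] determines the list. The two lengths
    are not assumed equal. *)
Lemma sinhc_prod_inj s t : sorted <=%R s -> sorted <=%R t ->
  {in s, forall x, 0 < x} -> {in t, forall x, 0 < x} ->
  (forall l, 0 < l -> \prod_(x <- s) sinhc l x = \prod_(x <- t) sinhc l x) -> s = t.
Proof.
move=> ss st ps pt H; apply: Q_inj => //.
have P u l : posseq u -> 0 < l -> \prod_(x <- u) sinhc l x =
    expR (l * (\sum_(x <- u) x / 2)) * Q u l / (l ^+ size u * \prod_(x <- u) x).
  move=> + l0; elim: u => [_|x u IH /posseq_cons[x0 pu]].
    by rewrite /Q !big_nil mulr0 expR0 !mulr1 divr1.
  have up : 0 < \prod_(x <- u) x by rewrite big_seq; apply: prodr_gt0 => z /pu.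
  rewrite /Q !big_cons IH// -/(Q u l) mulrDr expRD [l * (x / 2)]mulrA.
  rewrite /sinhc [l ^+ size (x :: u)]exprS; field.
  by rewrite !gt_eqF ?exprn_gt0.
pose pi u : R := \prod_(x <- u) x.
have pi0 u : posseq u -> 0 < pi u.
  by move=> pu; rewrite /pi big_seq; apply: prodr_gt0 => z /pu.
pose sg u : R := \sum_(x <- u) x / 2.
have C : Q s l / Q t l @[l --> +oo] --> (1 : R).
  rewrite -[X in _ --> X](_ : 1 / 1 = 1 :> R); last by rewrite divr1.
  apply: cvgM; first exact: Q_cvg.
  by apply: cvgV; [rewrite oner_neq0|exact: Q_cvg].
have K0 : 0 < pi s / pi t by rewrite divr_gt0 ?pi0.
have F l : 0 < l -> Q s l / Q t l =
    pi s / pi t * (l ^+ size s / l ^+ size t) * expR ((sg t - sg s) * l).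
  move=> l0; have := H l l0; rewrite !P// -/(pi s) -/(pi t) -/(sg s) -/(sg t).
  have /andP[Qt0 _] := Q_itv l0 pt.
  have := pi0 _ ps; have := pi0 _ pt; have := expR_gt0 (l * sg s).
  have ln : 0 < l ^+ size s by rewrite exprn_gt0.
  have lm : 0 < l ^+ size t by rewrite exprn_gt0.
  rewrite mulrBl expRD expRN [sg t * l]mulrC [sg s * l]mulrC => es pt0 ps0 h.
  have {h}h : Q s l = expR (l * sg t) * Q t l / (l ^+ size t * pi t) *
      (l ^+ size s * pi s) / expR (l * sg s).
    by rewrite -h; field; rewrite !gt_eqF.
  by rewrite h; field; rewrite !gt_eqF.
move=> l l0; have := asymptotics_trivial K0 F C l0.
have /andP[Qt0 _] := Q_itv l0 pt.
by move=> /(congr1 (fun z => z * Q t l)); rewrite divfK ?gt_eqF// mul1r.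
Qed.

Local Open Scope ereal_scope.

Lemma integral_centered_uniform_exp (l x : R) : (0 < l)%R -> (0 < x)%R ->
  \int[centered_uniform x]_y (expR (l * y))%:E = (sinhc l x)%:E.
Proof.
move=> l0 x0.
have mle : measurable_fun setT (fun y : R => (expR (l * y))%:E).
  apply/measurable_EFinP; apply: (measurableT_comp (@measurable_expR R)).
  exact: mulrl_measurable.
rewrite integral_centered_uniform//.
have ab : (- (x / 2) < x / 2)%R by lra.
have D (y : R) : is_derive y 1%R (fun y : R => expR (l * y) / l)%R (expR (l * y)).
  have D1 : is_derive y 1%R (fun y : R => l * y)%R l.
    by apply: is_derive_eq; rewrite /GRing.scale/=; ring.
  have D2 := @is_derive1_comp _ expR (fun y : R => l * y)%R y _ _ (is_derive_expR _) D1.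
  have D3 : is_derive y 1%R (fun y : R => expR (l * y))%R (expR (l * y) * l)%R by exact: D2.
  by apply: is_derive_eq; rewrite /GRing.scale/=; field; rewrite gt_eqF.
have D' (y : R) : is_derive y 1%R (fun y : R => expR (l * y))%R (expR (l * y) * l)%R.
  have D1 : is_derive y 1%R (fun y : R => l * y)%R l.
    by apply: is_derive_eq; rewrite /GRing.scale/=; ring.
  exact: (@is_derive1_comp _ expR (fun y : R => l * y)%R y _ _ (is_derive_expR _) D1).
have cF : continuous (fun y : R => expR (l * y) / l : R)%R.
  by move=> y; apply: differentiable_continuous; apply/derivable1_diffP; have [] := D y.
have cf : continuous (fun y : R => expR (l * y) : R)%R.
  by move=> y; apply: differentiable_continuous; apply/derivable1_diffP; have [] := D' y.
rewrite (@continuous_FTC2 _ (fun y => expR (l * y)) (fun y => expR (l * y) / l)%R)//.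
- rewrite -EFinB -EFinM; congr EFin; rewrite /sinhc.
  rewrite (_ : l * - (x / 2) = l * x / 2 - l * x)%R; last by field.
  rewrite expRD (_ : l * (x / 2) = l * x / 2)%R; last by ring.
  by field; rewrite !gt_eqF.
- exact: continuous_subspaceT.
- split.
  + by move=> y _; have [] := D y.
  + by apply: cvg_at_right_filter; exact: cF.
  + by apply: cvg_at_left_filter; exact: cF.
- by move=> y _; rewrite derive1E; have [_ ->] := D y.
Qed.

(** Exponentials are eigenfunctions of every smoothing operator, with the Laplace transform as
    eigenvalue. *)
Lemma smooths_uniform_exp (l : R) s : (0 < l)%R -> {in s, forall x, (0 < x)%R} ->
  smooths [seq centered_uniform x | x <- s] (fun x => (expR (l * x))%:E) =
  (fun x => (expR (l * x) * \prod_(x <- s) sinhc l x)%:E).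
Proof.
move=> l0; elim: s => [_|a s IH /posseq_cons[a0 ps]].
  by apply/funext => x /=; rewrite big_nil mulr1.
rewrite /= -/(smooths _ _) IH//; apply/funext => x; rewrite /smooth big_cons.
have pr0 : (0 <= \prod_(x <- s) sinhc l x)%R.
  by rewrite big_seq; apply: prodr_ge0 => z zs; apply/ltW/sinhc_gt0 => //; exact: ps.
set p := (\prod_(x <- s) _)%R in pr0 *.
transitivity (\int[centered_uniform a]_y ((expR (l * x) * p)%:E * (expR (l * y))%:E)).
  by apply: eq_integral => y _; rewrite -EFinM; congr EFin; rewrite mulrDr expRD; ring.
have mle : measurable_fun setT (fun y : R => (expR (l * y))%:E).
  apply/measurable_EFinP; apply: (measurableT_comp (@measurable_expR R)).
  exact: mulrl_measurable.
rewrite ge0_integralZl//; try by rewrite lee_fin mulr_ge0// expR_ge0.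
by rewrite integral_centered_uniform_exp// -EFinM; congr EFin; ring.
Qed.

End mgf.

(** * Compactness, homeomorphisms and subsequences *)

Section compact_hausdorff.
Implicit Types X Y : topologicalType.

(** The map is closed: the part of [K] outside a neighbourhood of [x] is compact, so its image is
    closed and, by injectivity, misses [f x]. The point [x0] is a junk value of the inverse off the
    image. *)
Lemma compact_hausdorff_homeomorphism X Y (x0 : X) (K : set X) (f : X -> Y) :
  hausdorff_space Y -> compact K -> {within K, continuous f} ->
  set_inj K f -> homeomorphism_on K (f @` K) f.
Proof.
move=> hY cK cf injf; split=> //; first by split => //; exact: subset_refl.
pose g y : X := if pselect (exists2 x, K x & f x = y) is left h
  then projT1 (cid2 h) else x0.
have gK x : K x -> g (f x) = x.
  move=> Kx; rewrite /g; case: pselect => [h|]; last by case; exists x.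
  by case: cid2 => z /= Kz fz; apply: injf; rewrite ?inE.
exists g => //; apply/subspace_continuousP => y [x Kx fx] A.
have gy : g y = x by rewrite -fx gK.
move=> nA; have : nbhs x A by rewrite -gy; exact: nA.
rewrite nbhsE => -[W [oW Wx] WA].
have cC : compact (K `&` ~` W) by apply: compact_closedI => //; exact: open_closedC.
have cfC : closed (f @` (K `&` ~` W)).
  apply: compact_closed => //; apply: continuous_compact => //.
  by apply: continuous_subspaceW cf => z [].
have : nbhs y (~` (f @` (K `&` ~` W))).
  apply: open_nbhs_nbhs; split; first exact: closed_openC.
  move=> [z [Kz nWz] fzy]; apply: nWz.
  by rewrite (_ : z = x)//; apply: injf; rewrite ?inE// fzy.
apply: filterS => y' nfC [z Kz fz].
have gy' : g y' = z by rewrite -fz gK.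
have Az : A z by apply: WA; apply: contrapT => nWz; apply: nfC; exists z.
by move: Az; rewrite -gy'; apply.
Qed.

(** Pulls sequential compactness back from the metric space of laws to the sequence space. *)
Lemma homeomorphism_on_seq_compact X Y (K : set X) (B : set Y) (f : X -> Y) :
  homeomorphism_on K B f -> seq_compact B -> seq_compact K.
Proof.
move=> [[fKB _ Bf] _ [g gK /subspace_continuousP cg]] sB u uK.
have [n|phi phi_lt [l Bl cl]] := sB (f \o u); first by apply: fKB.
exists phi => //; exists (g l).
  by have [x Kx <-] := Bf _ Bl; rewrite gK.
move=> A /(cg _ Bl) gA.
have near_gA : \forall n \near \oo, B (f (u (phi n))) -> A (g (f (u (phi n)))).
  exact: (cl _ gA).
suff : \forall n \near \oo, A (u (phi n)) by [].
by apply: filterS near_gA => n; rewrite gK//; apply; exact: fKB.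
Qed.

Lemma metric_seq_compact (R : realType) (V : metricType R) (A : set V) :
  compact A -> seq_compact A.
Proof.
move=> cA u uA.
have uA_near : (u @ \oo) A by exists 0%N => // n _; exact: uA.
have [l [Al cl]] := cA (u @ \oo) _ uA_near.
have H (n k : nat) : exists m, (n <= m)%N /\ ball l k.+1%:R^-1 (u m).
  have := cl (u @` [set m | (n <= m)%N]) (ball l k.+1%:R^-1).
  case=> [||_ [[m nm <-] bm]]; last by exists m.
    by exists n => // m /= nm; exists m.
  by apply: nbhsx_ballx; rewrite invr_gt0 ltr0n.
pose pick n k : nat := projT1 (cid (H n k)).
have pickP n k : (n <= pick n k)%N /\ ball l k.+1%:R^-1 (u (pick n k)).
  by rewrite /pick; case: cid.
(* Each index is sought beyond the preceding one, within distance [1 / (k + 1)] of the cluster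
   point. *)
pose phi := fix F k := if k is k'.+1 then pick (F k').+1 k'.+1 else pick 0%N 0%N.
exists phi.
  by apply: homo_ltn => [y x z|k]; [exact: ltn_trans|exact: (pickP _ _).1].
have bk k : ball l k.+1%:R^-1 (u (phi k)) by case: k => [|k]; exact: (pickP _ _).2.
exists l => //; apply/cvg_ballP => e e0; near=> k.
apply: le_ball (bk k); rewrite -[leRHS]invrK lef_pV2 ?posrE ?invr_gt0//.
rewrite (@le_trans _ _ k%:R) ?ler_nat//; near: k; exact: nbhs_infty_ger.
Unshelve. all: by end_near. Qed.

End compact_hausdorff.

(** * Injectivity, and separation from the normal law *)

Section laws_of_P_DIST.
Context (R : realType).
Local Notation S := {ptws nat -> R}.
Implicit Types u v : S.

(** The positive entries are read off from the Laplace transform; they are listed in reverse because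
    the uniqueness argument peels off the smallest entry first. *)
Lemma uniform_sum_law_inj u v : P_DIST R u -> P_DIST R v ->
  uniform_sum_law u = uniform_sum_law v -> u = v.
Proof.
move=> /P_DISTP[n [n0 un un0 ud _]] /P_DISTP[m [m0 vm vm0 vd _]] uv.
have E (w : S) k : (forall i, (i < k)%N -> 0 < w i) -> (forall i, (k <= i)%N -> w i = 0) ->
    forall l, 0 < l -> (\int[uniform_sum_law w]_x (expR (l * x))%:E =
      (\prod_(x <- rev (mkseq w k)) sinhc l x)%:E)%E.
  move=> wk w0 l l0.
  rewrite (@integral_uniform_sum_law _ _ _ _ (fun x => (expR (l * x))%:E) w0
    (uniform_sum_lawP w0)).
  - rewrite (map_comp (@centered_uniform R) w) smooths_uniform_exp//.
      rewrite mulr0 expR0 mul1r; congr EFin; apply: perm_big.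
      by rewrite perm_sym perm_rev.
    by move=> _ /mapP[i + ->]; rewrite mem_iota => /andP[_]; exact: wk.
  - apply/measurable_EFinP; apply: (measurableT_comp (@measurable_expR R)).
    exact: mulrl_measurable.
  - by move=> x; rewrite lee_fin expR_ge0.
have srt (w : S) k : (forall i j, (i <= j)%N -> w j <= w i) ->
    sorted <=%R (rev (mkseq w k)).
  move=> wd; rewrite rev_sorted; apply/(sortedP 0) => i; rewrite size_mkseq => ik.
  by rewrite !nth_mkseq ?wd//; exact: ltnW.
have pos (w : S) k : (forall i, (i < k)%N -> 0 < w i) ->
    {in rev (mkseq w k), forall x, 0 < x}.
  move=> wk x; rewrite mem_rev => /mapP[i + ->].
  by rewrite mem_iota => /andP[_]; exact: wk.
have rE : rev (mkseq u n) = rev (mkseq v m).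
  apply: sinhc_prod_inj; [exact: srt|exact: srt|exact: pos|exact: pos|].
  by move=> l l0; apply: EFin_inj; rewrite -(E u n)// uv (E v m).
have uvE : mkseq u n = mkseq v m by rewrite -[LHS]revK rE revK.
have nm : n = m by have := congr1 size uvE; rewrite !size_mkseq.
apply/funext => k; have [nk|kn] := leqP n k; first by rewrite un0// vm0// -nm.
have := congr1 (nth 0 ^~ k) uvE; rewrite !nth_mkseq//; by rewrite -nm.
Qed.

Local Open Scope ereal_scope.

(** A summand of width [a] moves the argument by at most [a / 2]; charging [a] instead is wasteful
    but enough for boundedness. *)
Lemma smooths_uniform_support (s : seq R) (f : R -> \bar R) (M : R) :
  {in s, forall x, (0 < x)%R} -> measurable_fun setT f -> (forall x, 0 <= f x) ->
  (forall x, (x <= M)%R -> f x = 0) ->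
  forall x, (x <= M - \sum_(y <- s) y)%R ->
  smooths [seq centered_uniform y | y <- s] f x = 0.
Proof.
move=> + mf f0 fM; elim: s => [_ x|a s IH pas x].
  by rewrite big_nil subr0 => /fM.
have a0 : (0 < a)%R by apply: pas; rewrite mem_head.
rewrite big_cons => xM; rewrite /= -/(smooths _ _) /smooth.
rewrite integral_centered_uniform//; last 2 first.
- by apply: measurable_shift; exact: measurable_smooths.
- by move=> y; exact: smooths_ge0.
rewrite integral0_eq ?mule0// => y /=; rewrite in_itv/= => /andP[_ ya].
apply: IH; first by move=> z zs; apply: pas; rewrite in_cons zs orbT.
by move: xM a0 ya; clear; lra.
Qed.

(** On [[M + 1, M + 2]] the density is at least its value at the right end, as it decreases on the
    positive half-line. *)
Lemma std_normal_gt0 (M : R) : (0 <= M)%R ->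
  0 < std_normal R `]M, +oo[%classic.
Proof.
move=> M0; rewrite law_ofE//= /normal_prob.
have mp (A : set (measurableTypeR R)) :
    measurable_fun A (fun x => (normal_pdf 0 1 x)%:E).
  by apply: measurable_funTS; apply/measurable_EFinP; exact: measurable_normal_pdf.
have p0 : (0 < normal_pdf 0 1 (M + 2) :> R)%R.
  by rewrite normal_pdfE ?oner_neq0// mulr_gt0 ?expR_gt0// normal_peak_gt0 ?oner_neq0.
apply: (@lt_le_trans _ _ (\int[lebesgue_measure]_(x in `[(M + 1)%R, (M + 2)%R])
    (normal_pdf 0 1 (M + 2))%:E)).
  rewrite integral_cst//= lebesgue_measure_itv/= lte_fin ltrD2l ltr1n.
  rewrite -EFinB -EFinM lte_fin mulr_gt0//; lra.
apply: (@le_trans _ _ (\int[lebesgue_measure]_(x in `[(M + 1)%R, (M + 2)%R])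
    (normal_pdf 0 1 x)%:E)).
  apply: ge0_le_integral => //.
  - by move=> x _; rewrite lee_fin normal_pdf_ge0.
  move=> x /=; rewrite in_itv/= => /andP[x1 x2]; rewrite lee_fin.
  rewrite !normal_pdfE ?oner_neq0// ler_pM2l ?normal_peak_gt0 ?oner_neq0//.
  rewrite ler_expR !mulNr lerN2 ler_pM2r ?invr_gt0 ?pmulrn_lgt0 ?expr1n//.
  rewrite !subr0 ler_sqr ?nnegrE//; move: M0 x1 x2; clear; lra.
apply: ge0_subset_integral => //.
- by move=> x _; rewrite lee_fin normal_pdf_ge0.
- move=> x /=; rewrite !in_itv/= andbT => /andP[x1 _].
  by move: x1; clear; lra.
Qed.

Lemma uniform_sum_law_not_normal u : P_DIST R u ->
  uniform_sum_law u <> std_normal R.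
Proof.
move=> /P_DISTP[n [n0 un un0 ud _]] uN.
pose M : R := (\sum_(y <- mkseq u n) y)%R.
have pos : {in mkseq u n, forall x, (0 < x)%R}.
  by move=> _ /mapP[i + ->]; rewrite mem_iota => /andP[_]; exact: un.
have M0 : (0 <= M)%R by rewrite /M big_seq; apply: sumr_ge0 => x /pos/ltW.
have := std_normal_gt0 M0; rewrite -uN.
have mI : measurable_fun setT (EFin \o (\1_(`]M, +oo[%classic : set R) : R -> R)).
  by apply/measurable_EFinP; exact: measurable_indic.
have I0 x : 0 <= (EFin \o (\1_(`]M, +oo[%classic : set R) : R -> R)) x.
  by rewrite lee_fin.
suff -> : uniform_sum_law u `]M, +oo[%classic = 0 by rewrite ltxx.
transitivity (\int[uniform_sum_law u]_x
    (EFin \o (\1_(`]M, +oo[%classic : set R) : R -> R)) x).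
  by rewrite integral_indic// setIT.
rewrite (integral_uniform_sum_law un0 (uniform_sum_lawP un0) mI I0).
rewrite (map_comp (@centered_uniform R) u).
apply: (@smooths_uniform_support _ _ M) => //; last by rewrite subrr.
move=> x xM; rewrite /= indicE memNset//= in_itv/= andbT.
by apply/negP; rewrite -leNgt.
Qed.

Local Close Scope ereal_scope.

Lemma nbhs_ptws_coord u k (e : R) : 0 < e -> \forall v \near u, `|u k - v k| < e.
Proof.
move=> e0; have := @ptws_coord_continuous R k u [set y | `|u k - y| < e].
by apply; exact: nbhsx_ballx.
Qed.

End laws_of_P_DIST.

(** * Continuity of the map to laws *)

Section levy_continuity.
Context (R : realType).
Local Notation S := {ptws nat -> R}.
Implicit Types u v : S.

Lemma levy_normal_le (e : R) : 0 < e -> exists2 c : R, 0 < c &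
  forall v, P_DIST R v -> v 0%N < c ->
    levy_dist (std_normal R) (uniform_sum_law v) < e.
Proof.
move=> e0; have [h [d [h0 d0 H]]] := levy_dist_step e0.
have h3 : 0 < h ^+ 3 by rewrite exprn_gt0.
have K0 : 0 < 780 :> R by rewrite ltr0n.
have c0 : 0 < d * h ^+ 3 / 780 by exact: divr_gt0 (mulr_gt0 d0 h3) K0.
(* The bound on the largest entry for which the Lindeberg error [780 * v 0 / h ^+ 3] is at most
   [d]. *)
exists (d * h ^+ 3 / 780); first exact: c0.
move=> v /P_DISTP[n [n0 vn vn0 vd v12]] v0c.
have L a := @lindeberg R v n a h h0 n0 vn (fun k => vd _ _ (leq0n k)) v12.
have le : 780 * v 0%N / h ^+ 3 <= d.
  rewrite (ler_pdivrMr _ _ h3) mulrC -(ler_pdivlMr _ _ K0); exact: (ltW v0c).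
have I a : (\int[uniform_sum_law v]_x (step a h x)%:E =
    smooths [seq centered_uniform (v k) | k <- iota 0 n] (EFin \o step a h) 0%R)%E.
  rewrite -(integral_uniform_sum_law vn0 (uniform_sum_lawP vn0)); first by [].
    by apply/measurable_EFinP; exact: measurable_step.
  by move=> x; rewrite lee_fin step_ge0.
have {}L a := L a; move: (780 * v 0%N / h ^+ 3) le L => z zd L.
apply: H => a; rewrite I; have [L1 L2] := L a.
  by apply: (le_trans L2); apply: leeD2l; rewrite lee_fin.
by apply: (le_trans L1); apply: leeD2l; rewrite lee_fin.
Qed.

Lemma levy_near_normal (e : R) : 0 < e ->
  \forall v \near ((fun=> 0) : S), P_DIST R v ->
    levy_dist (std_normal R) (uniform_sum_law v) < e.
Proof.
move=> e0; have [c c0 H] := levy_normal_le e0.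
have N0 := @nbhs_ptws_coord R (fun=> 0) 0%N c c0.
apply: (@filterS _ (nbhs ((fun=> 0) : S)) _ _ _ _ N0) => v.
rewrite sub0r normrN => v0c Pv; apply: (H v Pv).
exact: le_lt_trans (ler_norm _) v0c.
Qed.

Lemma levy_uniform_sum_le (e : R) N : 0 < e -> exists2 d : R, 0 < d & forall u v,
  (forall k, 0 <= u k) -> (forall k, 0 <= v k) ->
  (forall k, (N <= k)%N -> u k = 0) -> (forall k, (N <= k)%N -> v k = 0) ->
  (forall k, (k < N)%N -> `|u k - v k| < d) ->
  levy_dist (uniform_sum_law u) (uniform_sum_law v) < e.
Proof.
move=> e0; have [h [d [h0 d0 H]]] := levy_dist_step e0.
(* Each of the [N] exchanges costs at most [d / N.+1], hence less than [d] in total; the successor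
   covers [N = 0]. *)
exists (d * h / N.+1%:R); first by rewrite divr_gt0 ?mulr_gt0// ltr0n.
move=> u v u0 v0 uN vN uv.
have mst a : measurable_fun setT (EFin \o step a h).
  by apply/measurable_EFinP; exact: measurable_step.
have st0 a x : (0 <= (EFin \o step a h) x)%E by rewrite lee_fin step_ge0.
have I (w : S) a : (forall k, (N <= k)%N -> w k = 0) ->
    (\int[uniform_sum_law w]_x (step a h x)%:E =
    smooths [seq centered_uniform (w k) | k <- iota 0 N] (EFin \o step a h) 0%R)%E.
  by move=> wN; rewrite -(integral_uniform_sum_law wN (uniform_sum_lawP wN)).
have D (w z : S) a : (forall k, 0 <= w k) -> (forall k, 0 <= z k) ->
    (forall k, (N <= k)%N -> w k = 0) -> (forall k, (N <= k)%N -> z k = 0) ->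
    (forall k, (k < N)%N -> `|w k - z k| < d * h / N.+1%:R) ->
    (\int[uniform_sum_law w]_x (step a h x)%:E <=
     \int[uniform_sum_law z]_x (step a h x)%:E + d%:E)%E.
  move=> w0 z0 wN zN wz; rewrite !I//.
  have c0 i : 0 <= `|w i - z i| / h by rewrite divr_ge0// ltW.
  apply: (le_trans (le_smooths_sum (M := fun k => centered_uniform (w k))
    (N := fun k => centered_uniform (z k)) (s := iota 0 N) (mst a) (st0 a) c0
    (fun i x _ => smooth_uniform_lipschitz a x (w0 i) (z0 i) h0) 0)).
  rewrite leeD2l// lee_fin.
  apply: (@le_trans _ _ (\sum_(i <- iota 0 N) d / N.+1%:R)).
    rewrite !big_seq; apply: ler_sum => i; rewrite mem_iota => /andP[_ iN].
    rewrite ler_pdivrMr// mulrAC; exact/ltW/wz.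
  rewrite big_const_seq count_predT size_iota iter_addr_0 -mulrnAr.
  rewrite ler_piMr ?(ltW d0)// -mulr_natr mulrC ler_pdivrMr ?ltr0n//.
  by rewrite mul1r ler_nat.
apply: H => a; apply: D => // k kN.
by rewrite distrC; exact: uv.
Qed.

(** Close to [u] the first entry stays above [u 0 / 2], which bounds the number of points and so the
    length of the support. The comparison then involves a fixed finite number of coordinates, and
    pointwise closeness is enough. *)
Lemma levy_near_P_DIST u (e : R) : P_DIST R u -> 0 < e ->
  \forall v \near u, closure (P_DIST R) v ->
    P_DIST R v /\ levy_dist (uniform_sum_law u) (uniform_sum_law v) < e.
Proof.
move=> Pu e0; have [n [n0 un _ _ _]] := P_DISTP Pu.
have u00 := un _ n0; pose c : R := (u 0%N / 2) ^+ 2.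
have c0 : 0 < c by rewrite exprn_gt0// divr_gt0.
pose N := Num.bound (48 / c).
have cN : 48 / c < N%:R by apply: archi_boundP; rewrite divr_ge0// ltW.
(* The sum serves as an upper bound for the number of pairs over all sizes below [N]. *)
pose N' := (\sum_(0 <= m < N) size (index_pairs m))%N.
have PN (v : S) : closure (P_DIST R) v -> c < v 0%N ^+ 2 ->
    [/\ P_DIST R v, forall k, 0 <= v k & forall k, (N' <= k)%N -> v k = 0].
  move=> Pv cv; have [m mN [t [ut tm] tv]] := closure_P_DIST_bound Pv c0 cv cN.
  have [] := hat_distance ut; rewrite tv tm => v0 _ vm _ _; split => //.
    by exists t.
  move=> k Nk; apply: vm; apply: leq_trans Nk.
  rewrite /N' big_mkord (bigD1 (Ordinal mN))//=; exact: leq_addr.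
have [|_ u0 uN'] := PN u (subset_closure Pu).
  by rewrite ltr_pXn2r// ?nnegrE ?divr_ge0 ?(ltW u00)// ltr_pdivrMr// ltr_pMr// ltr1n.
have [d d0 H] := levy_uniform_sum_le N' e0.
have near1 : \forall v \near u, forall k, (k < N')%N -> `|u k - (v : S) k| < d.
  elim: N' {PN uN' H} => [|M IH]; first by apply: (@filterE _ (nbhs u)).
  have uM := @nbhs_ptws_coord R u M d d0.
  apply: (@filterS2 _ (nbhs u) _ _ _ _ _ IH uM) => v vk vM k.
  by rewrite ltnS leq_eqVlt => /predU1P[->//|]; exact: vk.
have near2 : \forall v \near u, `|u 0%N - v 0%N| < u 0%N / 2.
  exact: (@nbhs_ptws_coord R u 0%N (u 0%N / 2) (divr_gt0 u00 (ltr0Sn _ _))).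
apply: (@filterS2 _ (nbhs u) _ _ _ _ _ near1 near2) => v v1 v2 Pv.
have [|Pv' v0 vN'] := PN v Pv.
  have v0 : u 0%N / 2 < v 0%N.
    by move: v2; rewrite ltr_norml => /andP[_]; clear; lra.
  rewrite ltr_pXn2r ?nnegrE ?divr_ge0 ?(ltW u00)//.
  by rewrite (le_trans _ (ltW v0))// divr_ge0// ltW.
split => //; apply: H => // k kN; exact: v1.
Qed.

Lemma P_DIST_neq0 u : P_DIST R u -> u <> (fun=> 0).
Proof. by move=> /P_DISTP[n [n0 un _ _ _]] u0; have := un _ n0; rewrite u0 ltxx. Qed.

Lemma Phi_DIST0 : Phi_DIST (fun=> 0 : R) = std_normal R.
Proof. by rewrite /Phi_DIST; case: asboolP. Qed.

Lemma Phi_DISTE u : P_DIST R u -> Phi_DIST u = uniform_sum_law u.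
Proof. by move=> /P_DIST_neq0 u0; rewrite /Phi_DIST; case: asboolP. Qed.

Lemma Phi_DIST_continuous : {within closure (P_DIST R), continuous (@Phi_DIST R)}.
Proof.
apply/subspace_continuousP => u Pu.
apply/metricType_numDomainType.cvgrPdist_lt => e e0.
suff : \forall v \near u, closure (P_DIST R) v ->
    levy_dist (Phi_DIST u) (Phi_DIST v) < e by [].
have [->|Pu'] := closure_P_DIST Pu.
  apply: (@filterS _ (nbhs ((fun=> 0) : S)) _ _ _ _ (levy_near_normal e0)) => v Hv Pv; rewrite Phi_DIST0.
  have [->|Pv'] := closure_P_DIST Pv; first by rewrite Phi_DIST0 levy_distxx.
  by rewrite Phi_DISTE//; exact: Hv.
apply: (@filterS _ (nbhs u) _ _ _ _ (levy_near_P_DIST Pu' e0)) => v Hv Pv.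
by have [Pv' Hv'] := Hv Pv; rewrite !Phi_DISTE.
Qed.

Lemma Phi_DIST_inj : set_inj (closure (P_DIST R)) (@Phi_DIST R).
Proof.
move=> u v /[!inE] /closure_P_DIST[->|Pu] /closure_P_DIST[->|Pv] //.
- by rewrite Phi_DIST0 Phi_DISTE// => /esym /(uniform_sum_law_not_normal Pv).
- by rewrite Phi_DIST0 Phi_DISTE// => /(uniform_sum_law_not_normal Pu).
- by rewrite !Phi_DISTE//; exact: uniform_sum_law_inj.
Qed.

Lemma Phi_DIST_image :
  @Phi_DIST R @` closure (P_DIST R) = M_DIST R `|` [set std_normal R].
Proof.
apply/seteqP; split => [_ [u /closure_P_DIST[->|Pu] <-]|mu].
- by right; rewrite Phi_DIST0.
- by left; rewrite Phi_DISTE//; have [t ut <-] := Pu; exists t.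
case=> [[t ut <-]|->].
  have Pt : P_DIST R (hat (distance_multiset t)) by exists t.
  exists (hat (distance_multiset t)); first exact: subset_closure.
  by rewrite Phi_DISTE.
exists (fun=> 0); last exact: Phi_DIST0.
exact: closure_P_DIST0.
Qed.

End levy_continuity.

(** The first clause certifies that at nonzero points [uniform_sum_law] is the one and only law of
    the sum, not its default value. The second and third together express the disjoint union. *)
Theorem theorem3p32 (R : realType) :
  [/\ (forall u : {ptws nat -> R}, closure (P_DIST R) u -> u <> (fun=> 0) ->
         [set mu | is_uniform_sum_law u mu] = [set uniform_sum_law u]),
      closure (M_DIST R) = M_DIST R `|` [set std_normal R],
      M_DIST R `&` [set std_normal R] = set0,
      homeomorphism_on (closure (P_DIST R)) (closure (M_DIST R))
        (@Phi_DIST R) &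
      [/\ compact (closure (P_DIST R)), seq_compact (closure (P_DIST R)),
          compact (closure (M_DIST R)) & seq_compact (closure (M_DIST R))]].
Proof.
have cP := @closure_P_DIST_compact R; have cPhi := @Phi_DIST_continuous R.
have hl : hausdorff_space (law R) by exact: metric_hausdorff.
have cPhiP : compact (@Phi_DIST R @` closure (P_DIST R)).
  exact: continuous_compact cPhi cP.
(* The image is compact, hence closed, and contains [M_DIST]; conversely, continuity sends the
   closure of [P_DIST] into the closure of [M_DIST]. *)
have clM : closure (M_DIST R) = @Phi_DIST R @` closure (P_DIST R).
  apply/seteqP; split.
    have /closure_id -> : closed (@Phi_DIST R @` closure (P_DIST R)).
      exact: compact_closed.
    by apply: closureS; rewrite Phi_DIST_image => mu; left.
  move=> _ [u Pu <-] B BPhi.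
  have /subspace_continuousP/(_ u Pu) := cPhi.
  move=> /(_ _ BPhi) => H; have [v [Pv Bv]] := Pu _ H.
  exists (Phi_DIST v); split; last exact/Bv/subset_closure.
  by rewrite Phi_DISTE//; have [t ut <-] := Pv; exists t.
have hom : homeomorphism_on (closure (P_DIST R)) (closure (M_DIST R)) (@Phi_DIST R).
  rewrite clM; apply: compact_hausdorff_homeomorphism => //.
  - exact: (fun=> 0).
  - exact: Phi_DIST_inj.
have sM : seq_compact (closure (M_DIST R)).
  by rewrite clM; exact: metric_seq_compact.
split => //.
- move=> u Pu u0; have [//|Pu'] := closure_P_DIST Pu.
  have [n [_ _ un0 _ _]] := P_DISTP Pu'.
  apply/seteqP; split => [mu Hmu|_ ->]; last exact: uniform_sum_lawP un0.
  exact: uniform_sum_law_uniq un0 Hmu (uniform_sum_lawP un0).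
- by rewrite clM Phi_DIST_image.
- apply/seteqP; split => // mu [[t ut <-] /= tN].
  by apply: uniform_sum_law_not_normal tN; exists t.
- by split => //; [exact: homeomorphism_on_seq_compact hom sM|rewrite clM].
Qed.
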